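(* Let $(\mathcal G,\mathcal Y)$ be a developable complex of groups, $\mathcal Y_1\subset\mathcal Y$ a connected subcomplex, and $(\mathcal G,\mathcal Y_1)$ the restriction of $(\mathcal G,\mathcal Y)$ to $\mathcal Y_1$. Consider the following conditions. (1) $(\mathcal G,\mathcal Y)$ and $(\mathcal G,\mathcal Y_1)$ are complexes of hyperbolic groups. (2) The groups $\pi_1(\mathcal G,\mathcal Y)$ and $\pi_1(\mathcal G,\mathcal Y_1)$ are both hyperbolic. (3) All the local groups of $(\mathcal G,\mathcal Y)$ are quasiconvex in $\pi_1(\mathcal G,\mathcal Y)$. (4) The induced homomorphism $\pi_1(\mathcal G,\mathcal Y_1)\to\pi_1(\mathcal G,\mathcal Y)$ is injective. (5) If $B$, $B_1$ are the universal covers of $(\mathcal G,\mathcal Y)$ and $(\mathcal G,\mathcal Y_1)$, then the natural inclusion $B_1\to B$ satisfies Mitra's criterion. If (1)-(5) hold, then the Cannon-Thurston map for the inclusion $\pi_1(\mathcal G,\mathcal Y_1)\to\pi_1(\mathcal G,\mathcal Y)$ exists. Moreover, $\pi_1(\mathcal G,\mathcal Y_1)$ is quasiconvex in $\pi_1(\mathcal G,\mathcal Y)$ if and only if the Cannon-Thurston map for the inclusion $B_1\to B$ is injective. In particular, if (1)-(4) hold and $B_1$ is quasiisometrically embedded in $B$ (via the natural map), then $\pi_1(\mathcal G,\mathcal Y_1)$ is quasiconvex in $\pi_1(\mathcal G,\mathcal Y)$.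
   Context: Complexes of groups. Let $\mathcal Y$ be a finite connected simplicial complex. Its directed edges are pairs $e=(\sigma,\tau)$ of simplices with $\tau\subsetneq\sigma$; $o(e)=\sigma$, $t(e)=\tau$. If $o(e)=t(e')$, put $e*e'=(o(e'),t(e))$. A complex of groups $(\mathcal G,\mathcal Y)$ consists of a group $G_\sigma$ (local group) for each simplex, an injective homomorphism (local map) $\psi_e:G_{o(e)}\to G_{t(e)}$ for each $e$, and elements $g_{e,e'}\in G_{t(e)}$ for composable $e,e'$ with $\mathrm{Ad}(g_{e,e'})\psi_{e*e'}=\psi_e\psi_{e'}$ and $\psi_e(g_{e',e''})g_{e,e'*e''}=g_{e,e'}g_{e*e',e''}$. Its fundamental group $\pi_1(\mathcal G,\mathcal Y)$ is generated by the groups $G_\sigma$ and symbols $k_e$, subject to the relations of the $G_\sigma$, $k_egk_e^{-1}=\psi_e(g)$ for $g\in G_{o(e)}$, $k_ek_{e'}=g_{e,e'}k_{e*e'}$, and $k_e=1$ for $e$ in a fixed maximal tree of the graph with vertices the simplices and edges the $e$'s (equivalently, it is the fundamental group of the realization of a complex of spaces with local fundamental groups $G_\sigma$). It is developable if the natural maps $G_\sigma\to G=\pi_1(\mathcal G,\mathcal Y)$ are all injective. The universal cover (development) is $B=(G\times\bigsqcup_\sigma\sigma)/\sim$ with $(gg',x)\sim(g,x)$ for $g'\in G_\sigma$, $x\in\sigma$, and, for $e=(\sigma,\sigma')$ and $x\in\sigma'\subset\sigma$, the pair $(g,x)$ with $x$ viewed in $\sigma$ is identified with $(gk_e^{-1},x)$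 with $x$ viewed in $\sigma'$. It carries the quotient metric obtained by gluing standard Euclidean simplices, and $G$ acts on it by isometries. Restricting the data to a connected subcomplex $\mathcal Y_1$ gives $(\mathcal G,\mathcal Y_1)$ (developable if $(\mathcal G,\mathcal Y)$ is), a natural homomorphism of fundamental groups and a natural equivariant map $B_1\to B$, $[h,x]\mapsto[h,x]$. A complex of hyperbolic groups is a developable complex of groups over a finite connected simplicial complex whose local groups are hyperbolic, whose local maps are quasiisometric embeddings, and whose universal cover is a hyperbolic space. Boundaries and CT maps. $\partial X$ is the (sequential) Gromov boundary of a hyperbolic geodesic space $X$; the boundary of a hyperbolic group is that of a Cayley graph. A map $f:Y\to X$ of hyperbolic spaces admits the Cannon-Thurston (CT) map if for every $\xi\in\partial Y$ and every sequence $y_n\to\xi$ in $Y$, $\{f(y_n)\}$ converges to a point of $\partial X$ depending only on $\xi$, and the resulting map $\partial f:\partial Y\to\partial X$ is continuous. Mitra's criterion for $f:Y\to X$: given $y_0\in Y$ there is a non-negative function $M(N)\to\infty$ as $N\to\infty$ such that for every geodesic segment $\lambda$ of $Y$ outside $B(y_0,N)$, any geodesic segment in $X$ joining the endpoints of $f(\lambda)$ lies outside $B(f(y_0),M(N))$. *)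

(* Defs.v *)
From HB Require Import structures.
From Stdlib Require Import Relation_Operators.
From mathcomp Require Import all_boot all_order all_algebra generic_quotient.
From mathcomp Require Import all_classical all_reals.
From mathcomp Require Import topology normedtype.

Set Implicit Arguments.
Unset Strict Implicit.
Unset Printing Implicit Defensive.

Import Order.TTheory GRing.Theory Num.Theory.
Import numFieldNormedType.Exports.

Local Open Scope classical_set_scope.
Local Open Scope ring_scope.
Local Open Scope quotient_scope.

Notation ghom := UMagmaMorphism.type.

Section Quotient.
Variables (T : choiceType) (r : T -> T -> Prop).

Definition gen_rel : rel T := fun x y => `[< clos_refl_sym_trans T r x y >].

Fact gen_rel_refl : reflexive gen_rel.
Proof. by move=> x; apply/asboolP; exact: rst_refl. Qed.

Fact gen_rel_sym : symmetric gen_rel.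
Proof. by move=> x y; apply/asboolP/asboolP; exact: rst_sym. Qed.

Fact gen_rel_trans : transitive gen_rel.
Proof. by move=> y x z /asboolP xy /asboolP yz; apply/asboolP/rst_trans/yz. Qed.

Canonical gen_equiv := EquivRel gen_rel gen_rel_refl gen_rel_sym gen_rel_trans.

Definition quot := {eq_quot gen_equiv}.
HB.instance Definition _ := Choice.on quot.
HB.instance Definition _ := EqQuotient.on quot.

Lemma quotP (x y : T) :
  clos_refl_sym_trans T r x y <-> \pi_quot x = \pi_quot y.
Proof.
split=> [xy|/eqmodP/asboolP//].
by apply/eqmodP/asboolP.
Qed.

End Quotient.

Section QuotientMap.
Variables (T T' : choiceType) (r : T -> T -> Prop) (r' : T' -> T' -> Prop).

Definition quot_map (F : T -> T') (a : quot r) : quot r' :=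
  \pi_(quot r') (F (repr a)).

Lemma quot_mapE (F : T -> T') :
  (forall x y, r x y -> r' (F x) (F y)) ->
  forall x, quot_map F (\pi_(quot r) x) = \pi_(quot r') (F x).
Proof.
move=> FE x; apply/quotP.
have: clos_refl_sym_trans T r (repr (\pi_(quot r) x)) x.
  by apply/quotP; rewrite reprK.
move: (repr _) => y yx; elim: y x / yx => [a b /FE ab|a|a b _ ab|a b c _ ab _ bc].
- exact: rst_step.
- exact: rst_refl.
- exact: rst_sym.
- exact: rst_trans bc.
Qed.

End QuotientMap.

Arguments quot_map {T T' r r'} F a.

Section Presentation.
Variable X : choiceType.

(* the letter (x, true) stands for x and (x, false) for its inverse *)
Definition word := seq (X * bool).

Definition inv_word (w : word) : word := rev [seq (l.1, ~~ l.2) | l <- w].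

Variable rels : word -> word -> Prop.

Inductive word_step : word -> word -> Prop :=
| step_cancel u v x b : word_step (u ++ [:: (x, b); (x, ~~ b)] ++ v) (u ++ v)
| step_rel u v r s : rels r s -> word_step (u ++ r ++ v) (u ++ s ++ v).

Definition presented := quot word_step.
HB.instance Definition _ := Choice.on presented.

Definition wclass (w : word) : presented := \pi_(quot word_step) w.

Lemma wclass_repr (a : presented) : wclass (repr a) = a.
Proof. exact: reprK. Qed.

Lemma wclassP u v :
  clos_refl_sym_trans word word_step u v <-> wclass u = wclass v.
Proof. exact: quotP. Qed.

Definition pres_mul (a b : presented) : presented := wclass (repr a ++ repr b).
Definition pres_one : presented := wclass [::].
Definition pres_inv (a : presented) : presented := wclass (inv_word (repr a)).

Lemma word_step_cat a b u v :
  word_step u v -> word_step (a ++ u ++ b) (a ++ v ++ b).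
Proof.
case=> [{}u {}v x c|{}u {}v r s rs].
  have := step_cancel (a ++ u) (v ++ b) x c.
  by rewrite -!catA.
have := step_rel (a ++ u) (v ++ b) rs.
by rewrite -!catA.
Qed.

Lemma wclass_cong a b u v :
  wclass u = wclass v -> wclass (a ++ u ++ b) = wclass (a ++ v ++ b).
Proof.
move/wclassP => uv; apply/wclassP.
elim: u v / uv => [x y xy|x|x y _ xy|x y z _ xy _ yz].
- exact/rst_step/word_step_cat.
- exact: rst_refl.
- exact: rst_sym.
- exact: rst_trans yz.
Qed.

Lemma wclassM u v : pres_mul (wclass u) (wclass v) = wclass (u ++ v).
Proof.
rewrite /pres_mul.
have := wclass_cong [::] (repr (wclass v)) (wclass_repr (wclass u)).
rewrite !cat0s => ->.
by have := wclass_cong u [::] (wclass_repr (wclass v)); rewrite !cats0.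
Qed.

Lemma wclassVl w : wclass (inv_word w ++ w) = pres_one.
Proof.
elim: w => [//|[x b] w IH]; rewrite /inv_word /= rev_cons cat_rcons -/(inv_word w).
rewrite -IH; apply/wclassP/rst_step.
have := step_cancel (inv_word w) w x (~~ b).
by rewrite negbK.
Qed.

Lemma wclassVr w : wclass (w ++ inv_word w) = pres_one.
Proof.
elim/last_ind: w => [//|w [x b] IH].
rewrite /inv_word map_rcons rev_rcons /= -/(inv_word w) -cats1 -catA /= -IH.
exact/wclassP/rst_step/(step_cancel w (inv_word w) x b).
Qed.

Lemma pres_mulA : associative pres_mul.
Proof.
move=> a b c; rewrite -(wclass_repr a) -(wclass_repr b) -(wclass_repr c).
by rewrite !wclassM catA.
Qed.

Lemma pres_mul1 : left_id pres_one pres_mul.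
Proof. by move=> a; rewrite -(wclass_repr a) wclassM. Qed.

Lemma pres_mulr1 : right_id pres_one pres_mul.
Proof. by move=> a; rewrite -(wclass_repr a) wclassM cats0. Qed.

Lemma pres_mulV : left_inverse pres_one pres_inv pres_mul.
Proof. by move=> a; rewrite -{2}(wclass_repr a) wclassM wclassVl. Qed.

Lemma pres_mulVr : right_inverse pres_one pres_inv pres_mul.
Proof. by move=> a; rewrite -{1}(wclass_repr a) wclassM wclassVr. Qed.

HB.instance Definition _ := isGroup.Build presented
  pres_mulA pres_mul1 pres_mulr1 pres_mulV pres_mulVr.

End Presentation.

Section PresentationMap.
Variables (X X' : choiceType) (rels : word X -> word X -> Prop).
Variables (rels' : word X' -> word X' -> Prop) (f : X -> X').

Definition word_map : word X -> word X' := map (fun l => (f l.1, l.2)).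

Hypothesis fP : forall r s, rels r s -> rels' (word_map r) (word_map s).

Definition pres_map
    (_ : forall w v, rels w v -> rels' (word_map w) (word_map v)) :
    presented rels -> presented rels' :=
  quot_map word_map.

Lemma pres_mapE w : pres_map fP (wclass rels w) = wclass rels' (word_map w).
Proof.
apply: quot_mapE => {w} _ _ [u v x b|u v r s /fP rs]; rewrite /word_map !map_cat.
  exact: step_cancel.
exact: step_rel.
Qed.

Lemma pres_mapM : {morph pres_map fP : a b / (a * b)%g}.
Proof.
move=> a b; rewrite -(wclass_repr a) -(wclass_repr b).
rewrite [X in pres_map _ X]wclassM !pres_mapE.
by rewrite [RHS]wclassM /word_map map_cat.
Qed.

Lemma pres_map_morphism : monoid.monoid_morphism (pres_map fP).
Proof. by split; [rewrite [LHS]pres_mapE|exact: pres_mapM]. Qed.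

HB.instance Definition _ := isUMagmaMorphism.Build
  (presented rels) (presented rels') (pres_map fP) pres_map_morphism.

End PresentationMap.

Record scomplex (V : finType) := SComplex {
  simplices :> {set {set V}};
  simplices_neq0 : finset.set0 \notin simplices;
  simplices_down : forall s t : {set V},
    s \in simplices -> t \subset s -> t != finset.set0 -> t \in simplices
}.

Section SimplicialComplex.
Variables (V : finType) (Y : scomplex V).

Definition simplex := {s : {set V} | s \in (Y : {set {set V}})}.
HB.instance Definition _ := Finite.on simplex.

(* (s, t) is a directed edge: t is a proper face of s *)
Definition pface (s t : simplex) : bool := val t \proper val s.

Definition edge := {e : simplex * simplex | pface e.1 e.2}.
HB.instance Definition _ := Finite.on edge.

Definition mk_edge (s t : simplex) (h : pface s t) : edge :=
  exist (fun e => is_true (pface e.1 e.2)) (s, t) h.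

Definition adj (T : {set edge}) : rel simplex := fun s t =>
  [exists e in T, (val e == (s, t)) || (val e == (t, s))].

(* the graph whose vertices are the simplices and whose edges are the pairs
   (simplex, proper face): the 1-skeleton of the barycentric subdivision *)
Definition connected_complex :=
  (exists s, s \in (Y : {set {set V}})) /\
  forall s t : simplex, connect (adj [set: edge]%SET) s t.

(* a maximal tree of a finite graph is a spanning tree; [ucycle] counts a single
   edge run back and forth as a cycle of length 2 *)
Definition maximal_tree (T : {set edge}) :=
  (forall s t : simplex, connect (adj T) s t) /\
  (forall c : seq simplex, ucycle (adj T) c -> (size c < 3)%N).

Local Open Scope group_scope.

(* [psi h] is the local map of the edge e = (s, t).  For s > t > u,
   [twist h h'] is g_{e', e} with e = (s, t) and e' = (t, u). *)
Record complex_of_groups := ComplexOfGroups {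
  loc : simplex -> groupType;
  psi : forall s t, pface s t -> ghom (loc s) (loc t);
  twist : forall s t u, pface s t -> pface t u -> loc u;
  psi_inj : forall s t (h : pface s t), injective (psi h);
  psi_comp : forall s t u (st : pface s t) (tu : pface t u) (su : pface s u) x,
    twist st tu * psi su x * (twist st tu)^-1 = psi tu (psi st x);
  twist_cocycle : forall s t u v (st : pface s t) (tu : pface t u)
      (uv : pface u v) (su : pface s u) (tv : pface t v),
    psi uv (twist st tu) * twist su uv = twist tu uv * twist st tv
}.

End SimplicialComplex.

Arguments loc {V Y} c s : rename.
Arguments psi {V Y} c {s t} h : rename.
Arguments twist {V Y} c {s t u} st tu : rename.

Section FundamentalGroup.
Variables (V : finType) (Y : scomplex V) (C : complex_of_groups Y).
Variable T : {set edge Y}.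

Definition gens : choiceType := ({s : simplex Y & loc C s} + edge Y)%type.

Definition gen_loc (s : simplex Y) (g : loc C s) : gens :=
  inl (existT (fun s => loc C s : Type) s g).
Definition gen_edge (s t : simplex Y) (h : pface s t) : gens :=
  inr (mk_edge h).

Inductive pi1_rels : word gens -> word gens -> Prop :=
| rel_loc s (g h : loc C s) :
    pi1_rels [:: (gen_loc g, true); (gen_loc h, true)]
             [:: (gen_loc (g * h)%g, true)]
| rel_conj s t (e : pface s t) (g : loc C s) :
    pi1_rels [:: (gen_edge e, true); (gen_loc g, true); (gen_edge e, false)]
             [:: (gen_loc (psi C e g), true)]
| rel_comp s t u (st : pface s t) (tu : pface t u) (su : pface s u) :
    pi1_rels [:: (gen_edge tu, true); (gen_edge st, true)]
             [:: (gen_loc (twist C st tu), true); (gen_edge su, true)]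
| rel_tree s t (e : pface s t) : mk_edge e \in T ->
    pi1_rels [:: (gen_edge e, true)] [::].

Definition pi1 : groupType := presented pi1_rels.

Definition loc_map (s : simplex Y) (g : loc C s) : pi1 :=
  wclass pi1_rels [:: (gen_loc g, true)].

Definition k_edge (s t : simplex Y) (h : pface s t) : pi1 :=
  wclass pi1_rels [:: (gen_edge h, true)].

Definition developable := forall s : simplex Y, injective (@loc_map s).

End FundamentalGroup.

Section Restriction.
Variables (V : finType) (Y Y1 : scomplex V).
Hypothesis sub : (Y1 : {set {set V}}) \subset (Y : {set {set V}}).

Definition incl (s : simplex Y1) : simplex Y :=
  exist _ (val s) (fintype.subsetP sub _ (valP s)).

Definition incl_edge (e : edge Y1) : edge Y :=
  @mk_edge V Y (incl (val e).1) (incl (val e).2) (proj2_sig e).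

Variables (C : complex_of_groups Y) (T : {set edge Y}).

Definition restrict_groups : complex_of_groups Y1 :=
  @ComplexOfGroups V Y1 (fun s => loc C (incl s))
    (fun s t h => @psi V Y C (incl s) (incl t) h)
    (fun s t u st tu => @twist V Y C (incl s) (incl t) (incl u) st tu)
    (fun s t h => @psi_inj V Y C (incl s) (incl t) h)
    (fun s t u st tu su =>
       @psi_comp V Y C (incl s) (incl t) (incl u) st tu su)
    (fun s t u v st tu uv su tv =>
       @twist_cocycle V Y C (incl s) (incl t) (incl u) (incl v) st tu uv su tv).

(* If T is a maximal tree for Y and T1 a maximal tree for Y1 contained in T, then
   T1 is exactly [restrict_tree]; for such a pair of trees the generators of the
   group of Y1 map to the generators of the same name. *)
Definition restrict_tree : {set edge Y1} := [set e | incl_edge e \in T]%SET.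

Definition incl_gens (x : gens restrict_groups) : gens C :=
  match x with
  | inl a => @gen_loc V Y C (incl (projT1 a)) (projT2 a)
  | inr e => inr (incl_edge e)
  end.

Lemma incl_rels (r s : word (gens restrict_groups)) :
  pi1_rels restrict_tree r s ->
  pi1_rels T (word_map incl_gens r) (word_map incl_gens s).
Proof.
case=> [a g h|a b e g|a b c ab bc ac|a b e] /=.
- exact: (@rel_loc _ _ C T (incl a)).
- exact: (@rel_conj _ _ C T (incl a) (incl b)).
- exact: (@rel_comp _ _ C T (incl a) (incl b) (incl c)).
- by rewrite inE => eT; exact: (@rel_tree _ _ C T (incl a) (incl b)).
Qed.

Definition natural_hom :
    ghom (pi1 restrict_groups restrict_tree) (pi1 C T) :=
  pres_map incl_rels.

Lemma natural_homE w :
  natural_hom (wclass _ w) = wclass _ (word_map incl_gens w).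
Proof. exact: pres_mapE. Qed.

End Restriction.

Record distSpace (R : realType) := DistSpace {
  dpoint :> choiceType;
  dist : dpoint -> dpoint -> R
}.

Section Gluing.
Variables (R : realType) (T : choiceType) (I : Type).
Variables (piece : T -> I) (d : T -> T -> R) (r : T -> T -> Prop).

Inductive chain : quot r -> quot r -> R -> Prop :=
| chain_nil a : chain a a 0
| chain_cons x y c l : piece x = piece y -> chain (\pi_(quot r) y) c l ->
    chain (\pi_(quot r) x) c (d x y + l).

(* the quotient pseudometric: T is the disjoint union of the pieces, d the
   metric inside a piece and r generates the gluing.  The infimum is over a
   nonempty set whenever the glued space is connected. *)
Definition glued : distSpace R :=
  @DistSpace R (quot r) (fun a b => inf [set l | chain a b l]).

End Gluing.

Section Development.
Variables (R : realType) (V : finType).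

(* barycentric coordinates; the standard simplex has edges of length sqrt 2 *)
Definition std_simplex (s : {set V}) (x : {ffun V -> R}) : bool :=
  [&& [forall v, 0 <= x v], [forall v, (v \notin s) ==> (x v == 0)]
    & \sum_v x v == 1].

Definition euclid (x y : {ffun V -> R}) : R :=
  Num.sqrt (\sum_v (x v - y v) ^+ 2).

Variables (Y : scomplex V) (C : complex_of_groups Y) (T : {set edge Y}).

Definition dev_point :=
  {p : (pi1 C T * simplex Y) * {ffun V -> R} | std_simplex (val p.1.2) p.2}.
HB.instance Definition _ := Choice.on dev_point.

Definition dev_pt (g : pi1 C T) (s : simplex Y) (x : {ffun V -> R})
    (hx : std_simplex (val s) x) : dev_point :=
  exist (fun p : (pi1 C T * simplex Y) * {ffun V -> R} =>
    is_true (std_simplex (val p.1.2) p.2)) ((g, s), x) hx.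

Inductive dev_rel : dev_point -> dev_point -> Prop :=
| dev_loc g s (g' : loc C s) x (hx : std_simplex (val s) x) :
    dev_rel (dev_pt (g * loc_map T g')%g hx) (dev_pt g hx)
| dev_edge g s t (e : pface s t) x (hs : std_simplex (val s) x)
    (ht : std_simplex (val t) x) :
    dev_rel (dev_pt g hs) (dev_pt (g * (k_edge C T e)^-1)%g ht).

Definition development : distSpace R :=
  glued (fun p : dev_point => (val p).1)
        (fun p q : dev_point => euclid (val p).2 (val q).2) dev_rel.

End Development.

Section DevelopmentMap.
Variables (R : realType) (V : finType) (Y Y1 : scomplex V).
Hypothesis sub : (Y1 : {set {set V}}) \subset (Y : {set {set V}}).
Variables (C : complex_of_groups Y) (T : {set edge Y}).

Definition dev_incl
    (p : dev_point R (restrict_groups sub C) (restrict_tree sub T)) :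
    dev_point R C T :=
  @dev_pt R V Y C T (natural_hom sub C T (val p).1.1)
    (incl sub (val p).1.2) (val p).2 (valP p).

Definition dev_map :
    development R (restrict_groups sub C) (restrict_tree sub T) ->
    development R C T :=
  quot_map dev_incl.

Lemma dev_mapE p : dev_map (\pi_(quot _) p) = \pi_(quot _) (dev_incl p).
Proof.
have inclE g s (x : {ffun V -> R}) (hx : std_simplex (val s) x) :
    dev_incl (dev_pt g hx) =
    @dev_pt R V Y C T (natural_hom sub C T g) (incl sub s) x hx.
  exact: val_inj.
apply: quot_mapE => {p} _ _ [g s g' x hx|g s t e x hs ht]; rewrite !inclE gmulfM.
- rewrite natural_homE.
  exact: (@dev_loc R V Y C T (natural_hom sub C T g) (incl sub s) g').
- rewrite gmulfV natural_homE.
  exact: (@dev_edge R V Y C T _ (incl sub s) (incl sub t) e x hs ht).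
Qed.

End DevelopmentMap.

Arguments dev_map R {V Y Y1} sub C T.

Section Hyperbolic.
Variables (R : realType) (X : distSpace R).

Definition is_metric :=
  [/\ forall x y : X, 0 <= dist x y,
      forall x y : X, dist x y = 0 <-> x = y,
      forall x y : X, dist x y = dist y x
    & forall x y z : X, dist x z <= dist x y + dist y z].

Definition geodesic_segment (x y : X) (A : set X) :=
  exists (L : R) (c : R -> X),
    [/\ 0 <= L, c 0 = x, c L = y,
        forall s t, 0 <= s <= L -> 0 <= t <= L -> dist (c s) (c t) = `|s - t|
      & A = c @` [set t | 0 <= t <= L]].

Definition geodesic_space := forall x y : X, exists A, geodesic_segment x y A.

Definition slim_triangles (delta : R) :=
  forall (x y z : X) (A B D : set X),
    geodesic_segment x y A -> geodesic_segment y z B ->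
    geodesic_segment x z D ->
    forall p, D p -> exists2 q, (A `|` B) q & dist p q <= delta.

Definition hyperbolic_space :=
  [/\ is_metric, geodesic_space & exists delta : R, slim_triangles delta].

Definition gromov_product (p x y : X) : R :=
  (dist p x + dist p y - dist x y) / 2.

Definition gromov_diverge (u v : nat -> X) :=
  forall (p : X) (M : R), exists N : nat,
    forall i j, (N <= i)%N -> (N <= j)%N -> M <= gromov_product p (u i) (v j).

Definition at_infinity (u : nat -> X) := gromov_diverge u u.

Definition boundary_class (u : nat -> X) : set (nat -> X) :=
  [set v | at_infinity v /\ gromov_diverge u v].

(* a boundary point is the set of all sequences of X that converge to it *)
Record boundary := Boundary {
  bseqs : set (nat -> X);
  bseqsP : exists2 u, at_infinity u & bseqs = boundary_class u
}.

HB.instance Definition _ := gen_eqMixin boundary.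
HB.instance Definition _ := gen_choiceMixin boundary.

Definition converges_to (u : nat -> X) (xi : boundary) := bseqs xi u.

(* the sets U(xi, M) = {eta | liminf (u_i | v_j) >= M for some u -> xi, v -> eta}
   that form the usual basis of neighbourhoods of xi *)
Definition boundary_ball (xi : boundary) (pM : X * R) : set boundary :=
  [set eta | exists u v, [/\ converges_to u xi, converges_to v eta &
    exists N : nat, forall i j, (N <= i)%N -> (N <= j)%N ->
      pM.2 <= gromov_product pM.1 (u i) (v j)]].

HB.instance Definition _ := hasNbhs.Build boundary
  (fun xi => filter_from setT (boundary_ball xi)).

End Hyperbolic.

Section Maps.
Variables (R : realType) (X Z : distSpace R) (f : X -> Z).

Definition qi_embedding := exists (k e : R), [/\ 1 <= k, 0 <= e &
  forall x y : X, dist x y / k - e <= dist (f x) (f y) /\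
                  dist (f x) (f y) <= k * dist x y + e].

Definition is_CT_map (df : boundary X -> boundary Z) :=
  (forall (xi : boundary X) (u : nat -> X),
     converges_to u xi -> converges_to (f \o u) (df xi)) /\
  continuous df.

Definition admits_CT := exists df, is_CT_map df.

Definition mitra_criterion := forall x0 : X, exists M : nat -> R,
  [/\ forall N, 0 <= M N, M N @[N --> \oo] --> +oo &
    forall (N : nat) (a b : X) (A : set X) (B : set Z),
      geodesic_segment a b A -> (forall x, A x -> N%:R <= dist x0 x) ->
      geodesic_segment (f a) (f b) B ->
      forall z, B z -> M N <= dist (f x0) z].

End Maps.

Section Cayley.
Variables (R : realType) (G : groupType) (S : seq G).

Local Open Scope group_scope.

Definition generates := forall A : {pred G},
  group_closed A -> {subset S <= A} -> forall g, g \in A.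

Definition unit_itv := {t : R | (0 <= t <= 1)%R}.
HB.instance Definition _ := Choice.on unit_itv.

Definition itv0 : unit_itv :=
  exist (fun t : R => is_true (0 <= t <= 1)%R) 0%R (introT andP (conj (lexx _) ler01)).
Definition itv1 : unit_itv :=
  exist (fun t : R => is_true (0 <= t <= 1)%R) 1%R (introT andP (conj ler01 (lexx _))).

(* the edge (g, s) is a unit interval from the vertex g to the vertex g * s *)
Definition cayley_point : choiceType :=
  (G + (G * seq_sub S) * unit_itv)%type.

Definition cayley_piece (p : cayley_point) : G + G * seq_sub S :=
  match p with inl g => inl g | inr (e, _) => inr e end.

Definition cayley_dist (p q : cayley_point) : R :=
  match p, q with
  | inr (_, t), inr (_, t') => `|val t - val t'|%R
  | _, _ => 0%R
  end.

Inductive cayley_rel : cayley_point -> cayley_point -> Prop :=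
| cayley_src g s : cayley_rel (inr ((g, s), itv0)) (inl g)
| cayley_tgt g s : cayley_rel (inr ((g, s), itv1)) (inl (g * val s)).

Definition cayley : distSpace R := glued cayley_piece cayley_dist cayley_rel.

Definition vertex (g : G) : cayley := \pi_(quot cayley_rel) (inl g).

Definition word_space : distSpace R :=
  @DistSpace R G (fun g h => dist (vertex g) (vertex h)).

End Cayley.

Section CayleyMap.
Variables (R : realType) (G H : groupType) (phi : ghom G H).
Variables (S : seq G) (S' : seq H).
Hypothesis SS' : forall s, s \in S -> phi s \in S'.

Definition cayley_pt_map (p : cayley_point R S) : cayley_point R S' :=
  match p with
  | inl g => inl (phi g)
  | inr ((g, s), t) => inr ((phi g, SeqSub (SS' (valP s))), t)
  end.

Definition cayley_map : cayley R S -> cayley R S' := quot_map cayley_pt_map.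

Lemma cayley_mapE p :
  cayley_map (\pi_(quot _) p) = \pi_(quot _) (cayley_pt_map p).
Proof.
apply: quot_mapE => {p} _ _ [g s|g s] /=.
  exact: cayley_src.
by rewrite gmulfM; exact: (cayley_tgt R (phi g) (SeqSub (SS' (valP s)))).
Qed.

End CayleyMap.

Section HyperbolicGroups.
Variable R : realType.

(* As usual for hyperbolicity, quasiconvexity and quasiisometric embeddings of
   hyperbolic groups, "for some finite generating set" is equivalent to "for
   any finite generating set". *)
Definition hyperbolic_group (G : groupType) :=
  exists2 S : seq G, generates S & hyperbolic_space (cayley R S).

Definition qi_embedded_hom (G H : groupType) (phi : ghom G H) :=
  exists (S : seq G) (S' : seq H), [/\ generates S, generates S' &
    @qi_embedding R (word_space R S) (word_space R S') phi].

Definition quasiconvex (G : groupType) (H : set G) :=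
  exists2 S : seq G, generates S & exists k : R,
    forall (h h' : G) (A : set (cayley R S)), H h -> H h' ->
      geodesic_segment (vertex R S h) (vertex R S h') A ->
      forall p, A p -> exists2 h'', H h'' & dist p (vertex R S h'') <= k.

(* the choice of generating sets is immaterial; the condition on them makes
   the Cayley graph of G map to that of H *)
Definition group_admits_CT (G H : groupType) (phi : ghom G H) :=
  forall (S : seq G) (S' : seq H) (SS' : forall s, s \in S -> phi s \in S'),
    generates S -> generates S' -> admits_CT (cayley_map (R := R) SS').

Definition complex_of_hyperbolic_groups (V : finType) (Y : scomplex V)
    (C : complex_of_groups Y) (T : {set edge Y}) :=
  [/\ developable C T,
      connected_complex Y,
      forall s, hyperbolic_group (loc C s),
      forall s t (e : pface s t), qi_embedded_hom (psi C e)
    & hyperbolic_space (development R C T)].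

End HyperbolicGroups.

(* Main.v *)
(** Write G and H for the fundamental groups of the complex and of the subcomplex.
    Each carries a word metric (d, d1) and the pseudometric (D, D1) of an orbit in the
    development B, B1.  Points of B that are close share a vertex, so D is, up to
    bounded error, d with the cosets of the quasiconvex local groups coned off.
    Hence d-geodesics are unparametrized D-quasigeodesics (Bowditch), and since H
    embeds in G the local groups of the subcomplex are quasiconvex in H as well.
    Moreover the image of a d1-geodesic whose ends are at bounded D1-distance follows
    the d-geodesic between its ends: this holds along one coset and passes to chains
    of cosets by induction.  Cutting a d1-geodesic at its first and last D1-approach
    to the identity therefore lifts Mitra's criterion from B1 -> B to H -> G.

    If H is not quasiconvex, a limit of d1-geodesics gives two d1-rays from the
    identity with distinct ends in the boundary of H and the same end in that of G.
    A D1-bounded ray is followed by its image, which is impossible here, so both rays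
    converge in the boundary of B1, to distinct points with the same image in the
    boundary of B.  Conversely, if H is quasiconvex then images of d1-geodesics are
    d-quasigeodesics, and projecting to D1 and D shows that the Cannon-Thurston map
    of B1 -> B is injective. *)

Require Import Defs.
From mathcomp Require Import generic_quotient.
From HB Require Import structures.
From mathcomp Require Import all_boot all_order all_algebra.
From mathcomp Require Import all_classical all_reals topology normedtype.
From Stdlib Require Import Relation_Operators.
From mathcomp Require Import lra zify.

Set Implicit Arguments.
Unset Strict Implicit.
Unset Printing Implicit Defensive.

Import Order.TTheory GRing.Theory Num.Theory.

Local Open Scope classical_set_scope.
Local Open Scope ring_scope.
Local Open Scope quotient_scope.

(** The orbit pseudometrics may vanish between distinct elements and carry no geodesics, and B need
    not be proper. Geometry is therefore expressed by the [excess] of a point over a pair, twice a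
    Gromov product, in pseudometrics satisfying the four-point inequality. This notion pulls back
    along coarsely dense maps, and Mitra's criterion, convergence to the boundary and the comparison
    of geodesics all become one kind of statement: bounded excess for one metric bounds the excess
    for another. Limits of geodesics are taken in H, whose balls are finite, and only then viewed in
    B1. The main obstacle is that the image of a d1-geodesic need not be a d-quasigeodesic, since
    this is the very quasiconvexity to be decided. Available beforehand is only the statement over
    pairs at bounded D1-distance; everything about H -> G is assembled from it, from the criterion
    for B1 -> B and from the passage between d and D. *)

Ltac lra_clear := clear; lra.

(** * Finite sequences of reals and a logarithmic bound *)

Lemma fun_choice (X Y : Type) (P : X -> Y -> Prop) :
  (forall x, exists y, P x y) -> exists f, forall x, P x (f x).
Proof. by move=> /choice[f h]; exists f. Qed.

Lemma ex_max_nat (R : realType) (f : nat -> R) n :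
  exists2 i, (i <= n)%N & forall j, (j <= n)%N -> f j <= f i.
Proof.
elim: n => [|n [i ni fi]]; first by exists 0%N => // j; rewrite leqn0 => /eqP->.
case: (lerP (f i) (f n.+1)) => h.
  exists n.+1 => // j; rewrite leq_eqVlt ltnS => /orP[/eqP->//|/fi jn].
  exact: le_trans h.
exists i => [|j]; first exact: leqW.
by rewrite leq_eqVlt ltnS => /orP[/eqP->|/fi//]; exact: ltW.
Qed.

Lemma ex_min_nat (R : realType) (f : nat -> R) n :
  exists2 i, (i <= n)%N & forall j, (j <= n)%N -> f i <= f j.
Proof.
have [i ni fi] := ex_max_nat (fun i => - f i) n.
by exists i => // j /fi; rewrite lerN2.
Qed.

Lemma ex_switch (P : nat -> Prop) m n : (m <= n)%N -> P m -> ~ P n ->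
  exists i, [/\ (m <= i)%N, (i < n)%N, P i & ~ P i.+1].
Proof.
elim: n => [|n IH]; first by rewrite leqn0 => /eqP->.
rewrite leq_eqVlt => /orP[/eqP->//|]; rewrite ltnS => mn Pm Pn.
have [Pn'|nP] := pselect (P n); first by exists n.
have [i [mi iN Pi Pi1]] := IH mn Pm nP.
by exists i; split=> //; exact: leqW.
Qed.

Section RealBounds.
Variable R : realType.

Lemma sqr_le_exp2 m : (m * m <= 4 * 2 ^ m)%N.
Proof.
elim: m => // m IH; rewrite expnS.
have h : (m < 2 ^ m)%N by rewrite ltn_expl.
by nia.
Qed.

Lemma linear_le_exp2 (A B : R) :
  exists m0, forall m, (m0 <= m)%N -> A * m%:R + B <= 2 ^+ m.
Proof.
exists (Num.truncn (4 * (`|A| + `|B| + 1))).+1 => m mm.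
have h0 : 0 <= 4 * (`|A| + `|B| + 1) :> R by move: (normr_ge0 A) (normr_ge0 B); lra.
have h : 4 * (`|A| + `|B| + 1) <= m%:R :> R.
  have /andP[_ /ltW h] := truncn_itv h0.
  by apply: le_trans h _; rewrite ler_nat.
have h2 : (m * m)%:R <= (4 * 2 ^ m)%:R :> R by rewrite ler_nat sqr_le_exp2.
rewrite !natrM natrX in h2.
have hA := ler_norm A; have hB := ler_norm B.
have m1 : 1 <= m%:R :> R by rewrite ler1n; apply: leq_trans mm.
move: h2 h hA hB m1 (normr_ge0 A) (normr_ge0 B).
move: (2 ^+ m) (m%:R) `|A| `|B| => e x a b; clear; intros; nra.
Qed.

(* [rho] is bounded linearly by the logarithm of [c * rho + c] *)
Lemma log_bound (a b c : R) : 0 < a -> 0 <= b -> 0 <= c -> exists2 K, 0 <= K &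
  forall rho, (forall m : nat, c * rho + c <= 2 ^+ m -> rho <= a * m%:R + b) ->
  rho <= K.
Proof.
move=> a0 b0 c0.
have [m0 hm] := linear_le_exp2 (c * a) (c * (2 * a + b) + c).
exists (a * m0.+1%:R + b) => [|rho hr].
  by rewrite addr_ge0// mulr_ge0// ltW.
rewrite leNgt; apply/negP => lt.
have rb : m0.+1%:R <= (rho - b) / a.
  by rewrite ler_pdivlMr// mulrC; move: lt; lra_clear.
have rb0 : 0 <= (rho - b) / a by apply: le_trans rb.
(* With [m + 1] the integer part of (rho - b)/a, rho exceeds a*m + b, while c*rho + c is at most
   c*(a*(m + 2) + b) + c, the linear function of [m] that [m0] was chosen for. *)
have := truncn_itv rb0; have : (m0.+1 <= Num.truncn ((rho - b) / a))%N.
  by rewrite truncn_ge_nat.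
case: (Num.truncn _) => // m; rewrite ltnS => m0m.
rewrite ler_pdivlMr// ltr_pdivrMr// => /andP[h1 h2].
have h3 : rho <= c * 0 + (a * m.+2%:R + b) by move: h2; lra_clear.
have := hr m; have := hm _ m0m.
rewrite -?natr1 in h1 h2 *; move=> h4 h5; suff : rho <= a * m%:R + b by move: h1 a0; lra_clear.
apply: h5; apply: le_trans h4.
have : c * rho <= c * (a * (m%:R + 1 + 1) + b) by apply: ler_wpM2l => //; move: h2; lra_clear.
lra_clear.
Qed.

End RealBounds.

(** * Coarse hyperbolic geometry *)

Section Excess.
Variables (R : realType) (T : Type).
Implicit Types d : T -> T -> R.

(* twice the Gromov product: how far [p] is from lying on a geodesic [a, b] *)
Definition excess d (p a b : T) : R := d p a + d p b - d a b.

Record pmet d : Prop := Pmet {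
  pmet_ge0 : forall x y, 0 <= d x y;
  pmet_xx : forall x, d x x = 0;
  pmet_sym : forall x y, d x y = d y x;
  pmet_tri : forall y x z, d x z <= d x y + d y z }.

(** Gromov's inequality at the base point [p]. It is read below as a statement on triangles: a point
    near [a, b] is near [a, c] or near [c, b]. *)
Definition four_point d k := forall c p a b,
  excess d p a c <= excess d p a b + k \/ excess d p c b <= excess d p a b + k.

(* coarsely geodesic Gromov hyperbolic *)
Record chyp d k : Prop := CHyp {
  chyp_pmet :> pmet d;
  chyp_four : four_point d k;
  chyp_geod : forall x y t, 0 <= t <= d x y ->
    exists p, d x p <= t + k /\ d p y <= d x y - t + k }.

Lemma excessC d p a b : pmet d -> excess d p a b = excess d p b a.
Proof. by move=> dP; rewrite /excess (pmet_sym dP a b); lra. Qed.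

Lemma excess_ge0 d p a b : pmet d -> 0 <= excess d p a b.
Proof.
move=> dP; have := pmet_tri dP p a b; rewrite /excess (pmet_sym dP a p); lra.
Qed.

Lemma excess_le d p a b : pmet d -> excess d p a b <= 2 * d p a.
Proof.
move=> dP; have := pmet_tri dP a p b; rewrite /excess; lra.
Qed.

Lemma excess_le2 d p a b : pmet d -> excess d p a b <= 2 * d p b.
Proof. by move=> dP; rewrite excessC//; exact: excess_le. Qed.

Lemma excess_pp d p a : pmet d -> excess d p a a = 2 * d p a.
Proof. by move=> dP; rewrite /excess (pmet_xx dP) subr0; lra. Qed.

Lemma excess_end d a b : pmet d -> excess d a a b = 0.
Proof. by move=> dP; rewrite /excess (pmet_xx dP); lra. Qed.

Lemma excess_end2 d a b : pmet d -> excess d b a b = 0.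
Proof. by move=> dP; rewrite excessC// excess_end. Qed.

Lemma excess_lip p' a' b' d p a b : pmet d ->
  excess d p a b <= excess d p' a' b' + 2 * d p p' + 2 * d a a' + 2 * d b b'.
Proof.
move=> dP; move: (pmet_tri dP p' p a) (pmet_tri dP a' p' a) (pmet_tri dP p' p b)
  (pmet_tri dP b' p' b) (pmet_tri dP a a' b') (pmet_tri dP b a b')
  (pmet_sym dP a a') (pmet_sym dP b b').
rewrite /excess; lra_clear.
Qed.

Lemma excess_move p' d p a b : pmet d ->
  excess d p a b <= excess d p' a b + 2 * d p p'.
Proof.
by move=> dP; have := excess_lip p' a b p a b dP; rewrite !(pmet_xx dP); lra.
Qed.

Lemma excess_ends x x' d p a b : pmet d ->
  excess d p a b <= excess d p x x' + excess d a p x + excess d b p x'.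
Proof.
move=> dP; move: (pmet_tri dP a x b) (pmet_tri dP b x x').
rewrite /excess (pmet_sym dP a p) (pmet_sym dP b p) (pmet_sym dP x a).
move: (pmet_sym dP x p); lra_clear.
Qed.

Section Hyperbolic.
Variables (d : T -> T -> R) (k : R).
Hypothesis dk : chyp d k.
Let dP := chyp_pmet dk.

Lemma chyp_ge0 (x : T) : 0 <= k.
Proof. by case: (chyp_four dk x x x x); lra_clear. Qed.

(** [q] is the branch point of the tripod of a, b, p on [a, b]: its distance from [a] is the Gromov
    product of p and b based at a. *)
Lemma excess_proj p a b :
  exists q, excess d q a b <= 2 * k /\ d p q <= excess d p a b / 2 + 4 * k.
Proof.
have t0 : 0 <= (d a p + d a b - d p b) / 2 <= d a b.
  move: (pmet_tri dP a p b) (pmet_tri dP p a b) (pmet_sym dP a p).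
  by move: (pmet_tri dP b a p) (pmet_sym dP b p); lra_clear.
have [q []] := chyp_geod dk t0; set t := _ / 2; move=> h1 h2.
exists q; rewrite {1}/excess (pmet_sym dP q a); split; first by move: h1 h2; lra_clear.
have te : t = (d a p + d a b - d p b) / 2 by [].
move: te; rewrite /excess (pmet_sym dP p a); clear t0.
move: (chyp_four dk p q a b) (pmet_tri dP q a b); rewrite /excess.
rewrite (pmet_sym dP q p) (pmet_sym dP q a).
by move: h1 h2; clear; move=> h1 h2 [] h h3 h4; lra.
Qed.

Lemma excess_close C e p q a b : excess d p a b <= C -> excess d q a b <= C ->
  `|d a p - d a q| <= e -> d p q <= 2 * C + k + e.
Proof.
rewrite ler_norml => hp hq /andP[h1 h2].
move: (excess_ge0 p a b dP) (chyp_four dk q p a b) hp hq.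
rewrite /excess (pmet_sym dP p a) (pmet_sym dP q a).
by move: h1 h2; clear; move=> h1 h2 h3 [] h; lra.
Qed.

Lemma excess_order C e p q a b : excess d p a b <= C -> excess d q a b <= C ->
  d a p <= d a q + e -> excess d p a q <= 4 * C + 2 * k + 2 * `|e|.
Proof.
move=> hp hq h1; have := ler_norm e; have := normr_ge0 e; have := excess_le2 p a q dP.
move: (excess_ge0 p a b dP) (chyp_four dk q p a b) (chyp_four dk p p p p) hp hq.
rewrite /excess (pmet_sym dP p a) (pmet_sym dP q a).
by move: h1; clear; move=> h1 h3 [] h [] h4; lra.
Qed.

(** Coarse convexity of geodesics. With q before q', d a b is nearly d a q + d q q' + d q' b, and
    the triangle inequality through q and q' does the rest. *)
Lemma excess_convex C u q q' a b : excess d q a b <= C -> excess d q' a b <= C ->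
  excess d u a b <= excess d u q q' + 5 * C + 2 * k.
Proof.
wlog h : q q' / d a q <= d a q' + 0.
  move=> W h1 h2; have [h|h] := lerP (d a q) (d a q').
    by apply: W => //; move: h; lra_clear.
  by rewrite (excessC u q q' dP); apply: W => //; move: h; lra_clear.
move=> h1 h2; have h3 := excess_order h1 h2 h; move: h3 h1 h2; rewrite normr0.
move: (pmet_tri dP q u a) (pmet_tri dP q' u b); rewrite /excess.
move: (pmet_sym dP q' a) (pmet_sym dP q q'); lra_clear.
Qed.

(** Each bisection of the path costs one four-point inequality, hence [k], and [m] bisections reach
    a single step. This is the source of all logarithms below. *)
Lemma excess_split_exp m (w : nat -> T) p i j : (i < j)%N -> (j - i <= 2 ^ m)%N ->
  exists l, [/\ (i <= l)%N, (l < j)%N &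
    excess d p (w l) (w l.+1) <= excess d p (w i) (w j) + k * m%:R].
Proof.
elim: m i j => [|m IH] i j ij.
  rewrite expn0 => h; exists i; split=> //.
  have -> : j = i.+1 by lia.
  by rewrite mulr0 addr0.
rewrite expnS => h; have [hm|hm] := leqP (j - i) (2 ^ m).
  have [l [il lj hl]] := IH i j ij hm; exists l; split=> //.
  have := chyp_four dk p p p p; rewrite -natr1 mulrDr mulr1.
  by move: hl; clear; move=> h [] h'; lra.
pose c := (i + 2 ^ m)%N.
have pos : (0 < 2 ^ m)%N by rewrite expn_gt0.
have ic : (i < c)%N by move: pos; rewrite /c; clear; lia.
have cj : (c < j)%N by move: hm; rewrite /c; clear; lia.
rewrite -natr1 mulrDr mulr1.
case: (chyp_four dk (w c) p (w i) (w j)) => h1.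
  have [l [il lj hl]] := IH i c ic ltac:(by rewrite /c addKn).
  exists l; split=> //; first exact: ltn_trans cj.
  by move: hl h1; lra_clear.
have hc : (j - c <= 2 ^ m)%N by move: h; rewrite /c; clear; lia.
have [l [il lj hl]] := IH c j cj hc.
exists l; split=> //; first exact: leq_trans (ltnW ic) il.
by move: hl h1; lra_clear.
Qed.

End Hyperbolic.
End Excess.

(** * Coarse geodesics with integer parameter *)

Section Paths.
Variables (R : realType) (T : Type) (d : T -> T -> R) (k : R).
Hypothesis dk : chyp d k.
Let dP := chyp_pmet dk.
Ltac lra_from := clear -dk dP; lra.

Definition coarse_path c (w : nat -> T) n := forall i j, (i <= j)%N -> (j <= n)%N ->
  d (w i) (w j) <= j%:R - i%:R + c /\ j%:R - i%:R <= d (w i) (w j) + c.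

(** [chyp_geod] chooses the points at integer times independently of each other; the four-point
    inequality compares them, whence the constant 5k + 4. The two ends are put in exactly. *)
Lemma geodesic_path a b : exists n (w : nat -> T),
  [/\ w 0%N = a, w n = b, n%:R <= d a b + 1 & coarse_path (5 * k + 4) w n].
Proof.
have k0 := chyp_ge0 dk a.
have d0 := pmet_ge0 dP a b; have [n1 n2] := andP (truncn_itv d0).
pose n := (Num.truncn (d a b)).+1.
have [q hq] : exists q : nat -> T, forall i, (i < n)%N ->
    d a (q i) <= i%:R + k /\ d (q i) b <= d a b - i%:R + k.
  apply: (@fun_choice _ _ (fun i q => (i < n)%N ->
    d a q <= i%:R + k /\ d q b <= d a b - i%:R + k)) => i.
  have [iN|iN] := ltnP i n; last by exists a.
  have ti : 0 <= (i%:R : R) <= d a b.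
    by rewrite ler0n /=; apply: le_trans n1; rewrite ler_nat -ltnS.
  by have [p hp] := chyp_geod dk ti; exists p.
pose w i := if i == 0%N then a else if i == n then b else q i.
have w0 : w 0%N = a by [].
have wn : w n = b by rewrite /w eqxx.
have hn : (n%:R : R) = (Num.truncn (d a b))%:R + 1 by rewrite /n natr1.
have U i : (i <= n)%N -> d a (w i) <= i%:R + k + 1 /\ d (w i) b <= d a b - i%:R + k + 1.
  rewrite leq_eqVlt => /orP[/eqP->|iN].
    by rewrite wn (pmet_xx dP) hn; move: n1 n2 k0; rewrite -natr1; split; lra.
  have [->|i0] := eqVneq i 0%N; first by rewrite w0 (pmet_xx dP); move: k0 d0; split; lra.
  by rewrite /w (negbTE i0) (ltn_eqF iN); have [] := hq i iN; split; lra.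
exists n, w; split=> //; first by rewrite hn; move: n1; lra.
move=> i j ij jn; have [h1 h2] := U i (leq_trans ij jn); have [h3 h4] := U j jn.
have ijR : (i%:R : R) <= j%:R by rewrite ler_nat.
move: (chyp_four dk (w j) (w i) a b) (pmet_tri dP (w i) a b) (pmet_tri dP (w j) a b)
  (pmet_tri dP (w i) a (w j)) (pmet_tri dP (w i) (w j) b)  (pmet_sym dP (w i) a).
by move: h1 h2 h3 h4 k0 ijR; rewrite /excess; clear; intros; split; lra.
Qed.

Lemma coarse_path_excess c w n i j l : coarse_path c w n ->
  (i <= j)%N -> (j <= l)%N -> (l <= n)%N -> excess d (w j) (w i) (w l) <= 3 * c.
Proof.
move=> wP ij jl ln; have [h1 _] := wP i j ij (leq_trans jl ln).
have [h2 _] := wP j l jl ln; have [_ h3] := wP i l (leq_trans ij jl) ln.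
by rewrite /excess (pmet_sym dP (w j) (w i)); move: h1 h2 h3; lra_from.
Qed.

Lemma coarse_path_near c w n C p : coarse_path c w n -> 0 <= c ->
  excess d p (w 0%N) (w n) <= C ->
  exists2 i, (i <= n)%N & d p (w i) <= 2 * C + 7 * c + k + 1.
Proof.
move=> wP c0 hp; have k0 := chyp_ge0 dk p.
have C0 := le_trans (excess_ge0 p (w 0%N) (w n) dP) hp.
have [h|h] := lerP n%:R (d (w 0%N) p).
  exists n => //; have [h1 _] := wP 0%N n (leq0n _) (leqnn _).
  move: hp h1 h k0 c0 C0; rewrite /excess (pmet_sym dP p (w 0%N)); lra_from.
have d0 := pmet_ge0 dP (w 0%N) p; have [n1 n2] := andP (truncn_itv d0).
set i := Num.truncn _ in n1 n2; have iN : (i <= n)%N.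
  by rewrite -(@ler_nat R); apply: ltW; apply: le_lt_trans h.
exists i => //.
have [h1 h2] := wP 0%N i (leq0n _) iN.
have hi := coarse_path_excess wP (leq0n _) iN (leqnn _).
have hp' : excess d p (w 0%N) (w n) <= C + 3 * c by move: hp c0; lra_from.
have hi' : excess d (w i) (w 0%N) (w n) <= C + 3 * c by move: hi C0; lra_from.
apply: le_trans (excess_close dk (e := 1 + c) hp' hi' _) _; last by move: c0; lra_from.
rewrite ler_norml; move: n1 n2 h1 h2; rewrite -natr1 subr0.
by clear; intros; apply/andP; split; lra.
Qed.

(** A discrete intermediate value theorem: the distance from [w 0] moves by jumps of at most [e], so
    it passes the value at [p], and points near a geodesic are located by their distance from one
    end. *)
Lemma path_crossing C e w n p :
  (forall i, (i <= n)%N -> excess d (w i) (w 0%N) (w n) <= C) ->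
  (forall i, (i < n)%N -> d (w i) (w i.+1) <= e) -> 0 <= e ->
  excess d p (w 0%N) (w n) <= C ->
  exists2 i, (i <= n)%N & d p (w i) <= 2 * C + k + e.
Proof.
move=> wC we e0 hp; have k0 := chyp_ge0 dk p.
have C0 := le_trans (excess_ge0 p (w 0%N) (w n) dP) hp.
pose P i := is_true (d (w 0%N) (w i) < d (w 0%N) p).
have [P0|P0] := pselect (P 0%N); last first.
  exists 0%N => //; move: P0 => /negP; rewrite -leNgt (pmet_xx dP) (pmet_sym dP _ p).
  by move: C0 k0 e0; lra_from.
have [Pn|Pn] := pselect (P n).
  exists n => //; move: Pn hp; rewrite /P /excess (pmet_sym dP p (w 0%N)).
  by move: C0 k0 e0; lra_from.
have [i [_ iN Pi /negP]] := ex_switch (leq0n _) P0 Pn; rewrite -leNgt => Pi1.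
exists i; first exact: ltnW.
apply: (excess_close dk) hp (wC _ (ltnW iN)) _.
move: Pi Pi1 (we _ iN) (pmet_tri dP (w i) (w 0%N) (w i.+1)) e0.
by rewrite /P ler_norml; clear; intros; apply/andP; split; lra.
Qed.

Lemma path_length e w n i j : (forall i, (i < n)%N -> d (w i) (w i.+1) <= e) ->
  (i <= j)%N -> (j <= n)%N -> d (w i) (w j) <= e * (j%:R - i%:R).
Proof.
move=> we; elim: j => [|j IH]; first by rewrite leqn0 => /eqP-> _; rewrite (pmet_xx dP); lra.
rewrite leq_eqVlt => /orP[/eqP-> _|ij jn]; first by rewrite (pmet_xx dP); lra.
have := IH ij (ltnW jn); have := we _ jn; have := pmet_tri dP (w j) (w i) (w j.+1).
rewrite -natr1; lra_from.
Qed.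

End Paths.

(** * Stability of quasigeodesics *)

Section Morse.
Variables (R : realType) (T : Type) (d : T -> T -> R) (k lam eps : R).
Hypotheses (dk : chyp d k) (lam0 : 0 <= lam) (eps0 : 0 <= eps).
Let dP := chyp_pmet dk.
Ltac lra_from := clear -dk dP lam0 eps0; lra.

Definition quasi_path (w : nat -> T) n :=
  (forall i j, (i <= j)%N -> (j <= n)%N -> j%:R - i%:R <= lam * d (w i) (w j) + lam) /\
  (forall i, (i < n)%N -> d (w i) (w i.+1) <= eps).

(* A point [p] of a geodesic lying at maximal distance [rho] from the path is
   bypassed by a stretch of the path of length linear in [rho] that avoids the
   [rho]-ball about [p]; in a hyperbolic space such a stretch comes within
   [O(log rho)] of [p]. *)
Lemma geodesic_near_quasi_path : exists K, forall w n N p, quasi_path w n ->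
  coarse_path d (5 * k + 4) p N -> p 0%N = w 0%N -> p N = w n ->
  forall i, (i <= N)%N -> exists2 j, (j <= n)%N & d (p i) (w j) <= K.
Proof.
pose c := 5 * k + 4; pose cc := lam * (6 * `|c| + 6).
have cc0 : 0 <= cc by rewrite mulr_ge0// addr_ge0// mulr_ge0.
have a0 : 0 < `|k| + 1 by move: (normr_ge0 k); lra_from.
have b0 : 0 <= 3 * `|c| + 2 * `|k| + eps.
  by move: (normr_ge0 k) (normr_ge0 c) eps0; lra_from.
have [K K0 hK] := log_bound a0 b0 cc0.
exists K => w n N p [wl we] pP p0 pN.
have k0 := chyp_ge0 dk (p 0%N).
have c4 : 4 <= c by rewrite /c; move: k0; lra_from.
have c0 : 0 <= c by move: c4; lra_from.
rewrite -/c in pP; rewrite (ger0_norm k0) (ger0_norm c0) in hK.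
rewrite /cc (ger0_norm c0) in hK.
have [J hJ] : exists J : nat -> nat, forall i, (J i <= n)%N /\
    forall j, (j <= n)%N -> d (p i) (w (J i)) <= d (p i) (w j).
  apply: (@fun_choice _ _ (fun i J => (J <= n)%N /\
    forall j, (j <= n)%N -> d (p i) (w J) <= d (p i) (w j))) => i.
  by have [j jn h] := ex_min_nat (fun j => d (p i) (w j)) n; exists j.
have [i iN hi] := ex_max_nat (fun i => d (p i) (w (J i))) N.
set rho := d (p i) (w (J i)) in hi.
suff rK : rho <= K by move=> l lN; exists (J l); [case: (hJ l)|exact: le_trans (hi _ lN) rK].
have r0 : 0 <= rho by exact: pmet_ge0.
have far j : (j <= n)%N -> rho <= d (p i) (w j) by case: (hJ i) => _; apply.
have M0 : 0 <= 2 * rho + 2 * c + 1 by move: r0 c0; lra_from.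
have [M1 M2] := andP (truncn_itv M0).
set M := (Num.truncn _).+1 in M2; have {}M1 : M%:R <= 2 * rho + 2 * c + 2.
  by rewrite /M -natr1; move: M1; lra_from.
(* The detour leaves the geodesic at [p x], far enough from [p i] that the leg to the path, of
   length at most rho, stays away from [p i]; at an end of the geodesic the leg is trivial. The
   choice of [M] makes 2 rho + c + 1 attainable on either side. *)
have mk_leg x j : (x <= N)%N -> (j <= n)%N -> d (p x) (w j) <= rho ->
    (2 * rho + c + 1 <= d (p i) (p x) \/ p x = w j) ->
    2 * rho <= excess d (p i) (p x) (w j).
  move=> xN jn h1 [h2|->].
    by rewrite /excess; move: h1 h2 (far j jn) r0 c0; lra_from.
  by rewrite excess_pp//; move: (far j jn); lra_from.
have [x [j1 [xi j1n xj1 xM leg1]]] : exists x j, [/\ (x <= i)%N, (j <= n)%N,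
    d (p x) (w j) <= rho, d (p i) (p x) <= M%:R + c & 2 * rho <= excess d (p i) (p x) (w j)].
  have [iM|iM] := leqP i M.
    exists 0%N, 0%N; rewrite p0 (pmet_xx dP); split=> //.
      have [h _] := pP 0%N i (leq0n _) iN; rewrite -p0 (pmet_sym dP).
      have : (i%:R : R) <= M%:R by rewrite ler_nat.
      by move: h; lra_from.
    by rewrite excess_pp//; move: (far 0%N (leq0n _)); lra_from.
  have iMi : (i - M <= i)%N by exact: leq_subr.
  have [h1 h2] := pP _ _ iMi iN; have e : ((i - M)%:R : R) = i%:R - M%:R by rewrite natrB// ltnW.
  have iMN := leq_trans iMi iN.
  exists (i - M)%N, (J (i - M)%N); split=> //; first by case: (hJ (i - M)%N).
  - exact: hi.
  - by rewrite (pmet_sym dP); move: h1; rewrite e; lra_from.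
  apply: mk_leg; [exact: iMN|by case: (hJ (i - M)%N)|exact: hi|left].
  by rewrite (pmet_sym dP); move: h2 M2; rewrite e; lra_from.
have [y [j2 [iy yN [j2n yj2 yM leg2]]]] : exists y j, [/\ (i <= y)%N, (y <= N)%N &
  [/\ (j <= n)%N,
    d (p y) (w j) <= rho, d (p i) (p y) <= M%:R + c & 2 * rho <= excess d (p i) (p y) (w j)]].
  have [iM|iM] := leqP N (i + M).
    exists N, n; rewrite pN (pmet_xx dP); split=> //; split=> //.
      have [h _] := pP i N iN (leqnn _); rewrite -pN.
      have : (N%:R : R) <= (i + M)%:R by rewrite ler_nat.
      by rewrite natrD; move: h; lra_from.
    by rewrite excess_pp//; move: (far n (leqnn _)); lra_from.
  have iMi : (i <= i + M)%N by exact: leq_addr.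
  have [h1 h2] := pP _ _ iMi (ltnW iM); rewrite natrD in h1 h2.
  exists (i + M)%N, (J (i + M)%N); split=> //; [exact: ltnW|].
  split; first by case: (hJ (i + M)%N).
  - by apply: hi; exact: ltnW.
  - by move: h1; lra_from.
  apply: mk_leg; [exact: ltnW|by case: (hJ (i + M)%N)|apply: hi; exact: ltnW|left].
  by move: h2 M2; lra_from.
have h3 := coarse_path_excess dk pP xi iy yN.
apply: hK => m hm.
have km : 0 <= k * m%:R by rewrite mulr_ge0.
suff : 2 * rho <= 3 * c + 2 * k + eps + k * m%:R.
  by move: km k0 c0 eps0 (ler0n R m); rewrite mulrDl; lra_from.
(* Two four-point inequalities make one side of the detour [p x], [w j1], [w j2], [p y] come near
   [p i]. If it is a leg, rho is bounded at once; otherwise the stretch of path between [j1] and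
   [j2] is bisected. *)
have [h|h] := chyp_four dk (w j1) (p i) (p x) (p y).
  by move: h leg1 h3 k0 eps0 km; lra_from.
have [h'|h'] := chyp_four dk (w j2) (p i) (w j1) (p y); last first.
  by rewrite excessC// in h'; move: h' h leg2 h3 k0 eps0 km; lra_from.
have key u v : (u < v)%N -> (v <= n)%N -> excess d (p i) (w u) (w v) <= 3 * c + 2 * k ->
    d (w u) (w v) <= 2 * rho + 2 * (M%:R + c) -> 2 * rho <= 3 * c + 2 * k + eps + k * m%:R.
  move=> uv vn hex hd.
  have luv : (v - u <= 2 ^ m)%N.
    rewrite -(@ler_nat R) natrB ?(ltnW uv)// natrX; apply: le_trans hm.
    apply: le_trans (wl _ _ (ltnW uv) vn) _.
    have : lam * d (w u) (w v) <= lam * (6 * rho + 6 * c + 4).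
      by rewrite ler_wpM2l//; move: hd M1; lra_from.
    have : 0 <= lam * rho by rewrite mulr_ge0.
    have : 0 <= lam * rho * c by rewrite !mulr_ge0.
    by move: lam0; lra_from.
  have [l [ul lv hl]] := excess_split_exp dk w (p i) uv luv.
  have ln := leq_trans lv vn; have := we _ ln; have := far l (ltnW ln); have := far l.+1 ln.
  by rewrite /excess in hl hex *; move: hl hex; lra_from.
have dw : d (w j1) (w j2) <= 2 * rho + 2 * (M%:R + c).
  move: (pmet_tri dP (p x) (w j1) (w j2)) (pmet_tri dP (p i) (p x) (w j2)).
  move: (pmet_tri dP (p y) (p i) (w j2)) (pmet_sym dP (p x) (w j1)) (pmet_sym dP (p x) (p i)).
  by move: xj1 yj2 xM yM; lra_from.
(* Nearest points of the path need not occur in the order of [p x] and [p y]. *)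
have [lt|lt|e] := ltngtP j1 j2.
- by apply: key lt j2n _ dw; move: h h' h3; lra_from.
- by apply: key lt j1n _ _; rewrite 1?excessC// 1?(pmet_sym dP)//; move: h h' h3; lra_from.
- move: h'; rewrite e excess_pp// => h'; move: (far j2 j2n) h h' h3 k0 eps0 km; rewrite e; lra_from.
Qed.

(** For the path to stay near the geodesic: every geodesic point is close to some vertex of the path
    before or after [l], and where this switches two such vertices are close to each other. The
    stretch between them, which contains [w l], is then short. The second part is
    [path_crossing]. *)
Lemma morse : exists2 K, 0 <= K & forall w n, quasi_path w n ->
  (forall i, (i <= n)%N -> excess d (w i) (w 0%N) (w n) <= K) /\
  (forall C p, excess d p (w 0%N) (w n) <= C ->
    exists2 i, (i <= n)%N & d p (w i) <= 2 * C + K).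
Proof.
have [K0 hK0] := geodesic_near_quasi_path.
pose c := 5 * `|k| + 4.
pose K1 := `|K0| + eps * (lam * (2 * `|K0| + 1 + c) + lam).
have c0 : 0 <= c by rewrite /c; move: (normr_ge0 k); lra_from.
have K10 : 0 <= K1 by rewrite !(addr_ge0, mulr_ge0).
exists (6 * c + 4 * K1 + `|k| + eps).
  by move: (normr_ge0 k) eps0 c0 K10; lra_from.
move=> w n wP; have k0 := chyp_ge0 dk (w 0%N).
have [N [p [p0 pN _ pP]]] := geodesic_path dk (w 0%N) (w n).
have near := hK0 _ _ _ _ wP pP p0 pN.
have KK := ler_norm K0.
have -> : `|k| = k by rewrite ger0_norm.
have ck : c = 5 * k + 4 by rewrite /c ger0_norm.
rewrite -ck in pP.
have [wl we] := wP.
have wK l : (l <= n)%N -> excess d (w l) (w 0%N) (w n) <= 3 * c + 2 * K1.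
  move=> ln.
  suff [i iN h] : exists2 i, (i <= N)%N & d (w l) (p i) <= K1.
    have := coarse_path_excess dk pP (leq0n i) iN (leqnn _); rewrite p0 pN.
    have := excess_move (p i) (w l) (w 0%N) (w n) dP.
    by move: h; lra_from.
  pose P i := exists2 j, (j <= l)%N & d (p i) (w j) <= `|K0|.
  have P0 : P 0%N by exists 0%N; rewrite ?p0 ?(pmet_xx dP).
  have fin i j j' : (i <= N)%N -> (j <= l)%N -> (l <= j')%N -> (j' <= n)%N ->
      d (p i) (w j) <= `|K0| -> d (w j) (w j') <= 2 * `|K0| + 1 + c ->
      exists2 i, (i <= N)%N & d (w l) (p i) <= K1.
    move=> iN jl lj j'n h1 h2; exists i => //.
    have := path_length dk we jl ln; have := wl _ _ (leq_trans jl lj) j'n.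
    have lj' : (l%:R : R) <= j'%:R by rewrite ler_nat.
    have : eps * (l%:R - j%:R) <= eps * (lam * (2 * `|K0| + 1 + c) + lam).
      rewrite ler_wpM2l//; have := wl _ _ (leq_trans jl lj) j'n.
      have : lam * d (w j) (w j') <= lam * (2 * `|K0| + 1 + c) by rewrite ler_wpM2l.
      by move: lj'; lra_from.
    have := pmet_tri dP (w j) (w l) (p i).
    rewrite (pmet_sym dP (w l) (w j)) (pmet_sym dP (w j) (p i)) /K1.
    by move: h1; lra_from.
  have [PN|PN] := pselect (P N).
    have [j jl hj] := PN; apply: (fin N j n) => //.
    by rewrite -pN (pmet_sym dP); move: hj c0 (normr_ge0 K0); lra_from.
  have [i [_ iN [j jl hj] nP]] := ex_switch (leq0n N) P0 PN.
  have [j' j'n hj'] := near i.+1 iN.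
  have {}hj' : d (p i.+1) (w j') <= `|K0| by exact: le_trans hj' KK.
  apply: (fin i j j') => //; first exact: ltnW.
    by rewrite leqNgt; apply/negP => lt; apply: nP; exists j' => //; exact: ltnW.
  have [h _] := pP _ _ (leqnSn i) iN; rewrite -natr1 in h.
  move: (pmet_tri dP (p i) (w j) (w j')) (pmet_tri dP (p i.+1) (p i) (w j')).
  by rewrite (pmet_sym dP (w j) (p i)); move: h hj hj'; lra_from.
split=> [i iN|C q hq].
  by apply: le_trans (wK i iN) _; move: c0 K10 k0 eps0; lra_from.
have C0 := le_trans (excess_ge0 q (w 0%N) (w n) dP) hq.
have wK' i : (i <= n)%N -> excess d (w i) (w 0%N) (w n) <= C + (3 * c + 2 * K1).
  by move/wK; move: C0; lra_from.
have hq' : excess d q (w 0%N) (w n) <= C + (3 * c + 2 * K1).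
  by move: hq c0 K10; lra_from.
have [i iN hi] := path_crossing dk wK' we eps0 hq'.
by exists i => //; move: hi; lra_from.
Qed.

End Morse.

(** * Electrified metrics *)

Section Electrification.
Variables (R : realType) (T : Type) (d D : T -> T -> R) (k kD L : R).
Hypotheses (dk : chyp d k) (Dk : chyp D kD) (L0 : 0 <= L).
Hypothesis lip : forall x y, D x y <= L * d x y + L.
Hypothesis geodesic_bounded : forall r C, exists K, forall x y p,
  D x y <= r -> excess d p x y <= C -> D x p <= K.
Let dP := chyp_pmet dk.
Let DP := chyp_pmet Dk.
Let c := 5 * k + 4.
Let cD := 5 * kD + 4.
Ltac lra_from := clear -dk dP L0 Dk DP c cD lip geodesic_bounded; lra.

(** Bisecting a D-geodesic with respect to d leaves a single D-step over which [p] has d-excess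
    linear in [m]. Projecting [p] to the d-geodesic over that step costs a distance linear in [m],
    and [geodesic_bounded] keeps this geodesic D-close to the step. *)
Lemma electric_log C : exists A B, [/\ 0 < A, 0 <= B & forall x y p m,
  excess d p x y <= C -> D x y + 1 <= 2 ^+ m ->
  exists2 u, excess D u x y <= 3 * cD & D p u <= A * m%:R + B].
Proof.
have [K hK] := geodesic_bounded (1 + cD) (2 * k).
exists (L * `|k| + 1), (L * (`|C| + 4 * `|k|) + L + `|K|).
have z1 := normr_ge0 k; have z2 := normr_ge0 C; have z3 := normr_ge0 K.
have z4 := mulr_ge0 L0 z1; have z5 := mulr_ge0 L0 z2.
have lC := ler_norm C; have lK := ler_norm K.
split; [by move: z4; lra_from|by move: z3 z4 z5 L0; lra_from|].
move=> x y p m h1 h2; have k0 := chyp_ge0 dk x; have kD0 := chyp_ge0 Dk x.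
rewrite (ger0_norm k0) in z4 *; have cD0 : 0 <= cD by rewrite /cD; move: kD0; lra_from.
have m0 := ler0n R m; have zm := mulr_ge0 z4 m0.
have [n [w [w0 wn hn wP]]] := geodesic_path Dk x y.
have hn' : (n - 0 <= 2 ^ m)%N.
  by rewrite subn0 -(@ler_nat R) natrX; move: hn h2; lra_from.
have [n0|n0] := posnP n.
  exists x; first by rewrite excess_end//; move: cD0; lra_from.
  have exy : y = x by rewrite -w0 -wn n0.
  rewrite exy excess_pp// in h1.
  have := lip p x; have : L * d p x <= L * `|C|.
    by apply: ler_wpM2l => //; move: h1 lC (pmet_ge0 dP p x); lra_from.
  by move: zm m0 z3 z4; lra_from.
have [l [_ ln hl]] := excess_split_exp dk w p n0 hn'; rewrite w0 wn in hl.
exists (w l).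
  by have := coarse_path_excess Dk wP (leq0n l) (ltnW ln) (leqnn _); rewrite w0 wn.
have [q [hq1 hq2]] := excess_proj dk p (w l) (w l.+1).
have hs : D (w l) (w l.+1) <= 1 + cD.
  by have [h _] := wP _ _ (leqnSn l) ln; rewrite -natr1 in h; move: h; rewrite /cD; lra_from.
have hwq := hK _ _ _ hs hq1.
have := lip p q; have : L * d p q <= L * (`|C| + k * m%:R + 4 * k).
  apply: ler_wpM2l => //; have km : 0 <= k * m%:R by rewrite mulr_ge0.
  by move: hq2 hl h1 lC z2 k0 km; lra_from.
move: (pmet_tri DP q p (w l)) (pmet_sym DP q (w l)) hwq lK m0 z4.
lra_from.
Qed.

(* Bowditch's argument: a point of a d-path furthest from a D-geodesic between the
   ends of the path is bypassed by a D-path of linearly bounded length. *)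
Lemma electric_path : exists2 K, 0 <= K & forall n (p : nat -> T), coarse_path d c p n ->
  forall i, (i <= n)%N -> excess D (p i) (p 0%N) (p n) <= K.
Proof.
have [A [B [A0 B0 hAB]]] := electric_log (3 * c + 2 * k).
pose L' := L * (1 + `|c|) + L; pose c3 := 3 * `|cD| + 12 * `|kD|.
have L'0 : 0 <= L' by rewrite !(addr_ge0, mulr_ge0).
have c30 : 0 <= c3 by rewrite !(addr_ge0, mulr_ge0).
have kn := normr_ge0 kD.
have a0 : 0 < 2 * A by move: A0; lra_from.
have b0 : 0 <= 2 * (B + c3) by move: B0 c30; lra_from.
have cc0 : 0 <= 3 + 8 * `|kD| + 2 * L' by move: L'0 kn; lra_from.
have [K K0 hK] := log_bound a0 b0 cc0; exists K => // n p pP.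
have [i iN hi] := ex_max_nat (fun i => excess D (p i) (p 0%N) (p n)) n.
set e := excess D (p i) (p 0%N) (p n) in hi.
suff eK : e <= K by move=> j /hi h; exact: le_trans h eK.
have k0 := chyp_ge0 dk (p 0%N); have kD0 := chyp_ge0 Dk (p 0%N).
have c0 : 0 <= c by rewrite /c; move: k0; lra_from.
have cD0 : 0 <= cD by rewrite /cD; move: kD0; lra_from.
have ec3 : c3 = 3 * cD + 12 * kD by rewrite /c3 !ger0_norm.
have e0 : 0 <= e by exact: excess_ge0.
have step j : (j < n)%N -> D (p j) (p j.+1) <= L'.
  move=> jn; have [h _] := pP _ _ (leqnSn j) jn; apply: le_trans (lip _ _) _.
  rewrite lerD2r; apply: ler_wpM2l => //; rewrite -natr1 in h.
  by rewrite ger0_norm//; move: h; lra_from.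
(* A leg of the detour: [q] is on the D-geodesic between the ends of the path, and the D-geodesic
   from [p j] to [q] avoids the ball of radius e/2 - c3 about [p i]. This holds at an end of the
   path, and also once [p j] is farther than e + 1 from [p i], because the leg has length about
   e/2. *)
pose good j q := [/\ (j <= n)%N, excess D q (p 0%N) (p n) <= 2 * kD,
  D (p j) q <= e / 2 + 4 * kD, D (p i) (p j) <= e + 1 + L' &
  forall u, excess D u (p j) q <= 3 * cD -> e / 2 - c3 <= D (p i) u].
have good_end j : j = 0%N \/ j = n -> D (p i) (p j) <= e + 1 -> good j (p j).
  move=> je h; split=> //.
  - by case: je => ->.
  - by case: je => ->; rewrite ?excess_end2// ?excess_end//; move: kD0; lra_from.
  - by rewrite (pmet_xx DP); move: e0 kD0; lra_from.
  - by move: h L'0; lra_from.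
  move=> u; rewrite excess_pp// ec3 => hu.
  have : e <= 2 * D (p i) (p j).
    by case: je => ->; [exact: excess_le|exact: excess_le2].
  by move: (pmet_tri DP u (p i) (p j)) hu kD0 cD0; lra_from.
have good_mid j : (j <= n)%N -> e + 1 < D (p i) (p j) -> D (p i) (p j) <= e + 1 + L' ->
    exists q, good j q.
  move=> jn h1 h2; have [q [hq1 hq2]] := excess_proj Dk (p j) (p 0%N) (p n).
  have hq3 : D (p j) q <= e / 2 + 4 * kD by move: hq2 (hi _ jn); lra_from.
  exists q; split=> // u; rewrite ec3 /excess (pmet_sym DP u (p j)) => hu.
  move: (pmet_tri DP u (p i) (p j)) (pmet_sym DP u (p j)) (pmet_ge0 DP u q).
  by move: hu hq3 h1 kD0 cD0; lra_from.
have [j1 [q1 [j1i [j1n g11 g12 g13 g14]]]] : exists j q, (j <= i)%N /\ good j q.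
  pose P j := is_true (e + 1 < D (p i) (p j)).
  have [P0|/negP P0] := pselect (P 0%N); last first.
    by exists 0%N, (p 0%N); split=> //; apply: good_end; [left|rewrite leNgt].
  have Pi : ~ P i by apply/negP; rewrite -leNgt (pmet_xx DP); move: e0; lra_from.
  have [j [_ ji Pj /negP]] := ex_switch (leq0n i) P0 Pi; rewrite -leNgt => Pj1.
  have jn := leq_trans ji iN.
  have hj2 : D (p i) (p j) <= e + 1 + L'.
    move: (pmet_tri DP (p j.+1) (p i) (p j)) (step j jn) (pmet_sym DP (p j) (p j.+1)).
    by move: Pj1; lra_from.
  by have [q g] := good_mid j (ltnW jn) Pj hj2; exists j, q; split=> //; exact: ltnW.
have [j2 [q2 [ij2 [j2n g21 g22 g23 g24]]]] : exists j q, (i <= j)%N /\ good j q.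
  pose P j := is_true (D (p i) (p j) <= e + 1).
  have [Pn|Pn] := pselect (P n).
    by exists n, (p n); split=> //; apply: good_end => //; right.
  have Pi : P i by rewrite /P (pmet_xx DP); move: e0; lra_from.
  have [j [ij jn Pj /negP]] := ex_switch iN Pi Pn; rewrite -ltNge => Pj1.
  have hj2 : D (p i) (p j.+1) <= e + 1 + L'.
    move: (pmet_tri DP (p j) (p i) (p j.+1)) (step j jn).
    by move: Pj; rewrite /P; lra_from.
  by have [q g] := good_mid j.+1 jn Pj1 hj2; exists j.+1, q; split=> //; exact: leqW.
apply: hK => m hm.
have hB u : D (p i) u <= A * m%:R + B -> e / 2 - c3 <= D (p i) u ->
    e <= 2 * A * m%:R + 2 * (B + c3).
  by move=> h1 h2; move: h1 h2; lra_from.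
have eL : e * (3 + 8 * kD + 2 * L') >= 3 * e.
  rewrite mulrC; apply: ler_wpM2l => //; move: kD0 L'0; lra_from.
rewrite (ger0_norm kD0) in hm.
have len x y : D x y <= 3 * e + 8 * kD + 2 + 2 * L' -> D x y + 1 <= 2 ^+ m.
  by move=> h; apply: le_trans hm; move: h eL; lra_from.
have h3 := coarse_path_excess dk pP j1i ij2 j2n.
have [h|h] := chyp_four dk q1 (p i) (p j1) (p j2).
  have [||u hu1 hu2] := hAB (p j1) q1 (p i) m.
  - by move: h h3 k0; lra_from.
  - by apply: len; move: g12 e0 kD0 L'0; lra_from.
  exact: hB hu2 (g14 u hu1).
have [h'|h'] := chyp_four dk q2 (p i) q1 (p j2); last first.
  rewrite excessC// in h'; have [||u hu1 hu2] := hAB (p j2) q2 (p i) m.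
  - by move: h' h h3 k0; lra_from.
  - by apply: len; move: g22 e0 kD0 L'0; lra_from.
  exact: hB hu2 (g24 u hu1).
have [||u hu1 hu2] := hAB q1 q2 (p i) m.
- by move: h' h h3 k0; lra_from.
- apply: len; move: (pmet_tri DP (p j1) q1 q2) (pmet_tri DP (p i) (p j1) q2).
  move: (pmet_tri DP (p j2) (p i) q2) (pmet_sym DP q1 (p j1)) (pmet_sym DP (p i) (p j1)).
  by move: g12 g13 g22 g23; lra_from.
(* The middle side runs along the D-geodesic between [p 0] and [p n], from which [p i] has distance
   about e/2. *)
apply: hB hu2 _; have := excess_convex Dk u g11 g21.
have := excess_move u (p i) (p 0%N) (p n) DP; rewrite -/e ec3.
by move: hu1 kD0 cD0; lra_from.
Qed.

Lemma electric_excess C : exists2 K, 0 <= K & forall p a b,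
  excess d p a b <= C -> excess D p a b <= K.
Proof.
have [K K0 hK] := electric_path.
pose Z := 2 * `|C| + 7 * `|c| + `|k| + 1.
have Z0 : 0 <= Z by rewrite !(addr_ge0, mulr_ge0).
exists (K + 2 * (L * Z + L)); first by rewrite !(addr_ge0, mulr_ge0).
move=> p a b h; have k0 := chyp_ge0 dk p.
have c0 : 0 <= c by rewrite /c; move: k0; lra_from.
have [n [w [w0 wn _ wP]]] := geodesic_path dk a b.
rewrite -w0 -wn in h *.
have [i iN hi] := coarse_path_near dk wP c0 h.
have := hK _ _ wP i iN; have := excess_move (w i) p (w 0%N) (w n) DP.
have := lip p (w i); have : L * d p (w i) <= L * Z.
  apply: ler_wpM2l => //; apply: le_trans hi _; rewrite /Z (ger0_norm c0) (ger0_norm k0).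
  by rewrite -/c; move: (ler_norm C); lra_from.
lra_from.
Qed.

(** The converse half of the statement on unparametrized quasigeodesics: the d-path has bounded
    D-steps and stays near the D-geodesic, so it passes close to all of it. *)
Lemma electric_near_path C : exists2 K, 0 <= K & forall n (p : nat -> T) w,
  coarse_path d c p n -> excess D w (p 0%N) (p n) <= C ->
  exists2 i, (i <= n)%N & D w (p i) <= K.
Proof.
have [K K0 hK] := electric_path.
have z1 := normr_ge0 c; have z2 := normr_ge0 kD; have z3 := normr_ge0 C.
have z4 := mulr_ge0 L0 z1.
exists (2 * (`|C| + K) + `|kD| + (L * (1 + `|c|) + L)).
  by move: z2 z3 z4 K0 L0; lra_from.
move=> n p w pP hw; have k0 := chyp_ge0 dk w; have kD0 := chyp_ge0 Dk w.
have c0 : 0 <= c by rewrite /c; move: k0; lra_from.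
rewrite (ger0_norm kD0).
apply: (path_crossing Dk).
- by move=> i /(hK _ _ pP); move: z3; lra_from.
- move=> i iN; have [h _] := pP _ _ (leqnSn i) iN; apply: le_trans (lip _ _) _.
  rewrite lerD2r; apply: ler_wpM2l => //; rewrite -natr1 in h.
  by rewrite ger0_norm//; move: h; lra_from.
- by move: z4 L0; lra_from.
- by move: (ler_norm C) hw K0; lra_from.
Qed.

Lemma electric_near C : exists2 K, 0 <= K & forall w a b, excess D w a b <= C ->
  exists2 p, excess d p a b <= 3 * c & D w p <= K.
Proof.
have [K K0 hK] := electric_near_path C; exists K => // w a b.
have [n [p [p0 pn _ pP]]] := geodesic_path dk a b.
rewrite -p0 -pn => /(hK _ _ _ pP)[i iN hi]; exists (p i) => //.
exact: (coarse_path_excess dk pP (leq0n i) iN (leqnn n)).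
Qed.

End Electrification.

(** * Chains of quasiconvex pieces and their images *)

Section Pieces.
Variables (R : realType) (T : Type) (d : T -> T -> R) (F : set (set T)).

Definition near_piece e x y := exists A x' y',
  [/\ F A, A x', A y', d x x' <= e & d y y' <= e].

Fixpoint link e n x y := if n is m.+1 then exists2 z, near_piece e x z & link e m z y
  else x = y.

Definition qc_family := forall C, exists K, forall A x y p,
  F A -> A x -> A y -> excess d p x y <= C -> exists2 z, A z & d p z <= K.

Variables (D : T -> T -> R) (k L c e : R).
Hypotheses (dk : chyp d k) (DP : pmet D) (L0 : 0 <= L) (e0 : 0 <= e) (Fqc : qc_family).
Hypothesis lip : forall x y, D x y <= L * d x y + L.
Hypothesis piece_bounded : forall A x y, F A -> A x -> A y -> D x y <= c.
Let dP := chyp_pmet dk.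
Ltac lra_from := clear -dk DP L0 e0 Fqc lip piece_bounded dP; lra.

Let lip_le x y r : d x y <= r -> D x y <= L * r + L.
Proof. by move=> h; apply: le_trans (lip x y) _; rewrite lerD2r ler_wpM2l. Qed.

Lemma near_piece_bounded x y : near_piece e x y -> D x y <= 2 * (L * e + L) + c.
Proof.
move=> [A [x' [y' [FA Ax' Ay' hx hy]]]].
have := lip_le hx; have := lip_le hy; have := piece_bounded FA Ax' Ay'.
move: (pmet_tri DP x' x y) (pmet_tri DP y' x' y) (pmet_sym DP y y').
lra_from.
Qed.

(** Induction over the chain: the four-point inequality at the first junction [z] puts [p] near the
    first piece, which is D-bounded, or near the geodesic over the shorter chain. This supplies the
    hypothesis [geodesic_bounded] of the electrification. *)
Lemma link_bounded n C : exists K, forall x y p, link e n x y ->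
  excess d p x y <= C -> D x p <= K.
Proof.
elim: n C => [|n IH] C.
  exists (L * C + L) => x _ p <-; rewrite excess_pp// => h; apply: lip_le.
  by rewrite (pmet_sym dP); move: h (pmet_ge0 dP p x); lra_from.
have [K1 h1] := Fqc (C + k + 4 * e); have [K2 h2] := IH (C + k).
pose a := 2 * (L * e + L) + c; pose b := L * K1 + L.
exists (`|a + b| + `|a + K2|) => x y p /= [z xz zy] hp.
have ab := ler_norm (a + b); have aK := ler_norm (a + K2).
have [h|h] := chyp_four dk z p x y; last first.
  have hp2 : excess d p z y <= C + k by move: h hp; lra_from.
  have := h2 _ _ _ zy hp2; have := near_piece_bounded xz.
  have := pmet_tri DP z x p; have := normr_ge0 (a + b).
  by rewrite -/a; move: aK; lra_from.
have [A [x' [z' [FA Ax' Az' hx hz]]]] := xz.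
have [|q Aq hq] := h1 A x' z' p FA Ax' Az'.
  have := excess_lip p x z p x' z' dP.
  by rewrite (pmet_xx dP) (pmet_sym dP x') (pmet_sym dP z'); move: h hp hx hz; lra_from.
have := lip_le hq; have := lip_le hx; have := piece_bounded FA Ax' Aq.
move: (pmet_tri DP x' x p) (pmet_tri DP q x' p) (pmet_sym DP q p) ab.
have := mulr_ge0 L0 e0; move: (normr_ge0 (a + K2)).
by rewrite /b /a; move: L0; lra_from.
Qed.

End Pieces.

Section PieceImage.
Variables (R : realType) (S T : Type) (d1 : S -> S -> R) (d : T -> T -> R).
Variables (phi : S -> T) (F : set (set S)) (k1 k L e : R).
Hypotheses (dk1 : chyp d1 k1) (dk : chyp d k) (L0 : 0 <= L) (e0 : 0 <= e).
Hypothesis lip : forall x y, d (phi x) (phi y) <= L * d1 x y + L.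
Hypothesis phi_inj : injective phi.
Hypothesis proper : forall r, exists K, forall x y, d (phi x) (phi y) <= r -> d1 x y <= K.
Hypothesis Fqc : forall C, exists K, forall A x y p, F A -> A x -> A y ->
  excess d p (phi x) (phi y) <= C -> exists2 z, A z & d p (phi z) <= K.
Let dP1 := chyp_pmet dk1.
Let dP := chyp_pmet dk.
Ltac lra_from := clear -dk dk1 dP dP1 L0 e0 lip phi_inj proper Fqc; lra.

Let lip_le x y r : d1 x y <= r -> d (phi x) (phi y) <= L * r + L.
Proof. by move=> h; apply: le_trans (lip x y) _; rewrite lerD2r ler_wpM2l. Qed.

(** The image of a piece is d-quasiconvex, so a d-geodesic between two of its points is shadowed by
    points [z i] of the piece. Properness bounds their d1-steps and [lip] bounds their d1-distances
    from below: they form a d1-quasigeodesic, near the geodesics of both metrics. *)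
Lemma piece_path : exists2 K, 0 <= K & forall A x y, F A -> A x -> A y ->
  exists n (z : nat -> S), [/\ forall i, (i <= n)%N -> A (z i),
    forall i, (i <= n)%N -> excess d1 (z i) x y <= K /\ excess d (phi (z i)) (phi x) (phi y) <= K,
    forall C p, excess d1 p x y <= C -> exists2 i, (i <= n)%N & d1 p (z i) <= 2 * C + K
  & forall C p, excess d p (phi x) (phi y) <= C ->
      exists2 i, (i <= n)%N & d p (phi (z i)) <= 2 * C + K].
Proof.
pose c := 5 * `|k| + 4.
have [kap0 hkap0] := Fqc (3 * c); pose kap := `|kap0|.
have hkap : 0 <= kap by exact: normr_ge0.
have [eps0 heps0] := proper (2 * kap + 1 + c); pose eps := `|eps0|.
pose lam := L + 2 * kap + c.
have cc0 : 0 <= c by rewrite /c; move: (normr_ge0 k); lra_from.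
have lam0 : 0 <= lam by rewrite /lam; move: L0 hkap cc0; lra_from.
have [K K0 hK] := morse dk1 lam0 (normr_ge0 eps0).
exists (K + 7 * c + `|k| + 1 + 2 * kap).
  by move: K0 cc0 (normr_ge0 k) hkap; lra_from.
move=> A x y FA Ax Ay; have k0 := chyp_ge0 dk (phi x).
have [n [p [p0 pn _ pP]]] := geodesic_path dk (phi x) (phi y).
have kn : `|k| = k by rewrite ger0_norm.
have ce : c = 5 * k + 4 by rewrite /c kn.
rewrite -ce in pP; rewrite kn.
have pex i : (i <= n)%N -> excess d (p i) (phi x) (phi y) <= 3 * c.
  by move=> iN; have := coarse_path_excess dk pP (leq0n i) iN (leqnn n); rewrite p0 pn.
have [q hq] : exists q : nat -> S, forall i, (i <= n)%N ->
    A (q i) /\ d (p i) (phi (q i)) <= kap.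
  apply: (@fun_choice _ _ (fun i q => (i <= n)%N -> A q /\ d (p i) (phi q) <= kap)) => i.
  have [iN|iN] := leqP i n; last by exists x.
  have [z Az hz] := hkap0 A x y (p i) FA Ax Ay (pex i iN); exists z => _; split=> //.
  exact: le_trans hz (ler_norm _).
pose z i := if i == 0%N then x else if i == n then y else q i.
have z0 : z 0%N = x by [].
(* For [n = 0] the conventions at the two ends collide; injectivity of [phi] then gives x = y. *)
have zn : z n = y.
  rewrite /z eqxx; case: eqP => // n0; apply: phi_inj.
  by rewrite -p0 -pn n0.
have Az i : (i <= n)%N -> A (z i) /\ d (p i) (phi (z i)) <= kap.
  move=> iN; rewrite /z; case: eqP => [->|_]; first by rewrite p0 (pmet_xx dP).
  by case: eqP => [->|_]; [rewrite pn (pmet_xx dP)|exact: hq].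
have qp : quasi_path d1 lam eps z n.
  split=> [i j ij jn|i iN].
    have [_ h] := pP _ _ ij jn; have [_ h1] := Az i (leq_trans ij jn); have [_ h2] := Az j jn.
    have := lip (z i) (z j).
    move: (pmet_tri dP (phi (z i)) (p i) (p j)) (pmet_tri dP (phi (z j)) (phi (z i)) (p j)).
    rewrite (pmet_sym dP (phi (z j)) (p j)).
    have := mulr_ge0 hkap (pmet_ge0 dP1 (z i) (z j)).
    have := mulr_ge0 cc0 (pmet_ge0 dP1 (z i) (z j)).
    by rewrite /lam !mulrDl; move: h h1 h2 L0; lra_from.
  apply: le_trans (ler_norm eps0); apply: heps0.
  have [h _] := pP _ _ (leqnSn i) iN; rewrite -natr1 in h.
  have [_ h1] := Az i (ltnW iN); have [_ h2] := Az i.+1 iN.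
  move: (pmet_tri dP (p i) (phi (z i)) (phi (z i.+1))).
  move: (pmet_tri dP (p i.+1) (p i) (phi (z i.+1))) (pmet_sym dP (p i) (phi (z i))).
  by move: h h1 h2; lra_from.
have [m1 m2] := hK z n qp; rewrite z0 zn in m1 m2.
exists n, z; split=> [i /Az[]//|i iN|C q' hq'|C q' hq'].
- have [_ h] := Az i iN; split.
    by apply: le_trans (m1 i iN) _; move: hkap cc0 k0; lra_from.
  have := excess_move (p i) (phi (z i)) (phi x) (phi y) dP; have := pex i iN.
  by rewrite (pmet_sym dP); move: h K0 k0 cc0; lra_from.
- have [i iN hi] := m2 _ _ hq'; exists i => //.
  by move: hi hkap cc0 k0; lra_from.
rewrite -p0 -pn in hq'.
have [i iN hi] := coarse_path_near dk pP cc0 hq'; exists i => //.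
have [_ h] := Az i iN; move: (pmet_tri dP (p i) q' (phi (z i))) h hi K0 hkap; lra_from.
Qed.

Lemma piece_qc : qc_family d1 F.
Proof.
have [K _ hK] := piece_path => C; exists (2 * C + K) => A x y p FA Ax Ay h.
have [n [z [Az _ h1 _]]] := hK _ _ _ FA Ax Ay.
by have [i iN hi] := h1 _ _ h; exists (z i) => //; exact: Az.
Qed.

Lemma piece_lift C : exists K, forall A x y p, F A -> A x -> A y ->
  excess d p (phi x) (phi y) <= C ->
  exists2 z, excess d1 z x y <= K & d p (phi z) <= K.
Proof.
have [K K0 hK] := piece_path; exists (2 * `|C| + K) => A x y p FA Ax Ay h.
have [n [z [_ h2 _ h1]]] := hK _ _ _ FA Ax Ay.
have [i iN hi] := h1 _ _ h; exists (z i).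
  by have [h3 _] := h2 i iN; apply: le_trans h3 _; move: (normr_ge0 C); lra_from.
by move: hi (ler_norm C); lra_from.
Qed.

(** Besides cosets it serves the single piece [setT], once the whole image of [phi] is
    quasiconvex. *)
Lemma piece_image C : exists K, forall A x y p, F A -> A x -> A y ->
  excess d1 p x y <= C -> excess d (phi p) (phi x) (phi y) <= K.
Proof.
have [K K0 hK] := piece_path; exists (K + 2 * (L * (2 * C + K) + L)) => A x y p FA Ax Ay h.
have [n [z [_ h2 h1 _]]] := hK _ _ _ FA Ax Ay.
have [i iN hi] := h1 _ _ h; have [_ h3] := h2 i iN.
have := lip_le hi; have := excess_move (phi (z i)) (phi p) (phi x) (phi y) dP.
by move: h3; lra_from.
Qed.

Lemma near_piece_lift C C' : exists K, forall q q' x x' y,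
  near_piece d1 F e q q' -> excess d1 x q q' <= C -> excess d1 x' q q' <= C ->
  excess d y (phi x) (phi x') <= C' ->
  exists2 z, excess d1 z x x' <= K & d y (phi z) <= K.
Proof.
have [K1 h1] := piece_qc (C + 4 * e).
have [K2 h2] := piece_lift (C' + 4 * (L * K1 + L)).
exists (K2 + 4 * `|K1|) => q q' x x' y [A [a [a' [FA Aa Aa' qa qa']]]] hx hx' hy.
have near u : excess d1 u q q' <= C -> exists2 v, A v & d1 u v <= K1.
  move=> hu; apply: (h1 A a a') => //.
  have := excess_lip u q q' u a a' dP1; rewrite (pmet_xx dP1) (pmet_sym dP1 a q).
  by rewrite (pmet_sym dP1 a' q'); move: qa qa' hu; lra_from.
have [u Au xu] := near _ hx; have [u' Au' xu'] := near _ hx'.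
have [|z hz1 hz2] := h2 A u u' y FA Au Au'.
  have := excess_lip y (phi x) (phi x') y (phi u) (phi u') dP.
  rewrite (pmet_xx dP) (pmet_sym dP (phi u)) (pmet_sym dP (phi u')).
  by move: (lip_le xu) (lip_le xu') hy; lra_from.
exists z; last by move: hz2 (normr_ge0 K1); lra_from.
have := excess_lip z u u' z x x' dP1; rewrite (pmet_xx dP1).
by move: hz1 xu xu' (ler_norm K1); lra_from.
Qed.

(* Stated for all [x], [x'] near the geodesic [q, q'] so that the induction over
   the number of pieces goes through. *)
Lemma link_lift n C C' : exists K, forall q q' x x' y,
  link d1 F e n q q' -> excess d1 x q q' <= C -> excess d1 x' q q' <= C ->
  excess d y (phi x) (phi x') <= C' ->
  exists2 z, excess d1 z x x' <= K & d y (phi z) <= K.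
Proof.
elim: n C C' => [|n IH] C C'.
  exists (C' + (L * (2 * C) + L)) => q _ x x' y <-.
  rewrite !excess_pp// => hx hx' hy.
  have hxx : d1 x x' <= 2 * C.
    move: (pmet_tri dP1 q x x') (pmet_sym dP1 q x') hx hx'.
    by move: (pmet_ge0 dP1 x q) (pmet_ge0 dP1 x' q); lra_from.
  have C'0 := le_trans (excess_ge0 _ _ _ dP) hy.
  move: (pmet_tri dP y (phi x) (phi x')) (pmet_sym dP y (phi x)) => t1 t2.
  exists x; last first.
    move: (pmet_ge0 dP y (phi x')) (pmet_ge0 dP y (phi x)) C'0.
    by move: (lip_le hxx) t1 t2 hy; rewrite /excess; lra_from.
  by rewrite excess_end//; move: (lip_le hxx) (pmet_ge0 dP (phi x) (phi x')) C'0; lra_from.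
pose D := `|C| + 60 * `|k1|.
have [K1 h1] := near_piece_lift D (`|C'| + `|k|); have [K2 h2] := IH D (`|C'| + `|k|).
pose E := 2 * (`|C| + 2 * `|k1|).
exists (`|K1| + `|K2| + (5 * E + 2 * `|k1|)) => q q' x x' y /= [q1 qq1 q1q'] hx hx' hy.
have k10 := chyp_ge0 dk1 x; have k0 := chyp_ge0 dk (phi x).
have nk1 : `|k1| = k1 by rewrite ger0_norm.
have nk : `|k| = k by rewrite ger0_norm.
have lC := ler_norm C; have lC' := ler_norm C'.
have C0 := normr_ge0 C; have C'0 := normr_ge0 C'.
have z1 := normr_ge0 K1; have z2 := normr_ge0 K2; have l1 := ler_norm K1; have l2 := ler_norm K2.
have E0 : 0 <= E by rewrite /E nk1; move: C0 k10; lra_from.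
(* [m] is the centre of the triangle q, q1, q', near all three sides; it cuts [q, q'] into a part
   along the first piece and a part along the remaining chain. *)
have [m [hm1 hm2]] := excess_proj dk1 q1 q q'.
have [hm3 hm4] : excess d1 m q q1 <= 10 * k1 /\ excess d1 m q1 q' <= 10 * k1.
  move: (excess_ge0 m q q1 dP1) (excess_ge0 m q1 q' dP1) hm1 hm2.
  rewrite /excess (pmet_sym dP1 q1 m) (pmet_sym dP1 q1 q) => i1 i2 i3 i4.
  by split; move: i1 i2 i3 i4; lra_from.
have left u : excess d1 u q m <= C + k1 -> excess d1 u q q1 <= D.
  move=> hu; have h0 : excess d1 q q q1 <= 10 * k1 by rewrite excess_end//; move: k10; lra_from.
  by have := excess_convex dk1 u h0 hm3; rewrite /D nk1; move: hu lC k10; lra_from.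
have right u : excess d1 u m q' <= C + k1 -> excess d1 u q1 q' <= D.
  move=> hu; have h0 : excess d1 q' q1 q' <= 10 * k1 by rewrite excess_end2//; move: k10; lra_from.
  by have := excess_convex dk1 u hm4 h0; rewrite /D nk1; move: hu lC k10; lra_from.
have mq : excess d1 m q m <= C + k1 /\ excess d1 m m q' <= C + k1.
  have : 0 <= C by exact: le_trans (excess_ge0 _ _ _ dP1) hx.
  by rewrite excess_end// excess_end2// => C00; split; move: k10 C00; lra_from.
(* For points on different sides of [m], [y] is near [phi u, phi m] or [phi m, phi u'], where the
   case of one piece or the induction hypothesis applies. Points on the same side are treated
   directly at the end. *)
have cross u u' : excess d1 u q m <= C + k1 -> excess d1 u' m q' <= C + k1 ->
    excess d y (phi u) (phi u') <= C' ->
    exists2 z, excess d1 z u u' <= `|K1| + `|K2| + (5 * E + 2 * k1) &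
      d y (phi z) <= `|K1| + `|K2| + (5 * E + 2 * k1).
  move=> hu hu' hyu.
  have mE : excess d1 m u u' <= E.
    have := excess_ends q q' m u u' dP1; rewrite (excessC u m q dP1) /E nk1.
    by move: hu hu' hm1 lC; lra_from.
  have uE : excess d1 u u u' <= E by rewrite excess_end.
  have u'E : excess d1 u' u u' <= E by rewrite excess_end2.
  have [h|h] := chyp_four dk (phi m) y (phi u) (phi u').
    have [|z hz1 hz2] := h1 q q1 u m y qq1 (left _ hu) (left _ mq.1).
      by rewrite nk; move: h hyu lC'; lra_from.
    exists z; last by move: hz2 l1 z2 E0 k10; lra_from.
    by have := excess_convex dk1 z uE mE; move: hz1 l1 z2; lra_from.
  have [|z hz1 hz2] := h2 q1 q' m u' y q1q' (right _ mq.2) (right _ hu').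
    by rewrite nk; move: h hyu lC'; lra_from.
  exists z; last by move: hz2 l2 z1 E0 k10; lra_from.
  by have := excess_convex dk1 z mE u'E; move: hz1 l2 z1; lra_from.
rewrite nk1; have hy' : excess d y (phi x) (phi x') <= `|C'| + `|k|.
  by rewrite nk; move: hy lC' k0; lra_from.
have [a|a] := chyp_four dk1 m x q q'; have [b|b] := chyp_four dk1 m x' q q'.
- have [||z hz1 hz2] := h1 q q1 x x' y qq1 _ _ hy'.
  + by apply: left; move: a hx; lra_from.
  + by apply: left; move: b hx'; lra_from.
  by exists z; [move: hz1|move: hz2]; move: l1 z2 E0 k10; lra_from.
- by apply: cross hy; [move: a hx|move: b hx']; lra_from.
- rewrite excessC// in hy; have [||z hz1 hz2] := cross x' x _ _ hy.
  + by move: b hx'; lra_from.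
  + by move: a hx; lra_from.
  by exists z => //; rewrite excessC.
- have [||z hz1 hz2] := h2 q1 q' x x' y q1q' _ _ hy'.
  + by apply: right; move: a hx; lra_from.
  + by apply: right; move: b hx'; lra_from.
  by exists z; [move: hz1|move: hz2]; move: l2 z1 E0 k10; lra_from.
Qed.

End PieceImage.

(** * Comparison of two electrified spaces *)

Lemma ex_first (P : nat -> Prop) n : (exists2 i, (i <= n)%N & P i) ->
  exists i, [/\ (i <= n)%N, P i & forall j, (j < i)%N -> ~ P j].
Proof.
move=> [m mn Pm]; have ex : exists i, `[< P i >] by exists m; exact/asboolP.
have [i /asboolP Pi mi] := ex_minnP ex; exists i; split=> //.
  by apply: leq_trans mn; apply: mi; exact/asboolP.
move=> j ji Pj; have : (i <= j)%N by apply: mi; exact/asboolP.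
by rewrite leqNgt ji.
Qed.

Lemma ex_last_le (P : nat -> Prop) n : (exists2 i, (i <= n)%N & P i) ->
  exists i, [/\ (i <= n)%N, P i & forall j, (i < j)%N -> (j <= n)%N -> ~ P j].
Proof.
move=> [m mn Pm]; have [|i [iN Pi hi]] := @ex_first (fun i => P (n - i)%N) n.
  by exists (n - m)%N; [exact: leq_subr|rewrite subKn].
exists (n - i)%N; split=> //; first exact: leq_subr.
move=> j ij jn Pj; apply: (hi (n - j)%N); last by rewrite subKn.
by move: ij jn iN; clear; lia.
Qed.

Section CoarsePath.
Variables (R : realType) (T : Type) (d : T -> T -> R).

Lemma coarse_path_sub c w n i j : coarse_path d c w n -> (i <= j)%N -> (j <= n)%N ->
  coarse_path d c (fun l => w (i + l)%N) (j - i).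
Proof.
move=> wP ij jn l m lm mji.
have h1 : (i + l <= i + m)%N by rewrite leq_add2l.
have h2 : (i + m <= n)%N by apply: leq_trans jn; rewrite -leq_subRL.
by have := wP _ _ h1 h2; rewrite !natrD => -[i1 i2]; split; move: i1 i2; clear; lra.
Qed.

End CoarsePath.

Section Electric.
Variable R : realType.

(** Coning off in coarse form. Of the coned-off cosets only two traces remain: D is coarsely
    Lipschitz in d, and d-geodesics between D-close points are D-bounded. *)
Record electric (T : Type) (d D : T -> T -> R) (k kD L : R) : Prop := Electric {
  electric_d : chyp d k;
  electric_D : chyp D kD;
  electric_ge0 : 0 <= L;
  electric_lip : forall x y, D x y <= L * d x y + L;
  electric_geodesic : forall r C, exists K, forall x y p,
    D x y <= r -> excess d p x y <= C -> D x p <= K }.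

Variables (T : Type) (d D : T -> T -> R) (k kD L : R).
Hypothesis E : electric d D k kD L.

Lemma electric_excessE C : exists2 K, 0 <= K & forall p a b,
  excess d p a b <= C -> excess D p a b <= K.
Proof. by case: E => ? ? ? ? ?; apply: electric_excess; eassumption. Qed.

Lemma electric_near_pathE C : exists2 K, 0 <= K & forall n (p : nat -> T) w i j,
  coarse_path d (5 * k + 4) p n -> (i <= j)%N -> (j <= n)%N ->
  excess D w (p i) (p j) <= C ->
  exists l, [/\ (i <= l)%N, (l <= j)%N & D w (p l) <= K].
Proof.
have [K K0 hK] : exists2 K, 0 <= K & forall n (p : nat -> T) w,
    coarse_path d (5 * k + 4) p n -> excess D w (p 0%N) (p n) <= C ->
    exists2 i, (i <= n)%N & D w (p i) <= K.
  by case: E => ? ? ? ? ?; apply: electric_near_path; eassumption.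
exists K => // n p w i j pP ij jn h.
have [|l lji hl] := hK _ _ w (coarse_path_sub pP ij jn); first by rewrite addn0 subnKC.
by exists (i + l)%N; rewrite leq_addr -leq_subRL.
Qed.

Lemma electric_nearE C : exists2 K, 0 <= K & forall w a b, excess D w a b <= C ->
  exists2 p, excess d p a b <= 3 * (5 * k + 4) & D w p <= K.
Proof. by case: E => ? ? ? ? ?; apply: electric_near; eassumption. Qed.

End Electric.

Section Comparison.
Variables (R : realType) (S T : Type) (d1 D1 : S -> S -> R) (d D : T -> T -> R).
Variables (k1 kD1 L1 k kD Lg L : R) (phi : S -> T) (o : S).
Hypotheses (E1 : electric d1 D1 k1 kD1 L1) (E : electric d D k kD Lg) (L0 : 0 <= L).
Hypothesis lip : forall x y, d (phi x) (phi y) <= L * d1 x y + L.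
Let dk1 := electric_d E1.
Let dk := electric_d E.
Let dP1 := chyp_pmet dk1.
Let dP := chyp_pmet dk.
Let DP1 := chyp_pmet (electric_D E1).
Let DP := chyp_pmet (electric_D E).

Ltac lra_from := clear -E1 E L0 lip dk1 dk dP1 dP DP1 DP; lra.

(** A point near a D1-geodesic is D1-near a point of the d1-geodesic; the image of the latter is
    near the d-geodesic by assumption, hence near the D-geodesic. *)
Lemma excess_of_qc : (forall x y, D (phi x) (phi y) <= D1 x y) ->
  (forall C, exists K, forall p a b, excess d1 p a b <= C ->
     excess d (phi p) (phi a) (phi b) <= K) ->
  forall C, exists K, forall p a b, excess D1 p a b <= C ->
     excess D (phi p) (phi a) (phi b) <= K.
Proof.
move=> DD qc C; have [K1 _ h1] := electric_nearE E1 C; have [K2 h2] := qc (3 * (5 * k1 + 4)).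
have [K3 _ h3] := electric_excessE E K2; exists (K3 + 2 * K1) => p a b h.
have [q hq1 hq2] := h1 _ _ _ h.
have := h3 _ _ _ (h2 _ _ _ hq1); have := DD p q.
have := excess_move (phi q) (phi p) (phi a) (phi b) DP.
by move: hq2; lra_from.
Qed.

Hypothesis proper : forall r, exists K, forall x y, d (phi x) (phi y) <= r -> d1 x y <= K.
Hypothesis follow : forall r C, exists K, forall q q' y, D1 q q' <= r ->
  excess d y (phi q) (phi q') <= C ->
  exists2 z, excess d1 z q q' <= K & d y (phi z) <= K.
Hypothesis mitra : forall C, exists N, forall a b,
  excess D (phi o) (phi a) (phi b) <= C -> excess D1 o a b <= N.
Ltac lra_from ::= clear -E1 E L0 lip proper follow mitra dk1 dk dP1 dP DP1 DP; lra.

(** In contrapositive form: a stretch of d1-geodesic that is D1-far from [o] spans a d-geodesic in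
    the target that avoids [phi o]. *)
Lemma electric_entry C : exists K, forall n (p : nat -> S) i j,
  coarse_path d1 (5 * k1 + 4) p n -> (i <= j)%N -> (j <= n)%N ->
  excess d (phi o) (phi (p i)) (phi (p j)) <= C ->
  exists l, [/\ (i <= l)%N, (l <= j)%N & D1 o (p l) <= K].
Proof.
have [K1 _ h1] := electric_excessE E C; have [N h2] := mitra K1.
have [K _ hK] := electric_near_pathE E1 N; exists K => n p i j pP ij jn h.
by apply: hK pP ij jn _; apply: h2; apply: h1.
Qed.

(* The part of a d1-geodesic before its first and after its last D1-approach to
   [o] has image away from [phi o]; the part between them is followed by its
   image. *)
Lemma mitra_lift C : exists N, forall a b,
  excess d (phi o) (phi a) (phi b) <= C -> excess d1 o a b <= N.
Proof.
have k10 := chyp_ge0 dk1 o; have k0 := chyp_ge0 dk (phi o).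
pose c1 := 5 * k1 + 4; have c10 : 0 <= c1 by rewrite /c1; move: k10; lra_from.
pose step := L * (1 + c1) + L.
have step0 : 0 <= step by rewrite /step !(addr_ge0, mulr_ge0).
(* 2k pays for the two cuts by the four-point inequality, 2 step for moving a cut by one index. *)
pose C3 := C + 2 * k + 2 * step.
have [De hDe] := electric_entry C3.
have [K1 h1] := follow (2 * De) C3; have [K2 h2] := proper K1; have [K3 h3] := proper C3.
exists (2 * `|K3| + `|K1 + 2 * K2 + 15 * c1 + 2 * k1|) => a b hab.
have l1 := ler_norm (K1 + 2 * K2 + 15 * c1 + 2 * k1); have l3 := ler_norm K3.
have z1 := normr_ge0 (K1 + 2 * K2 + 15 * c1 + 2 * k1); have z3 := normr_ge0 K3.
have [n [p [p0 pn _ pP]]] := geodesic_path dk1 a b.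
pose P i := is_true (D1 o (p i) <= De).
have stepP i : (i < n)%N -> d (phi (p i)) (phi (p i.+1)) <= step.
  move=> iN; have [h _] := pP _ _ (leqnSn i) iN; rewrite -natr1 in h.
  apply: le_trans (lip _ _) _; rewrite lerD2r; apply: ler_wpM2l => //.
  by rewrite /c1; move: h; lra_from.
have exP : exists2 i, (i <= n)%N & P i.
  have [|l [_ ln hl]] := hDe n p 0%N n pP (leq0n _) (leqnn _); last by exists l.
  by rewrite p0 pn /C3; move: hab k0 step0; lra_from.
have [i [iN Pi fi]] := ex_first exP; have [j [jn Pj lj]] := ex_last_le exP.
have ij : (i <= j)%N by rewrite leqNgt; apply/negP => ji; exact: fi Pj.
have endc x : (x = a \/ x = b) -> d (phi o) (phi x) <= C3 -> excess d1 o a b <= 2 * `|K3|.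
  move=> xab /h3 h; case: xab h => -> h.
    by have := excess_le o a b dP1; move: h l3; lra_from.
  by have := excess_le2 o a b dP1; move: h l3; lra_from.
have [h|h] := chyp_four dk (phi (p i)) (phi o) (phi a) (phi b).
  (* The stretch is cut one index before [i], so that the approach found on it contradicts the
     choice of [i] as the first one. If there is no earlier index, [phi a] itself is close to
     [phi o] and properness bounds d1 o a. *)
  case: i => [|i] in iN Pi fi h {ij}.
    rewrite p0 excess_pp// in h; have := endc a (or_introl erefl).
    move=> /(_ _)/le_trans; apply; last by move: z1; lra_from.
    by rewrite /C3; move: h hab k0 step0 (pmet_ge0 dP (phi o) (phi a)); lra_from.
  have [|l [_ li hl]] := hDe n p 0%N i pP (leq0n _) (ltnW iN).
    rewrite p0; have := excess_lip (phi o) (phi a) (phi (p i.+1)) (phi o) (phi a) (phi (p i)) dP.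
    by rewrite !(pmet_xx dP) /C3; move: (stepP i iN) h hab k0; lra_from.
  by case: (fi l li hl).
have [h'|h'] := chyp_four dk (phi (p j)) (phi o) (phi (p i)) (phi b); last first.
  move: jn; rewrite leq_eqVlt => /orP[/eqP jn|jn].
    rewrite jn pn excess_pp// in h'; have := endc b (or_intror erefl).
    move=> /(_ _)/le_trans; apply; last by move: z1; lra_from.
    by rewrite /C3; move: h h' hab k0 step0 (pmet_ge0 dP (phi o) (phi b)); lra_from.
  have [|l [jl ln hl]] := hDe n p j.+1 n pP jn (leqnn _).
    rewrite pn.
    have := excess_lip (phi o) (phi (p j)) (phi b) (phi o) (phi (p j.+1)) (phi b) dP.
    rewrite !(pmet_xx dP) (pmet_sym dP (phi (p j.+1))) /C3.
    by move: (stepP j jn) h h' hab k0; lra_from.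
  by case: (lj l jl ln hl).
have [||z hz1 hz2] := h1 (p i) (p j) (phi o).
- move: Pi Pj (pmet_tri DP1 o (p i) (p j)); rewrite /P (pmet_sym DP1 (p i) o).
  by lra_from.
- by rewrite /C3; move: h h' hab k0 step0; lra_from.
have exi := coarse_path_excess dk1 pP (leq0n i) iN (leqnn n).
have exj := coarse_path_excess dk1 pP (leq0n j) jn (leqnn n).
rewrite p0 pn -/c1 in exi exj; have := excess_convex dk1 o exi exj.
have := excess_move z o (p i) (p j) dP1; have := h2 _ _ hz2.
by move: hz1 l1 z3; lra_from.
Qed.

End Comparison.

(** An ultrafilter containing the tails replaces the diagonal argument: a coordinate with finitely
    many values is constant on a set of the ultrafilter, and finitely many such sets meet every
    tail. *)
Lemma limit_sequence (T : choiceType) (a : nat -> nat -> T) :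
  (forall i, exists s : seq T, forall n, a n i \in s) ->
  exists f, forall I N, exists2 n, (N <= n)%N & forall i, (i <= I)%N -> a n i = f i.
Proof.
move=> fin; have [U [UU oU]] := @ultraFilterLemma nat \oo _.
have [f hf] : exists f, forall i, U [set n | a n i = f i].
  apply: (@fun_choice _ _ (fun i x => U [set n | a n i = x])) => i.
  have [s hs] := fin i; suff : U [set n | a n i \in s] ->
      exists x, U [set n | a n i = x].
    by apply; apply: filterS filterT => n _; exact: hs.
  elim: s {hs} => [U0|x s IH].
    by case: (@filter_not_empty _ U _); apply: filterS U0 => n.
  have [Ux _|Ux Us] := in_ultra_setVsetC [set n | a n i = x] UU; first by exists x.
  apply: IH; apply: filterS (filterI Ux Us) => n /= [nx].
  by rewrite inE => /orP[/eqP|].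
exists f => I N.
have UI : U [set n | forall i, (i <= I)%N -> a n i = f i].
  elim: I => [|I IH].
    by apply: filterS (hf 0%N) => n /= h i; rewrite leqn0 => /eqP->.
  apply: filterS (filterI IH (hf I.+1)) => n /= [h1 h2] i.
  by rewrite leq_eqVlt ltnS => /orP[/eqP->|/h1].
have UN : U [set n | (N <= n)%N] by apply: oU; exists N.
by have [n [h1 h2]] := @filter_ex _ U _ _ (filterI UI UN); exists n.
Qed.

(** * From injectivity on the boundary to control of images of geodesics *)

Section Injective.
Variables (R : realType) (H G : groupType) (phi : ghom H G).
Variables (d1 D1 : H -> H -> R) (d D : G -> G -> R) (k1 kD1 L1 k kD Lg L : R).
Hypotheses (E1 : electric d1 D1 k1 kD1 L1) (E : electric d D k kD Lg) (L0 : 0 <= L).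
Hypothesis lip : forall x y, d (phi x) (phi y) <= L * d1 x y + L.
Hypothesis lipD : forall x y, D (phi x) (phi y) <= D1 x y.
Hypothesis proper : forall r, exists K, forall x y, d (phi x) (phi y) <= r -> d1 x y <= K.
Hypothesis follow : forall r C, exists K, forall q q' y, D1 q q' <= r ->
  excess d y (phi q) (phi q') <= C ->
  exists2 z, excess d1 z q q' <= K & d y (phi z) <= K.
Hypothesis mitra : forall C, exists N, forall a b,
  excess D 1%g (phi a) (phi b) <= C -> excess D1 1%g a b <= N.
Hypothesis d1_inv : forall g x y : H, d1 (g * x)%g (g * y)%g = d1 x y.
Hypothesis d_inv : forall g x y : G, d (g * x)%g (g * y)%g = d x y.
Hypothesis d1_finite : forall r, exists s : seq H, forall x, d1 1%g x <= r -> x \in s.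

(** Convergence to a common boundary point, with fixed base point and with excess for twice the
    Gromov product; [divergeP] compares it with [gromov_diverge]. *)
Definition diverge (T : Type) (d : T -> T -> R) (o : T) (u v : nat -> T) :=
  forall M, exists N, forall i j, (N <= i)%N -> (N <= j)%N -> M <= excess d o (u i) (v j).

Hypothesis boundary_inj : forall u v, diverge D1 1%g u u -> diverge D1 1%g v v ->
  diverge D 1%g (phi \o u) (phi \o v) -> diverge D1 1%g u v.

Let dk1 := electric_d E1.
Let dk := electric_d E.
Let dP1 := chyp_pmet dk1.
Let dP := chyp_pmet dk.
Let DP1 := chyp_pmet (electric_D E1).
Let DP := chyp_pmet (electric_D E).
Let Dk := electric_D E.
Let c1 := 5 * k1 + 4.
Let k0 : 0 <= k := chyp_ge0 dk 1%g.
Let k10 : 0 <= k1 := chyp_ge0 dk1 1%g.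
Let phi1 : phi 1%g = 1%g.
Proof. exact: gmulf1. Qed.
Ltac lra_from := clear -E1 E L0 lip lipD proper follow mitra d1_inv d_inv d1_finite
  boundary_inj dk1 dk phi1 dP1 dP DP1 DP Dk c1 k0 k10; lra.

Definition ray (a : nat -> H) := a 0%N = 1%g /\ forall n, coarse_path d1 c1 a n.

(** An unbounded ray does not return: if [a i] and [a j] had small D1-product, the ray would come
    D1-near 1 after time [m], and [electric_geodesic] would bound D1 1 (a m), which was chosen
    large. *)
Lemma ray_dichotomy a : ray a ->
  (exists r, forall i, D1 1%g (a i) <= r) \/ diverge D1 1%g a a.
Proof.
move=> [a0 aP]; have [?|nb] := pselect (exists r, forall i, D1 1%g (a i) <= r); [by left|right].
move=> M; have [K _ hK] := electric_near_pathE E1 M.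
have [K' hK'] := electric_geodesic E1 K (3 * c1).
have [m hm] : exists m, K' < D1 1%g (a m).
  apply: contrapT => h; apply: nb; exists K' => i; rewrite leNgt; apply/negP => h'.
  by apply: h; exists i.
have key i j : (i <= j)%N -> (m <= i)%N -> M <= excess D1 1%g (a i) (a j).
  move=> ij mi; rewrite leNgt; apply/negP => /ltW h.
  have [l [il lj hl]] := hK j a 1%g i j (aP j) ij (leqnn j) h.
  have ml := leq_trans mi il.
  have ex := coarse_path_excess dk1 (aP l) (leq0n m) ml (leqnn l); rewrite a0 in ex.
  by move: (hK' _ _ _ hl ex) hm; lra_from.
exists m => i j mi mj; have [ij|/ltnW ji] := leqP i j; first exact: key.
by rewrite excessC//; exact: key.
Qed.

Lemma diverge_image a : diverge D1 1%g a a -> diverge D 1%g (phi \o a) (phi \o a).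
Proof.
move=> div M; have [N hN] := mitra M; have [n hn] := div (N + 1).
exists n => i j ni nj; rewrite leNgt; apply/negP => /ltW /hN.
by move: (hn i j ni nj); lra_from.
Qed.

(** A point d-near the geodesic is D-near the D-geodesic with the same ends, and the latter leaves
    every D-ball because the D-products grow. *)
Lemma diverge_avoid (a : nat -> H) r C : diverge D 1%g (phi \o a) (phi \o a) ->
  exists n, forall i y, (n <= i)%N -> excess d y (phi (a n)) (phi (a i)) <= C ->
    r < D 1%g y.
Proof.
move=> div; have [K _ hK] := electric_excessE E C.
have [n hn] := div (K + 2 * r + 1); exists n => i y ni /hK h; rewrite ltNge; apply/negP => hy.
have := hn n i (leqnn _) ni; have := excess_move y 1%g (phi (a n)) (phi (a i)) DP.
by move: h hy; rewrite /=; lra_from.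
Qed.

Lemma diverge_meet (a : nat -> H) r C : diverge D 1%g (phi \o a) (phi \o a) ->
  exists M n, forall i y, (n <= i)%N -> excess d y 1%g (phi (a i)) <= C ->
    D 1%g y <= r -> d 1%g y <= M.
Proof.
move=> /(@diverge_avoid a r (C + k))[n hn].
exists (d 1%g (phi (a n)) + (C + k)), n => i y ni h hy.
have [h'|h'] := chyp_four dk (phi (a n)) y 1%g (phi (a i)).
  move: (excess_ge0 y 1%g (phi (a n)) dP) h h' (pmet_ge0 dP y (phi (a n))).
  by rewrite /excess (pmet_sym dP y 1%g); lra_from.
have : r < D 1%g y by apply: (hn i) => //; move: h h'; lra_from.
by rewrite ltNge hy.
Qed.

(** A point [y] of G on the common initial part of both image geodesics is shown to be d-bounded. If
    [a'] goes to infinity in B1, its image leaves the D-ball that contains the image of [a]. If [a']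
    is D1-bounded too, [y] lifts near both rays, the lifts are close by properness, and the bounded
    product in H keeps them near 1. *)
Lemma bounded_ray_absurd a a' r C : (forall i, D1 1%g (a i) <= r) -> ray a' ->
  (forall i j, excess d1 1%g (a i) (a' j) <= C) ->
  diverge d 1%g (phi \o a) (phi \o a') -> False.
Proof.
move=> ab ra' aC div.
have [K1 h1] := follow r (2 * k); have [K2 h2] := electric_geodesic E r (2 * k).
have Da i y : excess d y 1%g (phi (a i)) <= 2 * k -> D 1%g y <= K2.
  by apply: h2; rewrite -phi1; apply: le_trans (lipD _ _) (ab i).
suff [M [n hM]] : exists M n, forall i j y, (n <= i)%N -> (n <= j)%N ->
    excess d y 1%g (phi (a i)) <= 2 * k -> excess d y 1%g (phi (a' j)) <= 3 * k ->
    d 1%g y <= M.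
  (* The point at distance [t] from 1 on the first geodesic has distance more than [M] from 1, and
     it is near the second geodesic because the images have a common end. *)
  pose t := `|M| + k + 1; have t0 : 0 <= t by move: k0; rewrite /t; move: (normr_ge0 M); lra_from.
  have [n' hn'] := div (2 * t + 10 * k + 1); pose i := maxn n n'.
  have := hn' i i (leq_maxr _ _) (leq_maxr _ _); rewrite /= => hi.
  have hti : 0 <= t <= d 1%g (phi (a i)).
    rewrite t0; have := excess_le 1%g (phi (a i)) (phi (a' i)) dP.
    by move: hi k0 t0; rewrite andTb; lra_from.
  have [y [hy1 hy2]] := chyp_geod dk hti.
  have e1 : excess d y 1%g (phi (a i)) <= 2 * k.
    by rewrite /excess (pmet_sym dP y); move: hy1 hy2; lra_from.
  have e2 : excess d y 1%g (phi (a' i)) <= 3 * k.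
    have [h|h] := chyp_four dk (phi (a' i)) y 1%g (phi (a i)); first by move: h e1; lra_from.
    have := excess_move y 1%g (phi (a' i)) (phi (a i)) dP.
    rewrite (excessC 1%g _ _ dP); rewrite excessC// in h hi.
    move: hi h e1 hy1; rewrite (excessC 1%g _ _ dP) (excessC y _ _ dP).
    by move: k0; lra_from.
  have := hM i i y (leq_maxl _ _) (leq_maxl _ _) e1 e2.
  move: hy2 (pmet_tri dP y 1%g (phi (a i))) (ler_norm M); rewrite /t; lra_from.
have [[r' hr']|dv] := ray_dichotomy ra'; last first.
  have [M [n hM]] := diverge_meet K2 (3 * k) (diverge_image dv).
  by exists M, n => i j y ni nj e1 e2; apply: hM nj e2 (Da i y e1).
have [K3 h3] := follow r' (3 * k); have [K4 h4] := proper (K1 + K3).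
exists (K1 + (L * ((C + 2 * K1 + 2 * K3 + 2 * K4) / 2) + L)), 0%N => i j y _ _ e1 e2.
have [|z hz1 hz2] := h1 1%g (a i) y (ab i); first by rewrite phi1.
have [|z' hz1' hz2'] := h3 1%g (a' j) y (hr' j); first by rewrite phi1.
have zz' : d1 z z' <= K4.
  apply: h4; move: (pmet_tri dP y (phi z) (phi z')) (pmet_sym dP y (phi z)).
  by move: hz2 hz2'; lra_from.
have e3 := excess_ends (a i) (a' j) 1%g z z' dP1.
have e4 := excess_lip 1%g z z' 1%g z z dP1; rewrite !(pmet_xx dP1) excess_pp// in e4.
have z1 : d1 1%g z <= (C + 2 * K1 + 2 * K3 + 2 * K4) / 2.
  move: (aC i j) e3 e4 zz' hz1 hz1' (excess_ge0 z 1%g (a i) dP1) (excess_ge0 z' 1%g (a' j) dP1).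
  by lra_from.
have := lip 1%g z; have : L * d1 1%g z <= L * ((C + 2 * K1 + 2 * K3 + 2 * K4) / 2).
  exact: ler_wpM2l.
rewrite phi1; move: (pmet_tri dP (phi z) 1%g y) (pmet_sym dP y (phi z)) hz2.
by lra_from.
Qed.

(** If both rays converge in B1 and the D-product of their images stayed small, some [w] in a
    bounded D-ball would be d-near [phi (a i), phi (a' j)]. The outer parts of that geodesic avoid
    the D-ball, so [w] is near the fixed middle part between indices [n1] and [n2], against
    divergence in d. *)
Lemma ray_pair_absurd a a' C : ray a -> ray a' ->
  (forall i j, excess d1 1%g (a i) (a' j) <= C) ->
  diverge d 1%g (phi \o a) (phi \o a') -> False.
Proof.
move=> ra ra' aC div.
have [[r hr]|dv] := ray_dichotomy ra; first exact: bounded_ray_absurd hr ra' aC div.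
have [[r hr]|dv'] := ray_dichotomy ra'.
  apply: (bounded_ray_absurd hr ra (C := C)).
    by move=> i j; rewrite excessC.
  by move=> M; have [n hn] := div M; exists n => i j ni nj; rewrite excessC//; exact: hn.
have [N N0 hN] := electric_excessE E1 C.
have ndv : ~ diverge D 1%g (phi \o a) (phi \o a').
  move=> /(boundary_inj dv dv')/(_ (N + 1))[n hn].
  by move: (hn n n (leqnn _) (leqnn _)) (hN _ _ _ (aC n n)); lra_from.
apply: ndv => M; apply: contrapT => nex.
have [r r0 hr] := electric_nearE E M; set C0 := 3 * _ in hr.
have [n1 h1] := diverge_avoid r (C0 + 2 * k) (diverge_image dv).
have [n2 h2] := diverge_avoid r (C0 + 2 * k) (diverge_image dv').
pose B0 := d 1%g (phi (a n1)) + d (phi (a n1)) (phi (a' n2)) + (C0 + 2 * k).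
have [n3 h3] := div (2 * B0 + C0 + 1).
apply: nex; exists (maxn n1 (maxn n2 n3)) => i j; rewrite !geq_max.
move=> /and3P[i1 i2 i3] /and3P[j1 j2 j3]; rewrite leNgt; apply/negP => /ltW /hr[w hw1 hw2].
have nr x y : r < D 1%g w -> x <= y :> R by rewrite ltNge hw2.
suff w1 : d 1%g w <= B0.
  have := h3 i j i3 j3; have := excess_move 1%g w (phi (a i)) (phi (a' j)) dP.
  have := excess_move w 1%g (phi (a i)) (phi (a' j)) dP.
  by move: hw1 w1; rewrite /=; lra_from.
have [h|h] := chyp_four dk (phi (a n1)) w (phi (a i)) (phi (a' j)).
  apply/nr/(h1 i) => //; rewrite excessC//.
  by move: h hw1 k0; lra_from.
have [h'|h'] := chyp_four dk (phi (a' n2)) w (phi (a n1)) (phi (a' j)); last first.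
  by apply/nr/(h2 j) => //; move: h h' hw1 k0; lra_from.
move: h' h hw1 (pmet_tri dP (phi (a n1)) 1%g w) (pmet_ge0 dP w (phi (a' n2))).
by rewrite /excess /B0 (pmet_sym dP (phi (a n1)) w); lra_from.
Qed.

Lemma excess_of_injective C : exists K, forall z x x', excess d1 z x x' <= C ->
  excess d (phi z) (phi x) (phi x') <= K.
Proof.
have mitra1 M : exists N, forall a b,
    excess d 1%g (phi a) (phi b) <= M -> excess d1 1%g a b <= N.
  rewrite -phi1; apply: (mitra_lift E1 E L0 lip proper follow).
  by rewrite phi1; exact: mitra.
have c10 : 0 <= c1 by rewrite /c1; move: k10; lra_from.
apply: contrapT => nex.
(* Left invariance moves the failing point [z] to the identity. *)
have bad (n : nat) : exists ab : H * H, excess d1 1%g ab.1 ab.2 <= C /\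
    n%:R < excess d 1%g (phi ab.1) (phi ab.2).
  apply: contrapT => h; apply: nex; exists n%:R => z x x' hx; rewrite leNgt.
  apply/negP => lt; apply: h; exists (z^-1 * x, z^-1 * x')%g.
  have e1 u v : d1 1%g (z^-1 * u)%g = d1 z u /\ d1 (z^-1 * u)%g (z^-1 * v)%g = d1 u v.
    by rewrite d1_inv -(d1_inv z 1%g) mulgA mulgV mulg1 mul1g.
  have e2 u v : d 1%g (phi (z^-1 * u)%g) = d (phi z) (phi u) /\
      d (phi (z^-1 * u)%g) (phi (z^-1 * v)%g) = d (phi u) (phi v).
    by rewrite !gmulfM gmulfV d_inv -(d_inv (phi z) 1%g) mulgA mulgV mulg1 mul1g.
  rewrite /excess /= (e1 x x').1 (e1 x x').2 (e1 x' x').1.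
  rewrite (e2 x x').1 (e2 x x').2 (e2 x' x').1.
  exact: (conj hx lt).
have [ab hab] := fun_choice bad.
have path x : exists np : nat * (nat -> H), [/\ np.2 0%N = 1%g, np.2 np.1 = x
    & coarse_path d1 c1 np.2 np.1].
  by have [n [p [p0 pn _ pP]]] := geodesic_path dk1 1%g x; exists (n, p).
have [pa hpa] := fun_choice (fun n => path (ab n).1).
have [pb hpb] := fun_choice (fun n => path (ab n).2).
have long (p : nat * (nat -> H)) x I : p.2 0%N = 1%g -> p.2 p.1 = x ->
    coarse_path d1 c1 p.2 p.1 -> 2 * (L * (I%:R + c1) + L) < 2 * d 1%g (phi x) -> (I < p.1)%N.
  move=> p0 pn pP lt; rewrite ltnNge; apply/negP => le.
  have [h _] := pP _ _ (leq0n _) (leqnn _); rewrite p0 pn in h.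
  have := lip 1%g x; rewrite phi1.
  have leR : (p.1%:R : R) <= I%:R by rewrite ler_nat.
  have : L * d1 1%g x <= L * (I%:R + c1) by apply: ler_wpM2l => //; move: h leR; lra_from.
  by move: lt; lra_from.
(* An excess above [n] in the image puts both ends at d-distance more than n/2 from 1, so both paths
   become long. *)
have longs I : exists N, forall n, (N <= n)%N -> (I < (pa n).1)%N /\ (I < (pb n).1)%N.
  pose B := 2 * (L * (I%:R + c1) + L).
  have B0 : 0 <= B by rewrite /B; rewrite !(addr_ge0, mulr_ge0).
  exists (Num.truncn B).+1 => n hn; have [h1 h2] := hab n.
  have hB : B <= n%:R.
    by apply: le_trans (_ : (Num.truncn B).+1%:R <= _); rewrite ?ler_nat// ltW// truncnS_gt.
  have := excess_le 1%g (phi (ab n).1) (phi (ab n).2) dP.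
  have := excess_le2 1%g (phi (ab n).1) (phi (ab n).2) dP.
  have [pa0 pan paP] := hpa n; have [pb0 pbn pbP] := hpb n.
  move=> i1 i2; split; [apply: long pa0 pan paP _|apply: long pb0 pbn pbP _].
    by rewrite -/B; move: h2 hB i2; lra_from.
  by rewrite -/B; move: h2 hB i1; lra_from.
(* The default outside the common range keeps the values at index [i] in a finite set; [longs] makes
   it disappear in the limit. *)
pose al n i := if (i <= (pa n).1)%N && (i <= (pb n).1)%N
  then ((pa n).2 i, (pb n).2 i) else (1%g, 1%g).
have [f hf] : exists f : nat -> H * H, forall I N, exists2 n, (N <= n)%N &
    forall i, (i <= I)%N -> al n i = f i.
  apply: limit_sequence => i; have [s hs] := d1_finite (i%:R + c1).
  exists [seq (x, y) | x <- s, y <- s] => n; apply/allpairsP.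
  exists (al n i); rewrite -surjective_pairing; split=> //; apply: hs.
    rewrite /al; case: ifP => [/andP[i1 i2]|_] /=; last by rewrite (pmet_xx dP1) addr_ge0.
    have [p0 _ pP] := hpa n; have [h _] := pP _ _ (leq0n i) i1.
    by rewrite p0 subr0 in h.
  rewrite /al; case: ifP => [/andP[i1 i2]|_] /=; last by rewrite (pmet_xx dP1) addr_ge0.
  have [p0 _ pP] := hpb n; have [h _] := pP _ _ (leq0n i) i2.
  by rewrite p0 subr0 in h.
have lim I N : exists n, [/\ (N <= n)%N, (I < (pa n).1)%N, (I < (pb n).1)%N &
    forall i, (i <= I)%N -> (pa n).2 i = (f i).1 /\ (pb n).2 i = (f i).2].
  have [N' hN'] := longs I; have [n hn hfn] := hf I (maxn N N').
  have [l1 l2] := hN' n (leq_trans (leq_maxr _ _) hn).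
  exists n; split=> //; first exact: leq_trans (leq_maxl _ _) hn.
  move=> i iI; rewrite -(hfn i iI) /al.
  by rewrite (leq_trans iI (ltnW l1)) (leq_trans iI (ltnW l2)).
have ra : ray (fun i => (f i).1).
  split=> [|I i j ij jI].
    have [n [_ l1 _ hn]] := lim 0%N 0%N.
    by rewrite -(hn 0%N (leqnn _)).1; have [] := hpa n.
  have [n [_ l1 _ hn]] := lim I 0%N; have [_ _ pP] := hpa n.
  rewrite -(hn j jI).1 -(hn i (leq_trans ij jI)).1.
  exact: pP ij (leq_trans jI (ltnW l1)).
have rb : ray (fun i => (f i).2).
  split=> [|I i j ij jI].
    have [n [_ _ l1 hn]] := lim 0%N 0%N.
    by rewrite -(hn 0%N (leqnn _)).2; have [] := hpb n.
  have [n [_ _ l1 hn]] := lim I 0%N; have [_ _ pP] := hpb n.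
  rewrite -(hn j jI).2 -(hn i (leq_trans ij jI)).2.
  exact: pP ij (leq_trans jI (ltnW l1)).
apply: (ray_pair_absurd (C := C + 6 * c1) ra rb).
  move=> i j; have [n [_ l1 l2 hn]] := lim (maxn i j) 0%N.
  rewrite -(hn i (leq_maxl _ _)).1 -(hn j (leq_maxr _ _)).2.
  have [p0 pn pP] := hpa n; have [q0 qn qP] := hpb n; have [h1 _] := hab n.
  have ip : (i <= (pa n).1)%N by apply: leq_trans (ltnW l1); exact: leq_maxl.
  have jq : (j <= (pb n).1)%N by apply: leq_trans (ltnW l2); exact: leq_maxr.
  have := coarse_path_excess dk1 pP (leq0n i) ip (leqnn _).
  have := coarse_path_excess dk1 qP (leq0n j) jq (leqnn _).
  rewrite p0 pn q0 qn.
  have := excess_ends (ab n).1 (ab n).2 1%g ((pa n).2 i) ((pb n).2 j) dP1.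
  by move: h1; lra_from.
(* The lifted Mitra criterion makes the image of a point far along a path have large product with
   the image of its end, and the two ends have large product by choice. Two four-point inequalities
   join these three bounds. *)
move=> M; have [N hN] := mitra1 (M + 2 * k).
pose i0 := (Num.truncn (`|N| + 3 * c1)).+1.
have hi0 : N < 2 * i0%:R - 3 * c1.
  have := truncnS_gt (`|N| + 3 * c1); rewrite -/i0.
  by move: (ler_norm N) (ler0n R i0); lra_from.
have far (p : nat * (nat -> H)) x i : p.2 0%N = 1%g -> p.2 p.1 = x ->
    coarse_path d1 c1 p.2 p.1 -> (i0 <= i)%N -> (i <= p.1)%N ->
    M + 2 * k < excess d 1%g (phi (p.2 i)) (phi x).
  move=> p0 pn pP ii ip; rewrite ltNge; apply/negP => /hN.
  have [_ h1] := pP _ _ (leq0n i) ip; have [_ h2] := pP _ _ (leq0n _) (leqnn p.1).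
  have [h3 _] := pP _ _ ip (leqnn _); rewrite p0 pn in h1 h2 h3.
  have iiR : (i0%:R : R) <= i%:R by rewrite ler_nat.
  by rewrite /excess; move: h1 h2 h3 hi0 iiR; lra_from.
exists i0 => i j ii jj /=.
have [n [nN l1 l2 hn]] := lim (maxn i j) (Num.truncn (M + 2 * k)).+1.
rewrite -(hn i (leq_maxl _ _)).1 -(hn j (leq_maxr _ _)).2.
have [p0 pn pP] := hpa n; have [q0 qn qP] := hpb n; have [_ h1] := hab n.
have ip : (i <= (pa n).1)%N by apply: leq_trans (ltnW l1); exact: leq_maxl.
have jq : (j <= (pb n).1)%N by apply: leq_trans (ltnW l2); exact: leq_maxr.
have f1 := far _ _ _ p0 pn pP ii ip; have f2 := far _ _ _ q0 qn qP jj jq.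
have f3 : M + 2 * k < excess d 1%g (phi (ab n).1) (phi (ab n).2).
  apply: le_lt_trans h1; apply: le_trans (ltW (truncnS_gt _)) _.
  by rewrite ler_nat.
have [h|h] := chyp_four dk (phi (ab n).1) 1%g (phi ((pa n).2 i)) (phi ((pb n).2 j)).
  by move: h f1 k0; lra_from.
have [h'|h'] := chyp_four dk (phi (ab n).2) 1%g (phi (ab n).1) (phi ((pb n).2 j)).
  by move: h h' f3; lra_from.
by rewrite excessC// in h'; move: h h' f2; lra_from.
Qed.

End Injective.

(** * Slim triangles and change of metric *)

Section Slim.
Variables (R : realType) (T : Type) (d : T -> T -> R) (c C : R).
Hypotheses (dP : pmet d) (c0 : 0 <= c).
Hypothesis slim : forall a b, exists n (w : nat -> T),
  [/\ w 0%N = a, w n = b, coarse_path d c w n &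
    forall i, (i <= n)%N -> forall x, excess d (w i) a x <= C \/ excess d (w i) x b <= C].
Ltac lra_from := clear -dP c0 slim; lra.

(** Walking from a to b, the first departure from [a, p] yields a point near both [a, p] and [p, b]:
    the centre of the triangle, at distance about half the excess from [p]. Slimness against the
    fourth point is then applied there. *)
Lemma slim_four_point : four_point d (3 * C + 2 * c + 2).
Proof.
move=> x p a b; have [n [w [w0 wn wP wS]]] := slim a b.
suff [q [hq qS]] : exists q, 2 * d p q <= excess d p a b + 2 * C + 2 * c + 2 /\
    forall x, excess d q a x <= C \/ excess d q x b <= C.
  by case: (qS x) => h; [left|right]; [have := excess_move q p a x dP|
    have := excess_move q p x b dP]; move: h hq; lra_from.
have C0 : 0 <= C.
  case: (wS 0%N (leq0n _) p) => h; exact: le_trans (excess_ge0 _ _ _ dP) h.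
pose P i := is_true (excess d (w i) a p <= C).
have [Pn|Pn] := pselect (P n).
  exists b; split; last by move=> x'; have := wS n (leqnn n) x'; rewrite wn.
  move: Pn; rewrite /P wn /excess (pmet_sym dP b a) (pmet_sym dP b p) (pmet_sym dP a p).
  by move: c0 C0; lra_from.
have P0 : P 0%N by rewrite /P w0 excess_end.
have [i [_ iN Pi nP]] := ex_switch (leq0n n) P0 Pn.
have h1 : excess d (w i.+1) p b <= C by case: (wS _ iN p).
have [h2 _] := wP _ _ (leqnSn i) iN; rewrite -natr1 in h2.
exists (w i); split; last by move=> x'; apply: wS; exact: ltnW.
have := excess_move (w i.+1) (w i) p b dP; move: Pi h1 h2 (pmet_tri dP (w i) a b).
rewrite /P /excess (pmet_sym dP p (w i)) (pmet_sym dP a (w i)) (pmet_sym dP p a); lra_from.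
Qed.

Lemma chyp_of_slim : chyp d (3 * C + 2 * c + 2).
Proof.
split=> //; first exact: slim_four_point.
move=> a b t /andP[t0 tab]; have [n [w [w0 wn wP wS]]] := slim a b.
have C0 : 0 <= C.
  case: (wS 0%N (leq0n _) a) => h; exact: le_trans (excess_ge0 _ _ _ dP) h.
have [nt|tn] := lerP n%:R t.
  exists b; have [h _] := wP _ _ (leq0n n) (leqnn n); rewrite (pmet_xx dP).
  by rewrite w0 wn in h; split; move: h nt tab c0 C0; lra_from.
have [i1 i2] := andP (truncn_itv t0); set i := Num.truncn t in i1 i2.
have iN : (i <= n)%N by rewrite -(@ler_nat R); apply: ltW; apply: le_lt_trans tn.
exists (w i); have [h1 _] := wP _ _ (leq0n i) iN; have [h2 _] := wP _ _ iN (leqnn n).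
have [_ h3] := wP _ _ (leq0n n) (leqnn n); rewrite w0 wn in h1 h2 h3.
by rewrite -natr1 in i2; split; move: h1 h2 h3 i1 i2 c0 C0; lra_from.
Qed.

End Slim.

Section ChangeOfMetric.
Variables (R : realType) (T : Type) (d d' : T -> T -> R) (k c L : R).
Hypotheses (dk : chyp d k) (dP' : pmet d') (c0 : 0 <= c) (L0 : 0 <= L).
Hypothesis dd' : forall x y, d x y <= L * d' x y + L.
Hypothesis d'd : forall x y, d' x y <= L * d x y + L.
Hypothesis paths : forall a b, exists n (w : nat -> T),
  [/\ w 0%N = a, w n = b & coarse_path d' c w n].
Let dP := chyp_pmet dk.
Ltac lra_from := clear -dk dP dP' c0 L0 dd' d'd paths; lra.

Let lam := L + c.
Let eps := L * (1 + c) + L.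

Lemma quasi_path_change w n : coarse_path d' c w n -> quasi_path d lam eps w n.
Proof.
move=> wP; split=> [i j ij jn|i iN].
  have [_ h] := wP _ _ ij jn; have := d'd (w i) (w j).
  have := mulr_ge0 c0 (pmet_ge0 dP (w i) (w j)).
  by rewrite /lam mulrDl; move: h; lra_from.
have [h _] := wP _ _ (leqnSn i) iN; rewrite -natr1 in h.
apply: le_trans (dd' _ _) _; rewrite /eps lerD2r ler_wpM2l//.
by move: h; lra_from.
Qed.

Let lam0 : 0 <= lam. Proof. exact: addr_ge0. Qed.
Let eps0 : 0 <= eps. Proof. by rewrite !(addr_ge0, mulr_ge0). Qed.

Lemma excess_change C : exists K, forall p a b, excess d p a b <= C -> excess d' p a b <= K.
Proof.
have [K K0 hK] := morse dk lam0 eps0.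
exists (3 * c + 2 * (L * (2 * C + K) + L)) => p a b h.
have [n [w [w0 wn wP]]] := paths a b.
have [_ m] := hK w n (quasi_path_change wP); rewrite w0 wn in m.
have [i iN hi] := m _ _ h.
have [h1 _] := wP _ _ (leq0n i) iN; have [h2 _] := wP _ _ iN (leqnn n).
have [_ h3] := wP _ _ (leq0n n) (leqnn n); rewrite w0 wn in h1 h2 h3.
have := excess_move (w i) p a b dP'; have := d'd p (w i).
have : L * d p (w i) <= L * (2 * C + K) by exact: ler_wpM2l.
rewrite {2}/excess (pmet_sym dP' (w i) a); move: h1 h2 h3; lra_from.
Qed.

(** Quasiisometry invariance of hyperbolicity: d'-geodesics are d-quasigeodesics, so slimness passes
    through d and back by [excess_change]. *)
Lemma chyp_change : exists k', chyp d' k'.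
Proof.
have [K K0 hK] := morse dk lam0 eps0; have [K1 hK1] := excess_change (K + k).
exists (3 * K1 + 2 * c + 2); apply: chyp_of_slim => // a b.
have [n [w [w0 wn wP]]] := paths a b; exists n, w; split=> // i iN x.
have [m _] := hK w n (quasi_path_change wP); have := m i iN; rewrite w0 wn => hi.
by case: (chyp_four dk x (w i) a b) => h; [left|right]; apply: hK1; move: h hi; lra_from.
Qed.

Lemma excess_change_back C : exists K, forall p a b, excess d' p a b <= C ->
  excess d p a b <= K.
Proof.
have [k' dk'] := chyp_change; have [K K0 hK] := morse dk lam0 eps0.
exists (K + 2 * (L * (2 * C + 7 * c + k' + 1) + L)) => p a b h.
have [n [w [w0 wn wP]]] := paths a b; rewrite -w0 -wn in h *.
have [i iN hi] := coarse_path_near dk' wP c0 h.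
have [m _] := hK w n (quasi_path_change wP); have := m i iN.
have := excess_move (w i) p (w 0%N) (w n) dP; have := dd' p (w i).
have : L * d' p (w i) <= L * (2 * C + 7 * c + k' + 1) by exact: ler_wpM2l.
lra_from.
Qed.

End ChangeOfMetric.

Lemma pmet_pullback (R : realType) (S T : Type) (d : T -> T -> R) (f : S -> T) :
  pmet d -> pmet (fun x y => d (f x) (f y)).
Proof.
case=> h1 h2 h3 h4; split=> [x y|x|x y|y x z]; [exact: h1|exact: h2|exact: h3|exact: h4].
Qed.

(** Applied to the vertices of a Cayley graph and to an orbit in a development. *)
Lemma chyp_pullback (R : realType) (S T : Type) (d : T -> T -> R) (f : S -> T) k c :
  chyp d k -> (forall x, exists y, d x (f y) <= c) ->
  chyp (fun x y => d (f x) (f y)) (`|k| + `|c|).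
Proof.
move=> dk dense; have dP := chyp_pmet dk; split; first exact: pmet_pullback.
  move=> x p a b; have := chyp_four dk (f x) (f p) (f a) (f b); rewrite /excess.
  by move: (ler_norm k) (normr_ge0 c); clear; move=> ? ? [] h; [left|right]; move: h; lra.
move=> x y t /(chyp_geod dk)[p [h1 h2]]; have [q hq] := dense p; exists q.
have t1 := pmet_tri dP p (f x) (f q); have t2 := pmet_tri dP p (f q) (f y).
rewrite (pmet_sym dP (f q) p) in t2; have l1 := ler_norm k; have l2 := ler_norm c.
by rewrite /=; split; [move: t1|move: t2]; move: h1 h2 hq l1 l2; clear; lra.
Qed.

Section HyperbolicSpace.
Variables (R : realType) (X : distSpace R).

Lemma is_metric_pmet : is_metric X -> pmet (@dist R X).
Proof. by case=> h1 h2 h3 h4; split=> // x; apply/h2. Qed.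

Lemma discretize (x y : X) A : geodesic_segment x y A ->
  exists n w, [/\ w 0%N = x, w n = y, coarse_path (@dist R X) 1 w n & forall i, A (w i)].
Proof.
move=> [l [g [l0 g0 gl gd ->]]].
pose w i := g (Num.min i%:R l); exists (Num.truncn l).+1, w.
have m0 i : 0 <= Num.min i%:R l <= l.
  by rewrite le_min ler0n l0 ge_min lexx orbT.
split.
- by rewrite /w min_l.
- by rewrite /w min_r// ltW// truncnS_gt.
- move=> i j ij jn; rewrite /w gd// distrC.
  have jl : (j%:R : R) <= l + 1.
    apply: le_trans (_ : (Num.truncn l).+1%:R <= _); first by rewrite ler_nat.
    by rewrite -natr1 lerD2r; case/andP: (truncn_itv l0).
  have ijR : (i%:R : R) <= j%:R by rewrite ler_nat.
  case: (leP i%:R l) => il; case: (leP j%:R l) => jl'; rewrite ger0_norm;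
    by [split; move: il jl' jl ijR; clear; lra|move: il jl' jl ijR; clear; lra].
by move=> i; exists (Num.min i%:R l) => //=; exact: m0.
Qed.

Lemma segment_excess (x y p : X) A : pmet (@dist R X) -> geodesic_segment x y A ->
  A p -> excess (@dist R X) p x y = 0.
Proof.
move=> dP [l [g [l0 g0 gl gd ->]]] [t /= /andP[t0 tl] <-].
rewrite /excess -gl -g0 !gd ?t0 ?tl ?lexx ?l0//.
rewrite subr0 sub0r normrN (ger0_norm t0) (ger0_norm l0) ler0_norm ?subr_le0//.
by clear; lra.
Qed.

Lemma hyperbolic_chyp : hyperbolic_space X -> exists k, chyp (@dist R X) k.
Proof.
move=> [/is_metric_pmet dP geo [del slim]].
exists (3 * (2 * del) + 2 * 1 + 2); apply: chyp_of_slim => // a b.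
have [A gA] := geo a b; have [n [w [w0 wn wP wA]]] := discretize gA.
exists n, w; split=> // i iN x; have [B gB] := geo a x; have [D gD] := geo x b.
have [q qBD hq] := slim _ _ _ _ _ _ gB gD gA _ (wA i).
have near u v : excess (@dist R X) q u v = 0 -> excess (@dist R X) (w i) u v <= 2 * del.
  by move=> q0; have := excess_move q (w i) u v dP; rewrite q0; move: hq; clear; lra.
by case: qBD => h; [left|right]; apply: near; apply: segment_excess h.
Qed.

End HyperbolicSpace.

(** * Cannon-Thurston maps *)

Section Boundary.
Variables (R : realType) (X : distSpace R) (k : R).
Local Notation dX := (@dist R X).
Hypotheses (dP : pmet dX) (d4 : four_point dX k).
Ltac lra_from := clear -dP d4; lra.

Lemma divergeP (o : X) u v : gromov_diverge u v <-> diverge dX o u v.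
Proof.
split=> [h M|h p M].
  have [N hN] := h o M; exists N => i j /hN/[apply]; have := pmet_ge0 dP o (u i).
  have := excess_ge0 o (u i) (v j) dP.
  by rewrite /gromov_product -/(excess dX o (u i) (v j)); lra_from.
have [N hN] := h (2 * M + 2 * dX o p); exists N => i j /hN/[apply].
have := excess_move p o (u i) (v j) dP.
by rewrite /gromov_product -/(excess dX p (u i) (v j)); lra_from.
Qed.

Lemma diverge_sym o (u v : nat -> X) : diverge dX o u v -> diverge dX o v u.
Proof. by move=> h M; have [N hN] := h M; exists N => i j ? ?; rewrite excessC//; exact: hN. Qed.

Lemma diverge_trans o (v u w : nat -> X) :
  diverge dX o u v -> diverge dX o v w -> diverge dX o u w.
Proof.
move=> h1 h2 M; have [N hN] := h1 (M + k); have [N' hN'] := h2 (M + k).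
exists (maxn N N') => i j; rewrite !geq_max => /andP[i1 i2] /andP[j1 j2].
have := hN i (maxn N N') i1 (leq_maxl _ _); have := hN' (maxn N N') j (leq_maxr _ _) j2.
by case: (d4 (v (maxn N N')) o (u i) (w j)); lra_from.
Qed.

Lemma boundary_ext (xi eta : boundary X) : bseqs xi = bseqs eta -> xi = eta.
Proof. by case: xi eta => [A hA] [B hB] /= AB; move: hA; rewrite AB => hA; congr Boundary. Qed.

Lemma converges_diverge (o : X) u v (xi eta : boundary X) :
  converges_to u xi -> converges_to v eta -> diverge dX o u v <-> xi = eta.
Proof.
have [a ha Aa] := bseqsP xi; have [b hb Bb] := bseqsP eta.
rewrite /converges_to Aa Bb => -[hu au] [hv bv].
rewrite -> (divergeP o) in au, bv; split=> [uv|].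
  have ab : diverge dX o a b by exact: diverge_trans (diverge_trans au uv) (diverge_sym bv).
  apply: boundary_ext; rewrite Aa Bb; apply/seteqP; split=> w [hw] /= aw; split=> //;
    move/(divergeP o): aw => aw; apply/(divergeP o).
    exact: diverge_trans (diverge_sym ab) aw.
  exact: diverge_trans ab aw.
move=> AB; have : bseqs eta v by rewrite Bb; split=> //; apply/(divergeP o).
by rewrite -AB Aa => -[_ /(divergeP o) av]; exact: diverge_trans (diverge_sym au) av.
Qed.

Lemma infinity_converges u : at_infinity u -> exists xi : boundary X, converges_to u xi.
Proof.
by move=> hu; exists (Boundary (ex_intro2 _ _ u hu erefl)); split.
Qed.

End Boundary.

Section CannonThurston.
Variables (R : realType) (X Z : distSpace R) (f : X -> Z) (k1 k : R) (o : X).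
Local Notation dX := (@dist R X).
Local Notation dZ := (@dist R Z).
Hypotheses (dP1 : pmet dX) (d41 : four_point dX k1) (dP : pmet dZ) (d4 : four_point dZ k).
Ltac lra_from := clear -dP1 d41 dP d4; lra.

Definition excess_proper := forall C, exists N, forall a b,
  excess dZ (f o) (f a) (f b) <= C -> excess dX o a b <= N.

Lemma excess_proper_diverge u v : excess_proper -> diverge dX o u v ->
  diverge dZ (f o) (f \o u) (f \o v).
Proof.
move=> fP h M; have [N hN] := fP M; have [n hn] := h (N + 1); exists n => i j ni nj.
rewrite leNgt; apply/negP => /ltW /hN; move: (hn i j ni nj); lra_from.
Qed.

Lemma admits_CT_of_excess : excess_proper -> admits_CT f.
Proof.
move=> fP.
have [df hdf] : exists df : boundary X -> boundary Z, forall xi u,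
    converges_to u xi -> converges_to (f \o u) (df xi).
  apply: (@fun_choice _ _ (fun xi eta => forall u, converges_to u xi ->
    converges_to (f \o u) eta)) => xi.
  have [u hu xiu] := bseqsP xi.
  have fu : at_infinity (f \o u).
    by apply/(divergeP dP (f o)); apply: excess_proper_diverge fP _; apply/(divergeP dP1).
  exists (Boundary (ex_intro2 _ _ (f \o u) fu erefl)) => v; rewrite /converges_to xiu /=.
  move=> [hv uv]; split; apply/(divergeP dP (f o)); apply: excess_proper_diverge fP _.
    exact/(divergeP dP1).
  exact/(divergeP dP1).
exists df; split=> // xi B [[p M] _ hB].
(* The factor 2 passes from Gromov products to excess, the second term moves the base point to
   [f o]. *)
have [N hN] := fP (2 * M + 2 * dZ p (f o)).
exists (o, N + 1) => // eta [u [v [hu hv [n hn]]]]; apply: hB.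
exists (f \o u), (f \o v); split; [exact: hdf|exact: hdf|exists n => i j ni nj].
rewrite leNgt; apply/negP; rewrite /= /gromov_product -/(excess dZ p (f (u i)) (f (v j))) => lt.
have : excess dX o (u i) (v j) <= N.
  apply: hN; have := excess_move p (f o) (f (u i)) (f (v j)) dP.
  by rewrite (pmet_sym dP (f o) p); move: lt; lra_from.
move: (hn i j ni nj) (excess_ge0 o (u i) (v j) dP1).
by rewrite /= /gromov_product -/(excess dX o (u i) (v j)); lra_from.
Qed.

Lemma CT_injectiveP df : is_CT_map f df -> injective df <->
  (forall u v, diverge dX o u u -> diverge dX o v v ->
    diverge dZ (f o) (f \o u) (f \o v) -> diverge dX o u v).
Proof.
move=> [hdf _]; split=> [inj u v /(divergeP dP1 o)/infinity_converges[xi hxi]|h xi eta e].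
  move=> /(divergeP dP1 o)/infinity_converges[eta heta].
  move/(converges_diverge dP d4 (f o) (hdf _ _ hxi) (hdf _ _ heta))/inj => e.
  exact/(converges_diverge dP1 d41 o hxi heta).
have [u hu xiu] := bseqsP xi; have [v hv etav] := bseqsP eta.
have cu : converges_to u xi by rewrite /converges_to xiu; split.
have cv : converges_to v eta by rewrite /converges_to etav; split.
apply/(converges_diverge dP1 d41 o cu cv); apply: h.
- exact/(divergeP dP1 o).
- exact/(divergeP dP1 o).
- exact/(converges_diverge dP d4 (f o) (hdf _ _ cu) (hdf _ _ cv)).
Qed.

End CannonThurston.

(** Read backwards, the criterion says that if the geodesic between the images comes near [f o],
    every geodesic [a, b] meets a fixed ball about [o], which bounds the excess. [K] is the distance
    provided by [coarse_path_near] for c = 1. *)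
Lemma mitra_criterion_excess (R : realType) (X Z : distSpace R) (f : X -> Z) o :
  hyperbolic_space X -> hyperbolic_space Z -> mitra_criterion f -> excess_proper f o.
Proof.
move=> hX hZ mf C; have [k1 dk1] := hyperbolic_chyp hX; have [k dk] := hyperbolic_chyp hZ.
have [M [M0 Moo Mf]] := mf o; pose K := 2 * C + 7 * 1 + k + 1.
have [n _ hn] := Moo _ (nbhs_pinfty_gt (num_real K)).
exists (2 * n%:R) => a b hab.
have [_ geoX _] := hX; have [_ geoZ _] := hZ.
have [A gA] := geoX a b; have [B gB] := geoZ (f a) (f b).
have [m [w [w0 wm wP wB]]] := discretize gB; rewrite -w0 -wm in hab.
have [i im hi] := coarse_path_near dk wP ler01 hab.
have [x Ax hx] : exists2 x, A x & dist o x < n%:R.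
  apply: contrapT => nex; have lt := hn n (leqnn n).
  have : M n <= dist (f o) (w i).
    apply: Mf gA _ gB _ (wB i) => x Ax; rewrite leNgt; apply/negP => ltx.
    by apply: nex; exists x.
  by move: lt hi; rewrite /K /=; clear; lra.
have dP1 := chyp_pmet dk1.
have := excess_move x o a b dP1; rewrite (segment_excess dP1 gA Ax).
by move: hx; clear; lra.
Qed.

(** * Glued metrics, word metrics and Cayley graphs *)

Section Glued.
Variables (R : realType) (T : choiceType) (I : Type) (piece : T -> I).
Variables (d : T -> T -> R) (r : T -> T -> Prop).
Local Notation chain := (chain piece d (r := r)).
Local Notation glued := (glued piece d r).
Hypotheses (d0 : forall x y, 0 <= d x y) (dC : forall x y, d x y = d y x).
Hypothesis conn : forall a b : quot r, exists l, chain a b l.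

Lemma chain_ge0 a b l : chain a b l -> 0 <= l.
Proof. by elim=> // x y c m _ _ m0; rewrite addr_ge0. Qed.

Lemma chain_cat a b c l m : chain a b l -> chain b c m -> chain a c (l + m).
Proof.
elim=> [x|x y z n xy _ IH] h; first by rewrite add0r.
by rewrite -addrA; apply: chain_cons => //; exact: IH.
Qed.

Lemma chain1 x y : piece x = piece y -> chain (\pi_(quot r) x) (\pi_(quot r) y) (d x y).
Proof.
by move=> xy; rewrite -[d x y]addr0; apply: chain_cons => //; exact: chain_nil.
Qed.

Lemma chain_sym a b l : chain a b l -> chain b a l.
Proof.
elim=> [x|x y z n xy _ IH]; first exact: chain_nil.
by rewrite addrC dC; apply: chain_cat IH _; exact: chain1.
Qed.

Lemma glued_le a b l : chain a b l -> dist (d := glued) a b <= l.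
Proof.
move=> h; apply: ge_inf => //; exists 0 => m /=; exact: chain_ge0.
Qed.

Lemma glued_ge a b m : (forall l, chain a b l -> m <= l) -> m <= dist (d := glued) a b.
Proof.
move=> h; apply: lb_le_inf; last by move=> l /h.
by have [l hl] := conn a b; exists l.
Qed.

Lemma glued_pmet : (forall x, d x x = 0) -> pmet (@dist R glued).
Proof.
move=> dxx; have h0 a b : 0 <= dist (d := glued) a b.
  by apply: glued_ge => l; exact: chain_ge0.
split=> //.
- move=> a; apply/eqP; rewrite eq_le h0 andbT; apply: glued_le; exact: chain_nil.
- suff h a b : dist (d := glued) a b <= dist (d := glued) b a.
    by move=> a b; apply/eqP; rewrite eq_le !h.
  by apply: glued_ge => l /chain_sym; exact: glued_le.
move=> b a c; rewrite -lerBlDr; apply: glued_ge => l hl.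
rewrite lerBlDr addrC -lerBlDr; apply: glued_ge => m hm.
by rewrite lerBlDr addrC; apply: glued_le; exact: chain_cat hl hm.
Qed.

Lemma glued_le_piece x y : piece x = piece y ->
  dist (d := glued) (\pi_(quot r) x) (\pi_(quot r) y) <= d x y.
Proof. by move=> xy; apply: glued_le; exact: chain1. Qed.

(** The source of explicit lower bounds on glued distances: a function that is 1-Lipschitz on each
    piece and compatible with the gluing descends to a 1-Lipschitz function. *)
Lemma glued_lip (f : T -> R) : (forall x y, piece x = piece y -> f x - f y <= d x y) ->
  (forall x y, r x y -> f x = f y) ->
  forall x y, f x - f y <= dist (d := glued) (\pi_(quot r) x) (\pi_(quot r) y).
Proof.
move=> fd fr; have fE x : f (repr (\pi_(quot r) x)) = f x.
  have : clos_refl_sym_trans T r (repr (\pi_(quot r) x)) x by apply/Defs.quotP; rewrite reprK.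
  move: (repr _) => y yx; elim: y x / yx => [a b /fr//|//|a b _ ->//|].
  by move=> a b c _ -> _ ->.
move=> x y; apply: glued_ge => l h; rewrite -(fE x) -(fE y).
elim: h => [a|a b c m ab _ IH]; first by rewrite subrr.
rewrite fE in IH; rewrite fE; have := fd _ _ ab; move: IH; clear; lra.
Qed.

End Glued.

Lemma glued_map (R : realType) (T T' : choiceType) (I I' : Type) (piece : T -> I)
    (piece' : T' -> I') (d : T -> T -> R) (d' : T' -> T' -> R) (r : T -> T -> Prop)
    (r' : T' -> T' -> Prop) (F : T -> T') (Q : quot r -> quot r') :
  (forall x y, 0 <= d' x y) ->
  (forall a b, exists l, @chain R T I piece d r a b l) ->
  (forall x, Q (\pi_(quot r) x) = \pi_(quot r') (F x)) ->
  (forall x y, piece x = piece y -> piece' (F x) = piece' (F y)) ->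
  (forall x y, piece x = piece y -> d' (F x) (F y) = d x y) ->
  forall a b, dist (d := glued piece' d' r') (Q a) (Q b) <= dist (d := glued piece d r) a b.
Proof.
move=> d0 conn QF Fp Fd a b; apply: glued_ge => // l h; apply: glued_le => //.
elim: h => [c|x y c m xy _ IH]; first exact: chain_nil.
by rewrite QF -(Fd _ _ xy); apply: chain_cons; [exact: Fp|rewrite -QF].
Qed.

(** * Word length and geodesics of Cayley graphs *)

Section WordLength.
Variables (G : groupType) (S : seq G).
Local Open Scope group_scope.

Inductive reach : nat -> G -> Prop :=
| reach_one : reach 0 1
| reach_mul n g s : s \in S -> reach n g -> reach n.+1 (g * s)
| reach_div n g s : s \in S -> reach n g -> reach n.+1 (g * s^-1).

Lemma reach_cat m n g h : reach m g -> reach n h -> reach (m + n) (g * h).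
Proof.
move=> hg; elim=> [|{}n {}h s sS _ IH|{}n {}h s sS _ IH]; first by rewrite addn0 mulg1.
  by rewrite addnS mulgA; exact: reach_mul.
by rewrite addnS mulgA; exact: reach_div.
Qed.

Lemma reach_inv n g : reach n g -> reach n g^-1.
Proof.
elim=> [|{}n h s sS _ IH|{}n h s sS _ IH]; first by rewrite invg1; exact: reach_one.
  rewrite invgM -add1n; apply: reach_cat IH.
  by rewrite -[s^-1]mul1g; apply: reach_div => //; exact: reach_one.
rewrite invgF -add1n; apply: reach_cat IH.
by rewrite -[s]mul1g; apply: reach_mul => //; exact: reach_one.
Qed.

Hypothesis gS : generates S.

Lemma ex_reach g : exists n, reach n g.
Proof.
pose A : {pred G} := [pred g | `[< exists n, reach n g >]].
have : g \in A; last by move/asboolP.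
refine (@gS A _ _ g); last first.
  by move=> s sS; apply/asboolP; exists 1%N; rewrite -[s]mul1g; apply: reach_mul => //; exact: reach_one.
split=> [|x y]; first by apply/asboolP; exists 0%N; exact: reach_one.
move=> /asboolP[m hm] /asboolP[n hn]; apply/asboolP.
by exists (m + n)%N; apply: reach_cat => //; exact: reach_inv.
Qed.

Definition wlen (g : G) : nat :=
  if pselect (exists n, `[< reach n g >]) is left h then ex_minn h else 0%N.

Lemma wlenP g : reach (wlen g) g /\ forall n, reach n g -> (wlen g <= n)%N.
Proof.
rewrite /wlen; case: pselect => [h|[]].
  by case: ex_minnP => m /asboolP hm mm; split=> // n hn; apply: mm; exact/asboolP.
by have [n hn] := ex_reach g; exists n; exact/asboolP.
Qed.

Lemma wlen1 : wlen 1 = 0%N.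
Proof. by apply/eqP; rewrite -leqn0; apply: (wlenP 1).2; exact: reach_one. Qed.

Lemma wlenM g h : (wlen (g * h) <= wlen g + wlen h)%N.
Proof. by apply: (wlenP _).2; apply: reach_cat; [exact: (wlenP g).1|exact: (wlenP h).1]. Qed.

Lemma wlenV g : wlen g^-1 = wlen g.
Proof.
have le x : (wlen x^-1 <= wlen x)%N by apply: (wlenP _).2; apply: reach_inv; exact: (wlenP x).1.
by apply/eqP; rewrite eqn_leq le -{1}(invgK g) le.
Qed.

Lemma wlen_gen s : s \in S -> (wlen s <= 1)%N.
Proof.
by move=> sS; apply: (wlenP s).2; rewrite -[s]mul1g; apply: reach_mul => //; exact: reach_one.
Qed.

Lemma wlen_mulr g s : s \in S ->
  (wlen (g * s) <= (wlen g).+1)%N /\ (wlen g <= (wlen (g * s)).+1)%N.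
Proof.
move=> sS; have h := wlen_gen sS; have a := wlenM g s.
have b := wlenM (g * s) s^-1; rewrite mulgK wlenV in b.
move: h a b; move: (wlen (g * s)) (wlen g) (wlen s) => x y z; clear; lia.
Qed.

Lemma reach_path n g : reach n g -> exists w : nat -> G, [/\ w 0%N = 1, w n = g &
  forall i, (i < n)%N -> exists2 s, s \in S & w i.+1 = w i * s \/ w i = w i.+1 * s].
Proof.
have ext m h (w : nat -> G) h' : w 0%N = 1 -> w m = h ->
    (forall i, (i < m)%N -> exists2 s, s \in S & w i.+1 = w i * s \/ w i = w i.+1 * s) ->
    (exists2 s, s \in S & h' = h * s \/ h = h' * s) ->
    exists w : nat -> G, [/\ w 0%N = 1, w m.+1 = h' &
      forall i, (i < m.+1)%N -> exists2 s, s \in S & w i.+1 = w i * s \/ w i = w i.+1 * s].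
  move=> w0 wm wS hs; exists (fun i => if (i <= m)%N then w i else h').
  rewrite ltnn; split=> // i; rewrite ltnS => im'.
  have [->|im] := eqVneq i m; first by rewrite ltnn leqnn wm.
  have {im im'} im : (i < m)%N by rewrite ltn_neqAle im.
  by rewrite (ltnW im) im; exact: wS.
elim=> [|m h s sS _ [w [w0 wm wS]]|m h s sS _ [w [w0 wm wS]]]; first by exists (fun=> 1).
  by apply: (ext m h w) => //; exists s => //; left.
by apply: (ext m h w) => //; exists s => //; right; rewrite mulgVK.
Qed.

(** The length changes by at most one per step and must climb from 0 to [n] in [n] steps. *)
Lemma path_wlen n (w : nat -> G) : w 0%N = 1 -> n = wlen (w n) ->
  (forall i, (i < n)%N -> exists2 s, s \in S & w i.+1 = w i * s \/ w i = w i.+1 * s) ->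
  forall i, (i <= n)%N -> wlen (w i) = i.
Proof.
move=> w0 nE wS; have step i : (i < n)%N ->
    (wlen (w i.+1) <= (wlen (w i)).+1)%N.
  move=> /wS[s sS [->|->]]; first by case: (wlen_mulr (w i) sS).
  by case: (wlen_mulr (w i.+1) sS).
have up i : (i <= n)%N -> (wlen (w i) <= i)%N.
  elim: i => [|i IH] iN; first by rewrite w0 wlen1.
  by apply: leq_trans (step i iN) _; rewrite ltnS; exact: IH (ltnW iN).
have down j : (j <= n)%N -> (n <= wlen (w (n - j)) + j)%N.
  elim: j => [_|j IH jn]; first by rewrite subn0 addn0 -nE.
  apply: leq_trans (IH (ltnW jn)) _.
  have e : (n - j = (n - j.+1).+1)%N by move: jn; clear; lia.
  rewrite e addnS -addSn leq_add2r; apply: step; move: jn; clear; lia.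
move=> i iN; have := down (n - i)%N (leq_subr _ _); rewrite subKn// => h.
by apply/eqP; rewrite eqn_leq up//=; move: h iN; clear; lia.
Qed.

End WordLength.

Section CayleyGraph.
Variables (R : realType) (G : groupType) (S : seq G).
Hypothesis gS : generates S.
Local Notation X := (cayley R S).
Local Notation V := (vertex R S).
Local Notation pt := (cayley_point R S).
Local Notation cchain := (chain (@cayley_piece R G S) (@cayley_dist R G S) (r := @cayley_rel R G S)).
Local Notation pi_ x := (\pi_(quot (@cayley_rel R G S)) (x : pt)).

Lemma cayley_dist_ge0 (x y : pt) : 0 <= cayley_dist x y.
Proof. by case: x y => [?|[? ?]] [?|[? ?]] /=. Qed.

Lemma cayley_distC (x y : pt) : cayley_dist x y = cayley_dist y x.
Proof. by case: x y => [?|[? ?]] [?|[? ?]] //=; rewrite distrC. Qed.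

Lemma cayley_distxx (x : pt) : cayley_dist x x = 0.
Proof. by case: x => [?|[? ?]] //=; rewrite subrr normr0. Qed.

Lemma edge_src g s : pi_ (inr ((g, s), itv0 R)) = V g.
Proof. by apply/Defs.quotP/rst_step; exact: cayley_src. Qed.

Lemma edge_tgt g s : pi_ (inr ((g, s), itv1 R)) = V (g * val s)%g.
Proof. by apply/Defs.quotP/rst_step; exact: cayley_tgt. Qed.

Lemma chain_edge g s (t t' : unit_itv R) :
  cchain (pi_ (inr ((g, s), t))) (pi_ (inr ((g, s), t'))) `|val t - val t'|.
Proof.
by apply: (@chain1 R pt _ (@cayley_piece R G S) (@cayley_dist R G S) _
  (inr ((g, s), t)) (inr ((g, s), t'))).
Qed.

Lemma cayley_conn (a b : X) : exists l, cchain a b l.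
Proof.
have vert g : exists l, cchain (V 1%g) (V g) l.
  have [n] := ex_reach gS g; elim=> [|{}n h s sS _ [l hl]|{}n h s sS _ [l hl]].
  - by exists 0; exact: chain_nil.
  - have := chain_edge h (SeqSub sS) (itv0 R) (itv1 R); rewrite edge_src edge_tgt => h'.
    by exists (l + `|0 - 1|); exact: chain_cat hl h'.
  have := chain_edge (h * s^-1)%g (SeqSub sS) (itv1 R) (itv0 R).
  rewrite edge_src edge_tgt /= mulgVK => h'.
  by exists (l + `|1 - 0|); exact: chain_cat hl h'.
have all c : exists l, cchain (V 1%g) c l.
  rewrite -[c]reprK; case: (repr c) => [g|[[g s] t]]; first exact: vert.
  have [l hl] := vert g; exists (l + `|val (itv0 R) - val t|).
  by apply: chain_cat hl _; rewrite -(edge_src g s); exact: chain_edge.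
have [l hl] := all a; have [m hm] := all b; exists (l + m).
by apply: chain_cat hm; apply: chain_sym hl; exact: cayley_distC.
Qed.

Lemma cayley_pmet : pmet (@dist R X).
Proof.
apply: glued_pmet; [exact: cayley_dist_ge0|exact: cayley_distC|exact: cayley_conn|].
exact: cayley_distxx.
Qed.
Let dP := cayley_pmet.
Ltac lra_from := clear -gS dP; lra.

Lemma dist_edge g s (t t' : unit_itv R) :
  dist (pi_ (inr ((g, s), t)) : X) (pi_ (inr ((g, s), t'))) <= `|val t - val t'|.
Proof. by apply: glued_le; [exact: cayley_dist_ge0|exact: chain_edge]. Qed.

(** A candidate for the distance from the vertex [g]: inside an edge, the shorter of the routes
    through its two ends. Neighbouring word lengths differ by at most one, so it descends to the
    graph. *)
Definition height (g : G) (p : pt) : R :=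
  match p with
  | inl h => (wlen S (g^-1 * h)%g)%:R
  | inr (e, t) => Num.min ((wlen S (g^-1 * e.1)%g)%:R + val t)
                          ((wlen S (g^-1 * (e.1 * val e.2))%g)%:R + 1 - val t)
  end.

Lemma height_dist g x y : height g x - height g y <= dist (pi_ x : X) (pi_ y).
Proof.
apply: glued_lip => [|u v|u v]; first (exact: cayley_conn); last first.
- case=> {}h s /=; have [h1 h2] := wlen_mulr gS (g^-1 * h)%g (valP s); rewrite mulgA.
    by rewrite addr0 subr0 min_l// natr1 ler_nat.
  by rewrite addrK min_r// natr1 ler_nat.
- case: u v => [u|[e [t ht]]] [v|[e' [t' ht']]] //= [->]; first by rewrite subrr.
  have := ler_norm (t - t'); have := ler_norm (t' - t); rewrite distrC.
  move: (_%:R) (_%:R) => b a; clear => h1 h2.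
  rewrite lerBlDr; case: (leP (a + t') (b + 1 - t')) => h.
    by rewrite ge_min; apply/orP; left; move: h1 h2; lra.
  by rewrite ge_min; apply/orP; right; move: h1 h2; lra.
Qed.

Definition word_dist (g h : G) : R := (wlen S (g^-1 * h)%g)%:R.

Lemma dist_adjacent g h : (exists2 s, s \in S & h = (g * s)%g \/ g = (h * s)%g) ->
  dist (V g) (V h) <= 1.
Proof.
have one a s : s \in S -> dist (V a) (V (a * s)%g) <= 1.
  move=> sS; have := dist_edge a (SeqSub sS) (itv0 R) (itv1 R).
  by rewrite edge_src edge_tgt /= sub0r normrN normr1.
by case=> s sS [->|->]; [|rewrite (pmet_sym dP)]; exact: one.
Qed.

Lemma vertex_dist g h : dist (V g) (V h) = word_dist g h.
Proof.
apply/eqP; rewrite eq_le; apply/andP; split; last first.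
  have := height_dist g (inl h) (inl g); rewrite {2}/height mulVg wlen1// subr0.
  by rewrite (pmet_sym dP (V g)).
have [r _] := wlenP gS (g^-1 * h)%g; have [w [w0 wn wS]] := reach_path r.
have step i : (i <= wlen S (g^-1 * h)%g)%N -> dist (V g) (V (g * w i)%g) <= i%:R.
  elim: i => [|i IH] iN; first by rewrite w0 mulg1 (pmet_xx dP).
  apply: le_trans (pmet_tri dP (V (g * w i)%g) _ _) _; rewrite -natr1 lerD ?IH 1?ltnW//.
  apply: dist_adjacent; have [s sS ws] := wS i iN; exists s => //.
  by case: ws => ->; rewrite mulgA; [left|right].
by have := step _ (leqnn _); rewrite wn mulVKg.
Qed.

Lemma word_pmet : pmet word_dist.
Proof.
have := pmet_pullback V dP; congr pmet.
by apply/funext => g; apply/funext => h; rewrite vertex_dist.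
Qed.

Lemma word_dist_inv g x y : word_dist (g * x)%g (g * y)%g = word_dist x y.
Proof. by rewrite /word_dist invgM -mulgA mulKg. Qed.

Lemma vertex_dense (a : X) : exists g, dist a (V g) <= 1.
Proof.
rewrite -[a]reprK; case: (repr a) => [g|[[g s] t]]; first by exists g; rewrite (pmet_xx dP).
exists g; rewrite -(edge_src g s); apply: le_trans (dist_edge g s _ _) _.
by case: t => t /= /andP[t0 t1]; rewrite subr0 ger0_norm.
Qed.

Lemma word_path a b : exists n (w : nat -> G),
  [/\ w 0%N = a, w n = b & coarse_path word_dist 0 w n].
Proof.
have [r _] := wlenP gS (a^-1 * b)%g; have [w [w0 wn wS]] := reach_path r.
set n := wlen S _ in wn wS r; have nE : n = wlen S (w n) by rewrite wn.
have wl := path_wlen gS w0 nE wS.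
have step i j : (i <= j)%N -> (j <= n)%N -> word_dist (w i) (w j) <= (j - i)%N%:R.
  elim: j => [|j IH]; first by rewrite leqn0 => /eqP-> _; rewrite (pmet_xx word_pmet).
  rewrite leq_eqVlt => /orP[/eqP-> _|ij jn]; first by rewrite (pmet_xx word_pmet).
  apply: le_trans (pmet_tri word_pmet (w j) _ _) _; rewrite subSn// -natr1.
  apply: lerD; first exact: IH (ltnW jn).
  by rewrite -vertex_dist; apply: dist_adjacent; exact: wS.
exists n, (fun i => a * w i)%g; split; first by rewrite w0 mulg1.
  by rewrite wn mulVKg.
move=> i j ij jn; rewrite word_dist_inv addr0 -natrB// addr0; split; first exact: step.
have := pmet_tri word_pmet (w i) (w 0%N) (w j).
rewrite w0 /word_dist invg1 !mul1g !wl// ?(leq_trans ij)// natrB//; lra_from.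
Qed.

(** Quasiconvexity may come with a generating set whose Cayley graph is not yet known to be
    geodesic, so a segment is built from a shortest word; [height] gives the lower bound on its
    distances. *)
Lemma word_segment a b : exists A, geodesic_segment (V a) (V b) A.
Proof.
have [r _] := wlenP gS (a^-1 * b)%g; have [w' [w0 wn wS]] := reach_path r.
set n := wlen S _ in wn wS r; have nE : n = wlen S (w' n) by rewrite wn.
have wl := path_wlen gS w0 nE wS; pose w i := (a * w' i)%g.
have wlw i : (i <= n)%N -> wlen S (a^-1 * w i)%g = i by move=> iN; rewrite mulKg wl.
(* [E] parametrizes the [i]-th edge in the direction of travel, reversed when the letter is an
   inverse. At [i = n] it is constant, and only u = 0 occurs there. *)
have E i : exists E : R -> pt, forall u : R, (i <= n)%N -> 0 <= u <= 1 ->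
    [/\ pi_ (E 0) = V (w i), (i < n)%N \/ u = 0 -> height a (E u) = i%:R + u,
      forall u', 0 <= u' <= 1 -> dist (pi_ (E u) : X) (pi_ (E u')) <= `|u - u'|,
      dist (V (w i)) (pi_ (E u)) <= u
    & (i < n)%N -> dist (pi_ (E u) : X) (V (w i.+1)) <= 1 - u].
  have [iN|iN] := ltnP i n; last first.
    exists (fun=> inl (w i)) => u iN' /andP[u0 u1].
    split=> [//|[//|->]|u' _||//]; rewrite ?(pmet_xx dP)//.
    by rewrite addr0 /height wlw.
  have [s sS ws] := wS i iN; have i1 := wlw _ iN; have i0 := wlw _ (ltnW iN).
  have uK (u : R) (hu : 0 <= u <= 1) : val (insubd (itv0 R) u) = u by rewrite val_insubd hu.
  have hu0 : 0 <= (0 : R) <= 1 by rewrite lexx ler01.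
  case: ws => ws.
    have wi : w i.+1 = (w i * s)%g by rewrite /w ws mulgA.
    exists (fun u => inr ((w i, SeqSub sS), insubd (itv0 R) u)) => u _ hu; have [u0 u1] := andP hu.
    have src : pi_ (inr ((w i, SeqSub sS), insubd (itv0 R) 0)) = V (w i).
      by rewrite -(edge_src (w i) (SeqSub sS)); congr (pi_ (inr (_, _))); apply: val_inj; rewrite uK.
    split=> //.
    - move=> _; rewrite /= -wi i0 i1 uK// min_l// -natr1; move: u1; lra_from.
    - by move=> u' hu'; apply: le_trans (dist_edge _ _ _ _) _; rewrite !uK.
    - rewrite -src; apply: le_trans (dist_edge _ _ _ _) _.
      by rewrite !uK// sub0r normrN ger0_norm.
    move=> _; rewrite wi -(edge_tgt (w i) (SeqSub sS)); apply: le_trans (dist_edge _ _ _ _) _.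
    by rewrite uK//= distrC ger0_norm// subr_ge0.
  have wi : w i = (w i.+1 * s)%g by rewrite /w ws mulgA.
  have hu1 (u : R) : 0 <= u <= 1 -> 0 <= 1 - u <= 1.
    by move=> /andP[h1 h2]; apply/andP; split; move: h1 h2; lra_from.
  exists (fun u => inr ((w i.+1, SeqSub sS), insubd (itv0 R) (1 - u))) => u _ hu.
  have [u0 u1] := andP hu.
  have src : pi_ (inr ((w i.+1, SeqSub sS), insubd (itv0 R) (1 - 0))) = V (w i).
    rewrite wi -(edge_tgt (w i.+1) (SeqSub sS)); congr (pi_ (inr (_, _))).
    by apply: val_inj; rewrite uK ?hu1// subr0.
  split=> //.
  - move=> _; rewrite /= -wi i0 i1 uK ?hu1// min_r; last by rewrite -natr1; move: u1; lra_from.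
    by lra_from.
  - move=> u' hu'; apply: le_trans (dist_edge _ _ _ _) _; rewrite !uK ?hu1//.
    by rewrite distrC le_eqVlt; apply/orP; left; apply/eqP; congr (`| _ |); lra_from.
  - rewrite -src; apply: le_trans (dist_edge _ _ _ _) _.
    by rewrite !uK ?hu1// subr0 opprB addrC addrNK ger0_norm.
  move=> _; rewrite -(edge_src (w i.+1) (SeqSub sS)); apply: le_trans (dist_edge _ _ _ _) _.
  by rewrite uK ?hu1//= subr0 ger0_norm// subr_ge0.
have {E} [E hE] := fun_choice E.
pose c (t : R) := pi_ (E (Num.truncn t) (t - (Num.truncn t)%:R)).
have tr (t : R) : 0 <= t <= n%:R -> let i := Num.truncn t in
    [/\ (i <= n)%N, 0 <= t - i%:R <= 1 & (i < n)%N \/ t - i%:R = 0].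
  move=> /andP[t0 tn] i; have [h1 h2] := andP (truncn_itv t0); rewrite -/i -natr1 in h1 h2.
  have iN : (i <= n)%N by rewrite -(@ler_nat R); exact: le_trans tn.
  split=> //; first by apply/andP; split; move: h1 h2; lra_from.
  move: iN; rewrite leq_eqVlt => /orP[/eqP iN|]; [right|by left].
  by rewrite iN in h1 *; move: h1 tn; lra_from.
have z01 : 0 <= (0 : R) <= 1 by rewrite lexx ler01.
exists (c @` [set t | 0 <= t <= n%:R]), n%:R, c; split=> //.
- rewrite /c truncn0 subr0; have [-> _ _ _ _] := hE 0%N 0 (leq0n _) z01.
  by rewrite /w w0 mulg1.
- rewrite /c natrK subrr; have [-> _ _ _ _] := hE n 0 (leqnn _) z01.
  by rewrite /w wn mulVKg.
suff le s t : 0 <= s <= n%:R -> 0 <= t <= n%:R -> s <= t -> dist (c s : X) (c t) = t - s.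
  move=> s t hs ht; have [st|/ltW ts] := leP s t.
    by rewrite le// distrC ger0_norm// subr_ge0.
  by rewrite (pmet_sym dP) le// ger0_norm// subr_ge0.
move=> hs ht st; apply/eqP; rewrite eq_le; apply/andP; split; last first.
  have [iN iu io] := tr s hs; have [jN ju jo] := tr t ht.
  have := height_dist a (E (Num.truncn t) (t - (Num.truncn t)%:R))
    (E (Num.truncn s) (s - (Num.truncn s)%:R)).
  have [_ -> // _ _ _] := hE _ _ iN iu; have [_ -> // _ _ _] := hE _ _ jN ju.
  by rewrite (pmet_sym dP) /c; lra_from.
have [iN iu io] := tr s hs; have [jN ju jo] := tr t ht.
rewrite /c; set i := Num.truncn s in iN iu io *; set j := Num.truncn t in jN ju jo *.
have : (i <= j)%N by apply: le_truncn.
have [_ _ h1 _ h2] := hE i _ iN iu; have [_ _ _ h3 _] := hE j _ jN ju.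
rewrite leq_eqVlt => /orP[/eqP ij|ij].
  have := h1 _ (_ : 0 <= t - i%:R <= 1); rewrite ij => /(_ ju).
  by rewrite ler0_norm; move: st; lra_from.
have {}h2 := h2 (leq_trans ij jN).
apply: le_trans (pmet_tri dP (V (w i.+1)) _ _) _.
have := pmet_tri dP (V (w j)) (V (w i.+1)) (pi_ (E j (t - j%:R))).
have : dist (V (w i.+1)) (V (w j)) <= j%:R - i.+1%:R.
  rewrite vertex_dist /w word_dist_inv -natrB//.
  have step l m : (l <= m)%N -> (m <= n)%N -> word_dist (w' l) (w' m) <= (m - l)%N%:R.
    elim: m => [|m IH]; first by rewrite leqn0 => /eqP-> _; rewrite (pmet_xx word_pmet).
    rewrite leq_eqVlt => /orP[/eqP-> _|lm mn]; first by rewrite (pmet_xx word_pmet).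
    apply: le_trans (pmet_tri word_pmet (w' m) _ _) _; rewrite subSn// -natr1.
    apply: lerD; first exact: IH (ltnW mn).
    by rewrite -vertex_dist; apply: dist_adjacent; exact: wS.
  exact: step.
by rewrite -natr1; move: h2 h3; lra_from.
Qed.

End CayleyGraph.

(** * Developments *)

Lemma min_step (R : realType) (z e l : R) : 0 <= e ->
  `|Num.min (z + e) l - Num.min z l| <= e.
Proof.
move=> e0; case: (leP z l) => h1; case: (leP (z + e) l) => h2;
  rewrite ger0_norm; move: h1 h2 e0; lra.
Qed.

Section PiOne.
Variables (V : finType) (Y : scomplex V) (C : complex_of_groups Y) (T : {set edge Y}).
Local Open Scope group_scope.
Local Notation loc_map := (@loc_map V Y C T).
Local Notation k_edge := (@k_edge V Y C T _ _).
Local Notation P := (pi1 C T).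

Lemma wclass_mul (u v : word (gens C)) :
  wclass (pi1_rels T) (u ++ v) = (wclass (pi1_rels T) u : P) * wclass (pi1_rels T) v.
Proof. exact: (esym (wclassM (pi1_rels T) u v)). Qed.

Lemma wclass_rel (u v : word (gens C)) : pi1_rels T u v ->
  wclass (pi1_rels T) u = wclass (pi1_rels T) v.
Proof.
move=> h; apply: (proj1 (wclassP (pi1_rels T) u v)); apply: rst_step.
by have := step_rel [::] [::] h; rewrite !cats0.
Qed.

Lemma loc_mapM s (g h : loc C s) : loc_map (g * h) = loc_map g * loc_map h.
Proof. by rewrite -wclass_mul; symmetry; apply: wclass_rel; exact: rel_loc. Qed.

Lemma loc_map1 s : loc_map (1 : loc C s) = 1.
Proof. by apply: (mulgI (loc_map (1 : loc C s))); rewrite -loc_mapM !mulg1. Qed.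

Lemma loc_mapV s (g : loc C s) : loc_map g^-1 = (loc_map g)^-1.
Proof. by apply: (mulgI (loc_map g)); rewrite -loc_mapM !mulgV loc_map1. Qed.

Lemma wclass_inv (x : gens C) :
  (wclass (pi1_rels T) [:: (x, false)] : P) = (wclass (pi1_rels T) [:: (x, true)])^-1.
Proof.
apply: (mulgI (wclass (pi1_rels T) [:: (x, true)] : P)); rewrite mulgV -wclass_mul.
apply: (proj1 (wclassP (pi1_rels T) [:: (x, true); (x, false)] [::])); apply: rst_step.
exact: (step_cancel (pi1_rels T) [::] [::] x true).
Qed.

Lemma k_edge_conj s t (e : pface s t) (g : loc C s) :
  k_edge e * loc_map g = loc_map (psi C e g) * k_edge e.
Proof.
have := wclass_rel (@rel_conj V Y C T s t e g); 
  rewrite (wclass_mul [:: _] [:: _; _]) (wclass_mul [:: _] [:: _]) wclass_inv.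
move=> h; have {}h : k_edge e * (loc_map g * (k_edge e)^-1) = loc_map (psi C e g) by exact: h.
by rewrite -h -!mulgA mulVg mulg1.
Qed.

Lemma k_edge_comp s t u (st : pface s t) (tu : pface t u) (su : pface s u) :
  k_edge tu * k_edge st = loc_map (twist C st tu) * k_edge su.
Proof.
by have := wclass_rel (@rel_comp V Y C T s t u st tu su); 
  rewrite (wclass_mul [:: _] [:: _]) => ->; rewrite (wclass_mul [:: _] [:: _]).
Qed.

(** [k_edge] made total, so that [vcoord] can be written without a proof of incidence; the value 1
    for s = t is what a vertex needs. *)
Definition face_elt (s t : simplex Y) : P :=
  if @idP (pface s t) is ReflectT h then k_edge h else 1.

Lemma face_eltE s t (h : pface s t) : face_elt s t = k_edge h.
Proof.
rewrite /face_elt; case: {-}_ / idP => [h'|]; last by rewrite h.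
by rewrite (bool_irrelevance h h').
Qed.

Lemma face_elt_id s : face_elt s s = 1.
Proof.
rewrite /face_elt; case: {-}_ / idP => [h'|//].
by exfalso; move: h'; rewrite /pface fintype.properxx.
Qed.

Definition loc_coset (g : P) (s : simplex Y) : set P :=
  [set h | exists l : loc C s, h = g * loc_map l].

Lemma loc_coset_mulr g s h (l : loc C s) :
  loc_coset g s (h * loc_map l) <-> loc_coset g s h.
Proof.
split=> [[m hm]|[m ->]]; last by exists (m * l); rewrite loc_mapM mulgA.
by exists (m * l^-1); rewrite loc_mapM loc_mapV mulgA -hm mulgK.
Qed.

End PiOne.

Section DevelopmentGeometry.
Variables (R : realType) (V : finType) (Y : scomplex V) (C : complex_of_groups Y).
Variable T : {set edge Y}.
Local Notation P := (pi1 C T).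
Local Notation B := (development R C T).
Local Notation pt := (dev_point R C T).
Local Notation pi_ x := (\pi_(quot (@dev_rel R V Y C T)) (x : pt)).
Local Notation dpiece := (fun p : pt => (val p).1).
Local Notation ddist := (fun p q : pt => euclid (val p).2 (val q).2).

Hypothesis hyp : hyperbolic_space B.

Let dP : pmet (@dist R B).
Proof. by apply: is_metric_pmet; case: hyp. Qed.

Lemma euclid_ge0 (x y : {ffun V -> R}) : 0 <= euclid x y.
Proof. exact: sqrtr_ge0. Qed.

Lemma euclid_coord (x y : {ffun V -> R}) v : x v - y v <= euclid x y.
Proof.
apply: le_trans (ler_norm _) _; rewrite -sqrtr_sqr ler_wsqrtr//.
by rewrite (bigD1 v)//= lerDl sumr_ge0// => i _; exact: sqr_ge0.
Qed.

Lemma std_simplexP (s : {set V}) (x : {ffun V -> R}) : std_simplex s x ->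
  [/\ forall v, 0 <= x v, forall v, v \notin s -> x v = 0 & \sum_v x v = 1].
Proof.
by move=> /and3P[/forallP h1 /forallP h2 /eqP h3]; split=> // v /(implyP (h2 v))/eqP.
Qed.

Lemma std_simplex_le1 (s : {set V}) (x : {ffun V -> R}) v : std_simplex s x -> x v <= 1.
Proof.
move=> /std_simplexP[h1 _ <-]; rewrite (bigD1 v)//= lerDl sumr_ge0// => i _; exact: h1.
Qed.

Lemma sum1R : #|V|%:R = \sum_(v : V) 1 :> R.
Proof. by rewrite sumr_const cardE -cardE. Qed.

Lemma euclid_bounded (s : {set V}) (x y : {ffun V -> R}) : std_simplex s x -> std_simplex s y ->
  euclid x y <= Num.sqrt #|V|%:R.
Proof.
move=> hx hy; rewrite /euclid ler_wsqrtr//.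
rewrite sum1R.
apply: ler_sum => v _; have [x0 _ _] := std_simplexP hx; have [y0 _ _] := std_simplexP hy.
move: (x0 v) (y0 v) (std_simplex_le1 v hx) (std_simplex_le1 v hy); move: (x v) (y v).
by clear => a b ? ? ? ?; nra.
Qed.

Lemma ex_std_simplex (s : simplex Y) : exists x : {ffun V -> R}, std_simplex (val s) x.
Proof.
have : val s != finset.set0.
  by apply/eqP => s0; have := simplices_neq0 Y; rewrite -s0 (valP s).
move=> /finset.set0Pn[v vs]; exists [ffun u => (u == v)%:R]; apply/and3P; split.
- by apply/forallP => u; rewrite ffunE ler0n.
- apply/forallP => u; apply/implyP; rewrite ffunE; case: (u =P v) => [->|_]; [by rewrite vs|by rewrite eqxx].
- rewrite (bigD1 v)//= ffunE eqxx big1 ?addr0// => u /negbTE uv; by rewrite ffunE uv.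
Qed.

(** Without a chain the distance would be the infimum of the empty set, which is 0, and the metric
    axiom would give a = b. *)
Lemma dev_conn (a b : B) : exists l, chain dpiece ddist (r := @dev_rel R V Y C T) a b l.
Proof.
apply: contrapT => h; have [[_ m0 _ _] _ _] := hyp.
have ab : a = b.
  apply/(m0 a b); rewrite /dist /= (_ : [set l | _] = set0) ?inf0//.
  by apply/seteqP; split=> // l hl; apply: h; exists l.
by apply: h; exists 0; rewrite ab; exact: chain_nil.
Qed.

Definition dev_act (h : P) (p : pt) : pt :=
  @dev_pt R V Y C T (h * (val p).1.1)%g (val p).1.2 (val p).2 (valP p).

Lemma dev_act_rel h p q : dev_rel p q -> dev_rel (dev_act h p) (dev_act h q).
Proof.
have actE g s (x : {ffun V -> R}) (hx : std_simplex (val s) x) :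
    dev_act h (@dev_pt R V Y C T g s x hx) = @dev_pt R V Y C T (h * g)%g s x hx.
  exact: val_inj.
case=> [g s g' x hx|g s t e x hs ht]; rewrite !actE mulgA; first exact: dev_loc.
exact: dev_edge.
Qed.

Lemma dev_act_dist h (p q : pt) :
  dist (pi_ (dev_act h p) : B) (pi_ (dev_act h q)) = dist (pi_ p : B) (pi_ q).
Proof.
have le g u v : dist (pi_ (dev_act g u) : B) (pi_ (dev_act g v)) <= dist (pi_ u : B) (pi_ v).
  have QF x : @quot_map pt pt (@dev_rel R V Y C T) (@dev_rel R V Y C T) (dev_act g) (pi_ x)
      = pi_ (dev_act g x).
    by apply: quot_mapE => ? ?; exact: dev_act_rel.
  rewrite -!QF; apply: (glued_map (F := dev_act g)) => //.
  - by move=> x y; exact: euclid_ge0.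
  - exact: dev_conn.
  - by move=> x y /= ->.
apply/eqP; rewrite eq_le le /=.
have actK x : dev_act h^-1 (dev_act h x) = x.
  by apply: val_inj; case: x => [[[? ?] ?] ?]; rewrite /= mulKg.
by rewrite -{1}(actK p) -{1}(actK q) le.
Qed.

Section Orbit.
Variables (s0 : simplex Y) (x0 : {ffun V -> R}) (hx0 : std_simplex (val s0) x0).

Definition orbit_pt (g : P) : B := pi_ (dev_pt g hx0).
Definition orbit_dist (g h : P) : R := dist (orbit_pt g) (orbit_pt h).

Lemma orbit_dist_inv g x y : orbit_dist (g * x)%g (g * y)%g = orbit_dist x y.
Proof.
have E z : dev_pt (g * z)%g hx0 = dev_act g (dev_pt z hx0) by exact: val_inj.
by rewrite /orbit_dist /orbit_pt !E dev_act_dist.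
Qed.

(** Translation reduces to the group element 1, and then finitely many simplices of bounded diameter
    remain. *)
Lemma near_orbit : exists c, forall p : pt, dist (pi_ p : B) (orbit_pt (val p).1.1) <= c.
Proof.
have [x hx] := fun_choice ex_std_simplex.
pose bd s : R := dist (pi_ (dev_pt 1%g (hx s)) : B) (orbit_pt 1%g).
exists (Num.sqrt #|V|%:R + \sum_s bd s) => p.
have E (z : pt) : (val z).1.1 = 1%g -> dist (pi_ z : B) (orbit_pt 1%g)
    <= Num.sqrt #|V|%:R + \sum_s bd s.
  case: z => [[[g s] y] hy] /= g1; subst g.
  apply: le_trans (pmet_tri dP (pi_ (dev_pt 1%g (hx s))) _ _) _; apply: lerD.
    apply: le_trans (euclid_bounded hy (hx s)).
    apply: (@glued_le_piece R pt _ dpiece ddist) => // ? ?; exact: euclid_ge0.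
  by rewrite (bigD1 s)//= lerDl sumr_ge0// => ? _; exact: (pmet_ge0 dP).
pose g := (val p).1.1; have := E (dev_act g^-1%g p) (mulVg g).
have -> : orbit_pt 1%g = pi_ (dev_act g^-1%g (dev_pt g hx0)).
  by congr (pi_ _); apply: val_inj; rewrite /= mulVg.
by rewrite dev_act_dist.
Qed.

Lemma orbit_dense : exists c, forall a : B, exists g, dist a (orbit_pt g) <= c.
Proof.
have [c hc] := near_orbit; exists c => a; exists (val (repr a)).1.1.
by have := hc (repr a); rewrite reprK.
Qed.

Definition loc_cosets : set (set P) := [set A | exists g s, A = loc_coset g s].

Lemma loc_coset_bounded : exists c, forall A g h, loc_cosets A -> A g -> A h ->
  orbit_dist g h <= c.
Proof.
have [c hc] := near_orbit; exists (2 * c) => _ g h [a [s ->]] [l ->] [m ->].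
have [x hx] := ex_std_simplex s.
have E (n : loc C s) : pi_ (dev_pt (a * loc_map T n)%g hx) = pi_ (dev_pt a hx).
  by apply/Defs.quotP/rst_step; exact: dev_loc.
have h1 := hc (dev_pt (a * loc_map T l)%g hx); rewrite E /= in h1.
have h2 := hc (dev_pt (a * loc_map T m)%g hx); rewrite E /= in h2.
rewrite /orbit_dist; apply: le_trans (pmet_tri dP (pi_ (dev_pt a hx)) _ _) _.
by rewrite (pmet_sym dP (orbit_pt _)); move: h1 h2; lra.
Qed.

(* the barycentric coordinate at the vertex of the development given by the coset
   [g G_t] of the local group of the vertex [t = {v}] *)
Definition vcoord (g : P) (v : V) (t : simplex Y) (p : pt) : R :=
  if (v \in val (val p).1.2) && `[< loc_coset g t ((val p).1.1 * (face_elt C T (val p).1.2 t)^-1)%g >]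
  then (val p).2 v else 0.

Lemma pface_vertex (s t : simplex Y) v : val t = [set v]%SET -> v \in val s ->
  s = t \/ pface s t.
Proof.
move=> tv vs; have [e|ne] := eqVneq (val s) (val t); first by left; exact: val_inj.
by right; rewrite /pface finset.properEneq eq_sym ne tv finset.sub1set.
Qed.

(** Both gluings respect the coset: for the local groups by the conjugation relation of k_e, for
    faces by the relation on k_e k_e', whose twist is absorbed by the local group of the vertex. *)
Lemma vcoord_rel g v t p q : val t = [set v]%SET -> dev_rel p q ->
  vcoord g v t p = vcoord g v t q.
Proof.
move=> tv; case=> [h s l x hx|h s u e x hs hu]; rewrite /vcoord /=.
  case vs: (v \in val s) => //=; congr (if _ then _ else _); apply: asbool_equiv_eq.
  have [st|st] := pface_vertex tv vs.
    by move: l hx; rewrite st => l hx; rewrite face_elt_id invg1 !mulg1; exact: loc_coset_mulr.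
  rewrite (face_eltE _ _ st) -(mulgA h).
  have -> : (loc_map T l * (k_edge C T st)^-1)%g
      = ((k_edge C T st)^-1 * loc_map T (psi C st l))%g.
    apply: (mulgI (k_edge C T st)); rewrite mulgA k_edge_conj mulgK mulgA mulgV mul1g//.
  by rewrite mulgA; exact: loc_coset_mulr.
have us : val u \subset val s by apply: fintype.proper_sub; exact: e.
(* A vertex outside the face [u] contributes 0 on both sides, since the point lies in [u]. *)
case vu: (v \in val u); last first.
  have [_ x0' _] := std_simplexP hu.
  by rewrite /= [x v]x0' ?vu//; case: ifP.
rewrite (fintype.subsetP us v vu) /=; congr (if _ then _ else _); apply: asbool_equiv_eq.
have [ut|ut] := pface_vertex tv vu.
  by move: e hu us vu; rewrite ut => e _ _ _; rewrite face_elt_id invg1 mulg1 (face_eltE _ _ e).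
have st : pface s t by exact: fintype.proper_trans ut e.
rewrite (face_eltE _ _ ut) (face_eltE _ _ st) -mulgA -invgM (@k_edge_comp V Y C T _ _ _ e ut st) invgM.
by rewrite -loc_mapV mulgA; apply: iff_sym; exact: loc_coset_mulr.
Qed.

Lemma vcoord_lip g v t (p q : pt) : val t = [set v]%SET ->
  vcoord g v t p - vcoord g v t q <= dist (pi_ p : B) (pi_ q).
Proof.
move=> tv; apply: (@glued_lip R pt _ dpiece ddist _ dev_conn).
  move=> x y /= xy; rewrite /vcoord xy; case: ifP => _; first exact: euclid_coord.
  by rewrite subrr euclid_ge0.
by move=> x y; exact: vcoord_rel.
Qed.

Lemma std_simplex_large (s : {set V}) (x : {ffun V -> R}) : std_simplex s x ->
  exists2 v, v \in s & #|V|%:R^-1 <= x v.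
Proof.
move=> /std_simplexP[x0' xs x1]; apply: contrapT => h.
have lt v : x v < #|V|%:R^-1.
  rewrite ltNge; apply/negP => hv; apply: h; exists v => //; apply: contraT => vs.
  have V0 : (0 < #|V|)%N by apply/card_gt0P; exists v.
  by move: hv; rewrite xs// leNgt invr_gt0 ltr0n V0.
have [v _] : exists v : V, true.
  apply: contrapT => nv; move: x1; rewrite big1 => [/eqP|v _]; first by rewrite eq_sym oner_eq0.
  by exfalso; apply: nv; exists v.
have V0 : (0 < #|V|)%N by apply/card_gt0P; exists v.
have : \sum_v x v < \sum_(v : V) #|V|%:R^-1.
  by apply: ltr_sum; [apply/hasP; exists v; rewrite ?mem_index_enum|].
rewrite x1 (_ : \sum_(v : V) _ = #|V|%:R^-1 * \sum_(v : V) 1).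
  by rewrite -sum1R mulVf ?ltxx// pnatr_eq0 -lt0n.
by rewrite mulr_sumr; apply: eq_bigr => ? _; rewrite mulr1.
Qed.

Lemma ex_vertex (s : simplex Y) v : v \in val s -> exists t : simplex Y, val t = [set v]%SET.
Proof.
move=> vs; have h : [set v]%SET \in (Y : {set {set V}}).
  apply: (simplices_down (valP s)); first by rewrite finset.sub1set.
  by apply/finset.set0Pn; exists v; rewrite finset.set11.
by exists (exist _ [set v]%SET h).
Qed.

Section Link.
Variable d : P -> P -> R.
Hypotheses (dPP : pmet d) (d_inv : forall g x y, d (g * x)%g (g * y)%g = d x y).

(** Some barycentric coordinate of [p] is at least 1/|V|, and [vcoord] is 1-Lipschitz, so it is
    still positive at [q]: both simplices contain that vertex of the development. [e] dominates the
    displacements by k_e over the finitely many edges. *)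
Lemma near_piece_of_close : exists2 e, 0 <= e & forall p q : pt,
  dist (pi_ p : B) (pi_ q) < #|V|%:R^-1 ->
  near_piece d loc_cosets e (val p).1.1 (val q).1.1.
Proof.
exists (\sum_s \sum_t d 1%g (face_elt C T s t)^-1%g).
  by apply: sumr_ge0 => s _; apply: sumr_ge0 => t _; exact: pmet_ge0.
move=> [[[g s] x] hx] [[[h u] y] hy] /= lt; have [v vs xv] := std_simplex_large hx.
have [t tv] := ex_vertex vs.
have near a r : d a (a * (face_elt C T r t)^-1)%g
    <= \sum_s \sum_t d 1%g (face_elt C T s t)^-1%g.
  rewrite -{1}(mulg1 a) d_inv (bigD1 r)//= (bigD1 t)//= -addrA lerDl addr_ge0//.
    by apply: sumr_ge0 => ? _; exact: pmet_ge0.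
  by apply: sumr_ge0 => ? _; apply: sumr_ge0 => ? _; exact: pmet_ge0.
pose a := (g * (face_elt C T s t)^-1)%g.
have : 0 < vcoord a v t (exist _ ((h, u), y) hy).
  have := vcoord_lip a (exist _ ((g, s), x) hx) (exist _ ((h, u), y) hy) tv.
  rewrite {1}/vcoord /= vs /= asboolT; last by exists 1%g; rewrite loc_map1 mulg1.
  by move: lt xv; lra.
rewrite /vcoord /=; case: ifP => [/andP[vu /asboolP au] _|]; last by rewrite ltxx.
exists (loc_coset a t), a, (h * (face_elt C T u t)^-1)%g; split=> //.
- by exists a, t.
- by exists 1%g; rewrite loc_map1 mulg1.
- exact: near.
Qed.

Lemma orbit_link : exists2 e, 0 <= e & forall r, exists N, forall g h,
  orbit_dist g h <= r -> link d loc_cosets e N g h.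
Proof.
have [e e0 he] := near_piece_of_close; exists e => // r.
(* A geodesic of B is cut into steps shorter than 1/|V|, each of which stays near one coset. *)
pose del : R := (#|V|%:R + 1)^-1.
have V0 : (0 : R) < #|V|%:R.
  have [v vs _] := std_simplex_large hx0; rewrite ltr0n; apply/card_gt0P; exists v => //.
have del0 : 0 < del by rewrite invr_gt0 addr_gt0.
have delV : del < #|V|%:R^-1 by rewrite ltf_pV2 ?posrE ?addr_gt0// ltrDl.
pose N := (Num.truncn (`|r| / del)).+1; exists N => g h hr.
have [_ geo _] := hyp; have [_ [l [c [l0 c0 cl cd _]]]] := geo (orbit_pt g) (orbit_pt h).
have lr : l <= r.
  move: hr; rewrite /orbit_dist -cl -c0 cd ?lexx ?l0//.
  by rewrite sub0r normrN ger0_norm.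
have lN : l <= N%:R * del.
  rewrite -ler_pdivrMr// ltW//; apply: le_lt_trans (truncnS_gt _).
  apply: ler_wpM2r; first by rewrite invr_ge0 ltW.
  exact: (le_trans lr (ler_norm r)).
pose b i := c (Num.min (i%:R * del) l).
have b0 : b 0%N = orbit_pt g by rewrite /b mul0r min_l.
have bN : b N = orbit_pt h by rewrite /b min_r.
have bstep i : dist (b i) (b i.+1) <= del.
  have hi m : 0 <= Num.min (m%:R * del) l <= l.
    by rewrite le_min l0 ge_min lexx orbT mulr_ge0// ltW.
  rewrite /b cd// distrC -natr1 mulrDl mul1r.
  exact: min_step (ltW del0).
(* At the ends the given representatives are kept, because [repr] may change the group element. *)
pose p i : pt := if i == 0%N then dev_pt g hx0 else
  if i == N then dev_pt h hx0 else repr (b i).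
have pb i : pi_ (p i) = b i.
  by rewrite /p; case: eqP => [->//|_]; case: eqP => [->//|_]; rewrite reprK.
have pstep i : near_piece d loc_cosets e (val (p i)).1.1 (val (p i.+1)).1.1.
  by apply: he; rewrite !pb; apply: le_lt_trans (bstep i) delV.
have pl m i : link d loc_cosets e m (val (p i)).1.1 (val (p (i + m)%N)).1.1.
  elim: m i => [|m IH] i /=; first by rewrite addn0.
  by exists (val (p i.+1)).1.1; [exact: pstep|rewrite addnS -addSn; exact: IH].
by have := pl N 0%N; rewrite add0n {2}/p eqxx.
Qed.

End Link.
End Orbit.
End DevelopmentGeometry.

(** * Change of generators and quasiconvex subsets *)

Lemma sum_seq_ge (R : realType) (T : eqType) (f : T -> R) (s : seq T) x :
  (forall y, 0 <= f y) -> x \in s -> f x <= \sum_(y <- s) f y.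
Proof.
move=> f0; elim: s => // y s IH; rewrite inE big_cons => /orP[/eqP->|/IH h].
  by rewrite lerDl sumr_ge0.
by apply: le_trans h _; rewrite lerDr.
Qed.

Section WordMetric.
Variables (R : realType) (G : groupType).
Local Notation wd S := (@word_dist R G S).

Lemma word_dist_vertex (S : seq G) : generates S ->
  wd S = fun g h => dist (vertex R S g) (vertex R S h).
Proof. by move=> gS; apply/funext => g; apply/funext => h; rewrite vertex_dist. Qed.

Lemma word_chyp (S : seq G) : generates S -> hyperbolic_space (cayley R S) ->
  exists k, chyp (wd S) k.
Proof.
move=> gS /hyperbolic_chyp[k dk]; exists (`|k| + `|1|); rewrite word_dist_vertex//.
by apply: chyp_pullback => // a; exact: vertex_dense.
Qed.

(** By invariance each letter of a word costs at most [L], the sum of the displacements of the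
    generators. *)
Lemma equivariant_lip (G' : groupType) (S : seq G) (f : G -> G') (D : G' -> G' -> R) :
  generates S -> pmet D -> (forall g x y, D (g * x)%g (g * y)%g = D x y) ->
  (forall x y, f (x * y)%g = (f x * f y)%g) ->
  exists2 L, 0 <= L & forall x y, D (f x) (f y) <= L * wd S x y + L.
Proof.
move=> gS DP Dinv fM; pose L := \sum_(s <- S) D 1%g (f s).
have D0 s : 0 <= D 1%g (f s) by exact: pmet_ge0.
have L0 : 0 <= L by exact: sumr_ge0.
exists L => // x y; rewrite -[X in D _ (f X)](mulVKg x) /word_dist.
have gen g s : s \in S -> D (f g) (f (g * s)%g) <= L.
  move=> sS; rewrite fM -{1}(mulg1 (f g)) Dinv.
  exact: (sum_seq_ge (f := fun s => D 1%g (f s))).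
have [r _] := wlenP gS (x^-1 * y)%g.
have key n h : reach S n h -> D (f x) (f (x * h)%g) <= L * n%:R.
  elim=> [|{}n {}h s sS _ IH|{}n {}h s sS _ IH].
  - by rewrite mulg1 (pmet_xx DP) mulr0.
  - rewrite mulgA; have := gen (x * h)%g s sS.
    move: (pmet_tri DP (f (x * h)%g) (f x) (f (x * h * s)%g)) IH.
    by rewrite -natr1 mulrDr mulr1; lra.
  rewrite mulgA; have := gen (x * h * s^-1)%g s sS; rewrite mulgVK.
  move: (pmet_tri DP (f (x * h)%g) (f x) (f (x * h * s^-1)%g)) IH.
  by rewrite (pmet_sym DP (f (x * h)%g)) -natr1 mulrDr mulr1; lra.
by have := key _ _ r; move: L0; lra.
Qed.

Lemma word_dist_change (S S' : seq G) : generates S -> generates S' ->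
  exists2 L, 0 <= L & forall x y, wd S' x y <= L * wd S x y + L /\ wd S x y <= L * wd S' x y + L.
Proof.
move=> gS gS'.
have [L L0 h] := equivariant_lip (f := id) gS (word_pmet R gS') (@word_dist_inv R G S') (fun _ _ => erefl).
have [L' L'0 h'] := equivariant_lip (f := id) gS' (word_pmet R gS) (@word_dist_inv R G S) (fun _ _ => erefl).
exists (L + L'); first exact: addr_ge0.
move=> x y; have z1 := mulr_ge0 L'0 (pmet_ge0 (word_pmet R gS) x y).
have z2 := mulr_ge0 L0 (pmet_ge0 (word_pmet R gS') x y).
by split; rewrite mulrDl; [have := h x y|have := h' x y]; rewrite /=; move: z1 z2 L0 L'0; lra.
Qed.

Lemma word_change (S S' : seq G) k : generates S -> generates S' -> chyp (wd S) k ->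
  [/\ exists k', chyp (wd S') k',
      forall C, exists K, forall p a b, excess (wd S) p a b <= C -> excess (wd S') p a b <= K
    & forall C, exists K, forall p a b, excess (wd S') p a b <= C -> excess (wd S) p a b <= K].
Proof.
move=> gS gS' dk; have [L L0 h] := word_dist_change gS gS'.
have h1 x y := (h x y).1; have h2 x y := (h x y).2.
have dP' := word_pmet R gS'; have pa := word_path R gS'.
split=> [|C|C].
- exact: (chyp_change dk dP' (lexx 0) L0 h2 h1 pa).
- exact: (excess_change dk dP' (lexx 0) L0 h2 h1 pa).
- exact: (excess_change_back dk dP' (lexx 0) L0 h2 h1 pa).
Qed.

Lemma word_ball_finite (S : seq G) : generates S ->
  forall r : R, exists s : seq G, forall x, wd S 1%g x <= r -> x \in s.
Proof.
move=> gS r; have key n : exists s : seq G, forall m x, (m <= n)%N -> reach S m x -> x \in s.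
  elim: n => [|n [s hs]].
    exists [:: 1%g] => m x; rewrite leqn0 => /eqP-> h; inversion h; subst.
    by rewrite inE.
  exists (s ++ [seq (x * y)%g | x <- s, y <- S] ++ [seq (x * y^-1)%g | x <- s, y <- S]).
  move=> m x; rewrite leq_eqVlt => /orP[/eqP->|mn hx]; last by rewrite mem_cat (hs m x).
  move=> h; rewrite !mem_cat; inversion h; subst.
    apply/orP; right; apply/orP; left; apply/allpairsP; exists (g, s0); split=> //=.
    exact: (hs n).
  apply/orP; right; apply/orP; right; apply/allpairsP; exists (g, s0); split=> //=.
  exact: (hs n).
have [s hs] := key (Num.truncn r); exists s => x.
rewrite /word_dist invg1 mul1g => hx; have [rx _] := wlenP gS x; apply: hs rx.
by rewrite truncn_ge_nat// (le_trans _ hx).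
Qed.

(** Translates quasiconvexity from geodesics of one Cayley graph to excess in any word metric: a
    geodesic between the vertices is rounded to vertices, and the rounded path passes near [p]. *)
Lemma quasiconvex_near (S : seq G) k (A : set G) : generates S -> chyp (wd S) k ->
  quasiconvex R A -> forall C, exists K, forall a b p, A a -> A b ->
  excess (wd S) p a b <= C -> exists2 z, A z & wd S p z <= K.
Proof.
move=> gS dk [S' gS' [k' hk']] C.
have [[k1 dk1] ch _] := word_change gS gS' dk; have [C' hC'] := ch C.
have [L L0 hL] := word_dist_change gS gS'.
have XP := cayley_pmet R gS'.
exists (L * (2 * (C' + 4) + 7 * 3 + k1 + 1 + (1 + k')) + L) => a b p Aa Ab /hC' h.
have [B gB] := word_segment R gS' a b; have [n [w [w0 wn wP wB]]] := discretize gB.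
have [u hu] := fun_choice (fun i => vertex_dense gS' (w i)).
have vd x y : wd S' x y = dist (vertex R S' x) (vertex R S' y) by rewrite vertex_dist.
have uP : coarse_path (wd S') 3 u n.
  move=> i j ij jn; have [h1 h2] := wP i j ij jn; rewrite vd.
  have t1 := pmet_tri XP (w i) (vertex R S' (u i)) (vertex R S' (u j)).
  have t2 := pmet_tri XP (w j) (w i) (vertex R S' (u j)).
  have t3 := pmet_tri XP (vertex R S' (u i)) (w i) (w j).
  have t4 := pmet_tri XP (vertex R S' (u j)) (vertex R S' (u i)) (w j).
  rewrite (pmet_sym XP (vertex R S' (u i)) (w i)) in t1.
  rewrite (pmet_sym XP (vertex R S' (u j)) (w j)) in t4.
  by split; move: t1 t2 t3 t4 (hu i) (hu j) h1 h2; clear; lra.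
have hp : excess (wd S') p (u 0%N) (u n) <= C' + 4.
  have := excess_lip p a b p (u 0%N) (u n) (word_pmet R gS').
  rewrite (pmet_xx (word_pmet R gS')) !vd.
  have := hu 0%N; have := hu n; rewrite w0 wn (pmet_sym XP (vertex R S' b)).
  by rewrite (pmet_sym XP (vertex R S' a)); move: h; clear; lra.
have [i iN hi] := coarse_path_near dk1 uP (ler0n R 3) hp.
have [z Az hz] := hk' _ _ _ Aa Ab gB _ (wB i); exists z => //.
apply: le_trans (hL p z).2 _; rewrite lerD2r; apply: ler_wpM2l => //.
apply: le_trans (pmet_tri (word_pmet R gS') (u i) _ _) _; apply: lerD hi _.
rewrite vd; have := pmet_tri XP (w i) (vertex R S' (u i)) (vertex R S' z).
by rewrite (pmet_sym XP (vertex R S' (u i)) (w i)); move: hz (hu i); clear; lra.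
Qed.

Lemma near_quasiconvex (S : seq G) (A : set G) : generates S ->
  (forall C, exists K, forall a b p, A a -> A b -> excess (wd S) p a b <= C ->
     exists2 z, A z & wd S p z <= K) -> quasiconvex R A.
Proof.
move=> gS qc; have [K hK] := qc 2; exists S => //; exists (1 + K) => a b B Aa Ab gB p Bp.
have XP := cayley_pmet R gS; have [g hg] := vertex_dense gS p.
have h := segment_excess XP gB Bp.
have [|z Az hz] := hK a b g Aa Ab.
  have := excess_move p (vertex R S g) (vertex R S a) (vertex R S b) XP.
  by rewrite h word_dist_vertex// (pmet_sym XP (vertex R S g)) /excess; move: hg; clear; lra.
exists z => //; apply: le_trans (pmet_tri XP (vertex R S g) _ _) _.
by rewrite vertex_dist// lerD.
Qed.

End WordMetric.

(** A ball of G is finite and each of its elements has at most one preimage; invariance moves [x] to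
    the identity. *)
Lemma injective_proper (R : realType) (H G : groupType) (S1 : seq H) (S : seq G)
    (phi : ghom H G) : generates S1 -> generates S -> injective phi ->
  forall r, exists K, forall x y,
    @word_dist R G S (phi x) (phi y) <= r -> @word_dist R H S1 x y <= K.
Proof.
move=> gS1 gS inj r; have [s hs] := word_ball_finite gS r.
have [K hK] : exists K, forall h, phi h \in s -> @word_dist R H S1 1%g h <= K.
  elim: s {hs} => [|g s [K hK]]; first by exists 0.
  have [[h hg]|nh] := pselect (exists h, phi h = g).
    exists (`|K| + `|@word_dist R H S1 1%g h|) => h'; rewrite inE => /orP[/eqP e|/hK].
      have -> : h' = h by apply: inj; rewrite hg.
      by move: (normr_ge0 K) (ler_norm (@word_dist R H S1 1%g h)); lra.
    by move: (normr_ge0 (@word_dist R H S1 1%g h)) (ler_norm K); lra.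
  exists K => h; rewrite inE => /orP[/eqP e|]; last exact: hK.
  by exfalso; apply: nh; exists h.
exists K => x y h; rewrite -(word_dist_inv R S1 x^-1%g) mulVg; apply: hK; apply: hs.
by rewrite gmulfM gmulfV -(mulVg (phi x)) word_dist_inv.
Qed.

Section QuasiIsometry.
Variables (R : realType) (S T : Type) (d1 : S -> S -> R) (d : T -> T -> R) (f : S -> T).
Variables (k1 k L : R).
Hypotheses (dk1 : chyp d1 k1) (dk : chyp d k) (L0 : 0 <= L).
Hypothesis up : forall x y, d (f x) (f y) <= L * d1 x y + L.
Hypothesis low : forall x y, d1 x y <= L * d (f x) (f y) + L.
Let dP1 := chyp_pmet dk1.
Let dP := chyp_pmet dk.
Ltac lra_from := clear -dk1 dk L0 up low dP1 dP; lra.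

Lemma qi_quasi_path : exists lam eps, [/\ 0 <= lam, 0 <= eps & forall w n,
  coarse_path d1 (5 * k1 + 4) w n -> quasi_path d lam eps (f \o w) n].
Proof.
pose c := 5 * `|k1| + 4; have c0 : 0 <= c by rewrite /c; move: (normr_ge0 k1); lra_from.
exists (L + c), (L * (1 + c) + L); split; [exact: addr_ge0|by rewrite !(addr_ge0, mulr_ge0)|].
move=> w n; have k10 := chyp_ge0 dk1 (w 0%N).
have -> : 5 * k1 + 4 = c by rewrite /c ger0_norm.
move=> wP; split=> [i j ij jn|i iN] /=.
  have [_ h] := wP _ _ ij jn; have := low (w i) (w j).
  have := mulr_ge0 c0 (pmet_ge0 dP (f (w i)) (f (w j))).
  by rewrite (mulrDl L c); move: h; lra_from.
have [h _] := wP _ _ (leqnSn i) iN; rewrite -natr1 in h.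
apply: le_trans (up _ _) _; rewrite lerD2r ler_wpM2l//.
by move: h; lra_from.
Qed.

Lemma qi_excess C : exists K, forall p a b, excess d1 p a b <= C ->
  excess d (f p) (f a) (f b) <= K.
Proof.
have [lam [eps [lam0 eps0 hq]]] := qi_quasi_path; have [K K0 hK] := morse dk lam0 eps0.
pose Z := 2 * C + 7 * (5 * k1 + 4) + k1 + 1.
exists (K + 2 * (L * Z + L)) => p a b h; have k10 := chyp_ge0 dk1 p.
have [n [w [w0 wn _ wP]]] := geodesic_path dk1 a b.
have [m _] := hK _ _ (hq _ _ wP); rewrite -w0 -wn in h *.
have c0 : 0 <= 5 * k1 + 4 by move: k10; lra_from.
have [i iN hi] := coarse_path_near dk1 wP c0 h; have := m i iN.
have := excess_move (f (w i)) (f p) (f (w 0%N)) (f (w n)) dP; have := up p (w i).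
have : L * d1 p (w i) <= L * Z by exact: ler_wpM2l.
by rewrite /=; lra_from.
Qed.

Lemma qi_excess_back C : exists K, forall p a b, excess d (f p) (f a) (f b) <= C ->
  excess d1 p a b <= K.
Proof.
have [lam [eps [lam0 eps0 hq]]] := qi_quasi_path; have [K K0 hK] := morse dk lam0 eps0.
exists (3 * (5 * k1 + 4) + 2 * (L * (2 * C + K) + L)) => p a b h.
have [n [w [w0 wn _ wP]]] := geodesic_path dk1 a b.
have [_ m] := hK _ _ (hq _ _ wP); rewrite /= in m; rewrite -w0 -wn in h *.
have [i iN hi] := m _ _ h; have := coarse_path_excess dk1 wP (leq0n i) iN (leqnn n).
have := excess_move (w i) p (w 0%N) (w n) dP1; have := low p (w i).
have : L * d (f p) (f (w i)) <= L * (2 * C + K) by exact: ler_wpM2l.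
lra_from.
Qed.

End QuasiIsometry.

(** * The subcomplex and the theorem *)

Record comparison (R : realType) (S T : Type) (phi : S -> T) (d1 D1 : S -> S -> R)
    (d D : T -> T -> R) (k1 kD1 L1 k kD Lg L : R) : Prop := Comparison {
  comparison_dom : electric d1 D1 k1 kD1 L1;
  comparison_cod : electric d D k kD Lg;
  comparison_ge0 : 0 <= L;
  comparison_lip : forall x y, d (phi x) (phi y) <= L * d1 x y + L;
  comparison_lipD : forall x y, D (phi x) (phi y) <= D1 x y;
  comparison_proper : forall r, exists K, forall x y, d (phi x) (phi y) <= r -> d1 x y <= K;
  comparison_follow : forall r C, exists K, forall q q' y, D1 q q' <= r ->
    excess d y (phi q) (phi q') <= C ->
    exists2 z, excess d1 z q q' <= K & d y (phi z) <= K }.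

Section Electrify.
Variables (R : realType) (V : finType) (Y : scomplex V) (C : complex_of_groups Y).
Variable T : {set edge Y}.
Local Notation P := (pi1 C T).
Variables (S : seq P) (k : R) (s0 : simplex Y) (x0 : {ffun V -> R}).
Hypotheses (hypX : hyperbolic_space (development R C T)) (gS : generates S).
Hypothesis dk : chyp (@word_dist R _ S) k.
Variable hx0 : std_simplex (val s0) x0.
Local Notation d := (@word_dist R _ S).

Lemma orbit_pmet : pmet (@orbit_dist R V Y C T s0 x0 hx0).
Proof.
apply: (pmet_pullback (@orbit_pt R V Y C T s0 x0 hx0)); apply: is_metric_pmet.
by case: hypX.
Qed.

Lemma orbit_chyp : exists kD, chyp (@orbit_dist R V Y C T s0 x0 hx0) kD.
Proof.
have [kX dX] := hyperbolic_chyp hypX; have [c hc] := orbit_dense hypX hx0.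
by exists (`|kX| + `|c|); apply: chyp_pullback hc.
Qed.

Lemma orbit_electric : qc_family d (@loc_cosets V Y C T) ->
  exists kD L, electric d (@orbit_dist R V Y C T s0 x0 hx0) k kD L.
Proof.
move=> Fqc; have [kD Dk] := orbit_chyp.
have [L L0 lip] := equivariant_lip (f := id) gS orbit_pmet (orbit_dist_inv hypX hx0) (fun _ _ => erefl).
exists kD, L; split=> // r M; have [e e0 hl] := orbit_link hypX hx0 (word_pmet R gS) (@word_dist_inv R P S).
have [N hN] := hl r; have [c hc] := loc_coset_bounded hypX hx0.
have [K hK] := link_bounded dk orbit_pmet L0 e0 Fqc lip hc N M.
by exists K => x y p /hN; exact: hK.
Qed.

Lemma word_excess_inv g p a b :
  excess d (g * p)%g (g * a)%g (g * b)%g = excess d p a b.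
Proof. by rewrite /excess !word_dist_inv. Qed.

(** Uniformity over all cosets comes from left invariance and the finiteness of the set of
    simplices. *)
Lemma loc_cosets_qc : (forall s, quasiconvex R (range (@loc_map V Y C T s))) ->
  qc_family d (@loc_cosets V Y C T).
Proof.
move=> qc M; have [K hK] := fun_choice (fun s => quasiconvex_near gS dk (qc s) M).
exists (\sum_s `|K s|) => _ _ _ p [g [s ->]] [l ->] [m ->].
rewrite -[p in excess _ p](mulVKg g) word_excess_inv => h.
have [|| _ [n _ <-] hz] := hK s _ _ _ _ _ h; [by exists l|by exists m|].
exists (g * loc_map T n)%g; first by exists n.
rewrite -(mulVKg g p) word_dist_inv; apply: le_trans hz (le_trans (ler_norm _) _).
by rewrite (bigD1 s)//= lerDl sumr_ge0.
Qed.

End Electrify.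

Section Subcomplex.
Variables (R : realType) (V : finType) (Y Y1 : scomplex V).
Variables (C : complex_of_groups Y) (T : {set edge Y}).
Variable sub : (Y1 : {set {set V}}) \subset (Y : {set {set V}}).
Local Notation C1 := (restrict_groups sub C).
Local Notation T1 := (restrict_tree sub T).
Local Notation G := (pi1 C T).
Local Notation H := (pi1 C1 T1).
Local Notation phi := (natural_hom sub C T).
Local Notation X := (development R C T).
Local Notation X1 := (development R C1 T1).
Local Notation j := (dev_map R sub C T).

Lemma natural_hom_loc (s : simplex Y1) (l : loc C1 s) :
  phi (loc_map T1 l) = @loc_map V Y C T (Defs.incl sub s) l.
Proof. by rewrite natural_homE. Qed.

Variables (s0 : simplex Y1) (x0 : {ffun V -> R}) (hx0 : std_simplex (val s0) x0).

Let hx0' : std_simplex (val (Defs.incl sub s0)) x0 := hx0.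
Local Notation o1 := (@orbit_pt R V Y1 C1 T1 s0 x0 hx0).
Local Notation o := (@orbit_pt R V Y C T (Defs.incl sub s0) x0 hx0').
Local Notation D1 := (@orbit_dist R V Y1 C1 T1 s0 x0 hx0).
Local Notation D := (@orbit_dist R V Y C T (Defs.incl sub s0) x0 hx0').

Lemma dev_map_orbit h : j (o1 h) = o (phi h).
Proof. by rewrite /orbit_pt dev_mapE; congr (\pi_(quot _) _); exact: val_inj. Qed.

Hypotheses (hypX : hyperbolic_space X) (hypX1 : hyperbolic_space X1).

Lemma dev_map_le a b : dist (j a) (j b) <= dist a b.
Proof.
apply: (glued_map (F := @dev_incl R V Y Y1 sub C T)) => //.
- by move=> x y; exact: euclid_ge0.
- exact: dev_conn.
- by move=> x; exact: dev_mapE.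
- by move=> x y /= ->.
Qed.

Lemma orbit_dist_le x y : D (phi x) (phi y) <= D1 x y.
Proof. by rewrite /orbit_dist -!dev_map_orbit; exact: dev_map_le. Qed.

Variables (S : seq G) (S1 : seq H) (k k1 : R).
Hypotheses (gS : generates S) (gS1 : generates S1).
Hypotheses (dk : chyp (@word_dist R _ S) k) (dk1 : chyp (@word_dist R _ S1) k1).
Hypothesis qc : forall s, quasiconvex R (range (@loc_map V Y C T s)).
Hypothesis inj : injective phi.
Ltac lra_from := clear -hx0 hx0' hypX hypX1 gS gS1 dk dk1 qc inj; lra.
Local Notation d := (@word_dist R _ S).
Local Notation d1 := (@word_dist R _ S1).

Lemma orbit_comparison : exists kD1 L1 kD Lg L,
  comparison phi d1 D1 d D k1 kD1 L1 k kD Lg L.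
Proof.
have FqcG := loc_cosets_qc gS dk qc.
have Fqc M : exists K, forall A x y p, @loc_cosets V Y1 C1 T1 A -> A x -> A y ->
    excess d p (phi x) (phi y) <= M -> exists2 z, A z & d p (phi z) <= K.
  have [K hK] := FqcG M; exists K => _ _ _ p [h [s ->]] [l ->] [m ->].
  rewrite !gmulfM !natural_hom_loc => hp.
  have [|||_ [n ->] hn] := hK (loc_coset (phi h) (Defs.incl sub s)) _ _ p _ _ _ hp.
  - by exists (phi h), (Defs.incl sub s).
  - by exists l.
  - by exists m.
  (* Restriction keeps the local groups, so the element found in the coset of G already comes from
     H. *)
  exists (h * loc_map T1 (n : loc C1 s))%g; first by exists n.
  by rewrite gmulfM natural_hom_loc.
have [L L0 lip] := equivariant_lip gS1 (word_pmet R gS) (@word_dist_inv R _ S) (gmulfM (s := phi)).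
have proper := injective_proper (R := R) gS1 gS inj.
have [e e0 hl] := orbit_link hypX1 hx0 (word_pmet R gS1) (@word_dist_inv R H S1).
have Fqc1 : qc_family d1 (@loc_cosets V Y1 C1 T1).
  exact: (piece_qc dk1 dk L0 lip inj proper Fqc).
have [kD1 [L1 E1]] := orbit_electric hypX1 gS1 dk1 hx0 Fqc1.
have [kD [Lg E]] := orbit_electric hypX gS dk hx0' FqcG.
exists kD1, L1, kD, Lg, L; split=> //; first exact: orbit_dist_le.
move=> r M; have [N hN] := hl r.
(* Excess 0 suffices in the induction, as [q] and [q'] are themselves the ends of the geodesic. *)
have [K hK] := link_lift e dk1 dk L0 lip inj proper Fqc N 0 M.
exists K => q q' y hq hy; apply: hK (hN _ _ hq) _ _ hy.
  by rewrite excess_end//; exact: word_pmet.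
by rewrite excess_end2//; exact: word_pmet.
Qed.

Definition orbit_proper := forall M, exists N, forall a b : H,
  excess D 1%g (phi a) (phi b) <= M -> excess D1 1%g a b <= N.

Lemma orbit_proper_lift : orbit_proper -> forall M, exists N, forall a b : H,
  excess d 1%g (phi a) (phi b) <= M -> excess d1 1%g a b <= N.
Proof.
have [kD1 [L1 [kD [Lg [L [E1 E L0 lip lipD pr fo]]]]]] := orbit_comparison.
move=> op; have phi1 : phi 1%g = 1%g by exact: gmulf1.
rewrite -phi1; apply: (mitra_lift E1 E L0 lip pr fo).
by rewrite phi1; exact: op.
Qed.

(** Images of d1-geodesics stay near the d-geodesics between their ends by [excess_of_injective];
    having bounded steps, they pass near every point of them. *)
Lemma quasiconvex_of_injective : orbit_proper ->
  (forall u v, diverge D1 1%g u u -> diverge D1 1%g v v ->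
    diverge D 1%g (phi \o u) (phi \o v) -> diverge D1 1%g u v) ->
  quasiconvex R (range phi).
Proof.
move=> op bi; have [kD1 [L1 [kD [Lg [L [E1 E L0 lip lipD pr fo]]]]]] := orbit_comparison.
have ex := excess_of_injective E1 E L0 lip lipD pr fo op
  (@word_dist_inv R _ S1) (@word_dist_inv R _ S) (word_ball_finite gS1) bi.
have k10 := chyp_ge0 dk1 1%g.
have [K hK] := ex (3 * (5 * k1 + 4)); pose st := L * (5 * k1 + 5) + L.
have st0 : 0 <= st by rewrite addr_ge0// mulr_ge0//; move: k10; lra_from.
apply: (near_quasiconvex gS) => M; exists (2 * (`|M| + `|K|) + k + st).
move=> _ _ p [a _ <-] [b _ <-] h.
have [n [w [w0 wn _ wP]]] := geodesic_path dk1 a b.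
rewrite -w0 -wn in h.
have [||||i iN hi] := path_crossing dk (C := `|M| + `|K|) (e := st) (w := phi \o w) (n := n) (p := p).
- move=> i iN /=; have := hK _ _ _ (coarse_path_excess dk1 wP (leq0n i) iN (leqnn n)).
  by move: (ler_norm K) (normr_ge0 M); lra_from.
- move=> i iN /=; apply: le_trans (lip _ _) _; rewrite lerD2r; apply: ler_wpM2l => //.
  by have [h' _] := wP _ _ (leqnSn i) iN; rewrite -natr1 in h'; move: h'; lra_from.
- exact: st0.
- by move: h (ler_norm M) (normr_ge0 K); rewrite /=; lra_from.
by exists (phi (w i)).
Qed.

Lemma orbit_excess_of_quasiconvex : quasiconvex R (range phi) ->
  forall M, exists K, forall p a b : H, excess D1 p a b <= M ->
    excess D (phi p) (phi a) (phi b) <= K.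
Proof.
move=> qcH; have [kD1 [L1 [kD [Lg [L [E1 E L0 lip lipD pr fo]]]]]] := orbit_comparison.
apply: (excess_of_qc E1 E lipD) => M.
have [|K hK] := piece_image (F := [set setT]) dk1 dk L0 lip inj pr _ M.
  move=> M'; have [K hK] := quasiconvex_near gS dk qcH M'; exists K => _ a b p -> _ _ hp.
  by have [||_ [z _ <-] hz] := hK _ _ p _ _ hp; [exists a|exists b|exists z].
by exists K => p a b; exact: hK.
Qed.

Lemma excess_proper_orbit : excess_proper j (o1 1%g) -> orbit_proper.
Proof.
move=> jp M; have [N hN] := jp M; exists N => a b h; apply: hN.
by rewrite !dev_map_orbit gmulf1.
Qed.

Lemma qi_embedding_excess : qi_embedding j ->
  (forall M, exists K, forall p a b : H, excess D1 p a b <= M ->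
     excess D (phi p) (phi a) (phi b) <= K) /\
  (forall M, exists K, forall p a b : H, excess D (phi p) (phi a) (phi b) <= M ->
     excess D1 p a b <= K).
Proof.
move=> [l [e [l1 e0 hj]]]; have [kD1 Dk1] := orbit_chyp hypX1 hx0.
have [kD Dk] := orbit_chyp hypX hx0'; have DP1 := chyp_pmet Dk1; have DP := chyp_pmet Dk.
have l0 : 0 < l by apply: lt_le_trans l1.
pose L := l * (1 + e); have L0 : 0 <= L by rewrite mulr_ge0 ?addr_ge0// ltW.
have le0 : 0 <= l * e by rewrite mulr_ge0// ltW.
have up x y : D (phi x) (phi y) <= L * D1 x y + L.
  have := orbit_dist_le x y; have := pmet_ge0 DP1 x y; rewrite /L => h0.
  have : 0 <= (l - 1) * D1 x y by rewrite mulr_ge0// subr_ge0.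
  have : 0 <= l * e * D1 x y by rewrite mulr_ge0.
  by move: le0 l1; lra.
have low x y : D1 x y <= L * D (phi x) (phi y) + L.
  have [h _] := hj (o1 x) (o1 y); rewrite !dev_map_orbit -/(D _ _) -/(D1 _ _) in h.
  have {}h : D1 x y <= l * (D (phi x) (phi y) + e).
    by rewrite -ler_pdivrMl// mulrC -lerBlDr.
  have : 0 <= l * e * D (phi x) (phi y) by rewrite mulr_ge0//; exact: (pmet_ge0 DP).
  by move: h le0 l1; rewrite /L; lra.
split=> M; [exact: (qi_excess Dk1 Dk L0 up low)|exact: (qi_excess_back Dk1 Dk L0 up low)].
Qed.

End Subcomplex.
(** The generating sets of the Cayley graphs are arbitrary, so the bound is carried through two
    changes of word metric; rounding [a] and [b] to vertices at distance at most 1 costs 4. *)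
Lemma group_admits_CT_of_excess (R : realType) (H G : groupType) (phi : ghom H G)
    (S1 : seq H) (S0 : seq G) k1 k :
  generates S1 -> generates S0 -> chyp (@word_dist R H S1) k1 -> chyp (@word_dist R G S0) k ->
  (forall M, exists N, forall a b : H,
    excess (@word_dist R G S0) 1%g (phi a) (phi b) <= M ->
    excess (@word_dist R H S1) 1%g a b <= N) ->
  group_admits_CT R phi.
Proof.
move=> gS1 gS0 dk1 dk lift S S' SS' gS gS'.
have [[k' dk'] _ back] := word_change gS0 gS' dk.
have [[k1' dk1'] forth _] := word_change gS1 gS dk1.
have XP := cayley_pmet R gS; have ZP := cayley_pmet R gS'.
set f := cayley_map SS'.
have fV g : f (vertex R S g) = vertex R S' (phi g) by rewrite /f cayley_mapE.
have f_le a b : dist (f a) (f b) <= dist a b.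
  apply: (glued_map (F := cayley_pt_map SS')).
  - exact: cayley_dist_ge0.
  - exact: cayley_conn.
  - exact: cayley_mapE.
  - by case=> [g|[[g s] t]] [h|[[h u] v]] //= [] // -> // ->.
  - by case=> [g|[[g s] t]] [h|[[h u] v]].
apply: (admits_CT_of_excess (o := vertex R S 1%g) XP ZP) => M.
have [M1 h1] := back (M + 4); have [M2 h2] := lift M1; have [M3 h3] := forth M2.
exists (M3 + 4) => a b hab.
have [g hg] := vertex_dense gS a; have [h hh] := vertex_dense gS b.
have e1 : excess (@word_dist R G S') 1%g (phi g) (phi h) <= M + 4.
  rewrite (word_dist_vertex R gS') -(gmulf1 (s := phi)).
  have := excess_lip (f (vertex R S 1%g)) (f a) (f b) (f (vertex R S 1%g))
    (f (vertex R S g)) (f (vertex R S h)) ZP.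
  rewrite (pmet_xx ZP) (pmet_sym ZP (f (vertex R S g)) (f a)).
  rewrite (pmet_sym ZP (f (vertex R S h)) (f b)).
  have := le_trans (f_le _ _) hg; have := le_trans (f_le _ _) hh.
  by rewrite /excess !fV; rewrite /excess !fV in hab; move: hab; lra.
have := h3 _ _ _ (h2 _ _ (h1 _ _ _ e1)); rewrite (word_dist_vertex R gS).
have := excess_lip (vertex R S 1%g) (vertex R S g) (vertex R S h) (vertex R S 1%g) a b XP.
by rewrite (pmet_xx XP) /excess; move: hg hh; lra.
Qed.

Theorem theorem3 (R : realType) (V : finType) (Y Y1 : scomplex V)
    (C : complex_of_groups Y) (T : {set edge Y})
    (sub : (Y1 : {set {set V}}) \subset (Y : {set {set V}})) :
  let C1 := restrict_groups sub C in
  let T1 := restrict_tree sub T in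
  let phi := natural_hom sub C T in
  let j := dev_map R sub C T in
  connected_complex Y -> connected_complex Y1 ->
  maximal_tree T -> maximal_tree T1 ->
  developable C T ->
  let cond1 := complex_of_hyperbolic_groups R C T /\
               complex_of_hyperbolic_groups R C1 T1 in
  let cond2 := hyperbolic_group R (pi1 C T) /\
               hyperbolic_group R (pi1 C1 T1) in
  let cond3 := forall s : simplex Y,
    quasiconvex R (range (@loc_map V Y C T s)) in
  let cond4 := injective phi in
  let cond5 := mitra_criterion j in
  (cond1 -> cond2 -> cond3 -> cond4 -> cond5 ->
     group_admits_CT R phi /\
     exists dj : boundary (development R C1 T1) -> boundary (development R C T),
       is_CT_map j dj /\
       (quasiconvex R (range phi) <-> injective dj)) /\
  (cond1 -> cond2 -> cond3 -> cond4 -> qi_embedding j ->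
     quasiconvex R (range phi)).
Proof.
move=> C1 T1 phi j cY cY1 mT mT1 dev cond1 cond2 cond3 cond4 cond5.
suff main : cond1 -> cond2 -> cond3 -> cond4 ->
    (cond5 -> group_admits_CT R phi /\
       exists dj : boundary (development R C1 T1) -> boundary (development R C T),
         is_CT_map j dj /\ (quasiconvex R (range phi) <-> injective dj)) /\
    (qi_embedding j -> quasiconvex R (range phi)).
  by split=> h1 h2 h3 h4; have [] := main h1 h2 h3 h4.
move=> [[_ _ _ _ hypX] [_ _ _ _ hypX1]] [[S gS hS] [S1 gS1 hS1]] qc inj.
have [k dk] := word_chyp gS hS; have [k1 dk1] := word_chyp gS1 hS1.
have [[s sY1] _] := cY1; pose s0 : simplex Y1 := exist _ s sY1.
have [x0 hx0] := ex_std_simplex R s0.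
have [kX1 dX1] := hyperbolic_chyp hypX1; have [kX dX] := hyperbolic_chyp hypX.
have XP1 := chyp_pmet dX1; have XP := chyp_pmet dX.
pose o1 := @orbit_pt R V Y1 C1 T1 s0 x0 hx0.
have jo h : j (o1 h) = @orbit_pt R V Y C T (Defs.incl sub s0) x0 hx0 (phi h).
  exact: dev_map_orbit.
have phi1 : phi 1%g = 1%g by exact: gmulf1.
split=> [mit|qi].
  have jp : excess_proper j (o1 1%g) by exact: mitra_criterion_excess.
  have op := excess_proper_orbit jp.
  split.
    apply: (group_admits_CT_of_excess gS1 gS dk1 dk).
    exact: (orbit_proper_lift hypX hypX1 gS gS1 dk dk1 qc inj op).
  have [dj hdj] := admits_CT_of_excess XP1 XP jp.
  exists dj; split=> //.
  have CTP := CT_injectiveP (o1 1%g) XP1 (chyp_four dX1) XP (chyp_four dX) hdj.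
  split=> [qcH|/CTP h].
    apply/CTP => u v _ _ div M.
    have oe := orbit_excess_of_quasiconvex hx0 hypX hypX1 gS gS1 dk dk1 qc inj qcH.
    (* Points of B1 are replaced by orbit points within [c], which changes an excess by at most 4c
       in B1, and also in B since [j] does not increase distances. *)
    have [c hc] := orbit_dense hypX1 hx0; have [K hK] := oe (M + 4 * c).
    have [n hn] := div (K + 4 * c + 1); exists n => p q np nq.
    rewrite leNgt; apply/negP => lt.
    have [g hg] := hc (u p); have [h hh] := hc (v q).
    have e1 := excess_lip (o1 1%g) (u p) (v q) (o1 1%g) (o1 g) (o1 h) XP1.
    rewrite (pmet_xx XP1) (pmet_sym XP1 (o1 g)) (pmet_sym XP1 (o1 h)) in e1.
    have e2 := excess_lip (j (o1 1%g)) (j (o1 g)) (j (o1 h)) (j (o1 1%g)) (j (u p)) (j (v q)) XP.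
    rewrite (pmet_xx XP) in e2.
    have i1 := dev_map_le hypX1 (u p) (o1 g); have i2 := dev_map_le hypX1 (v q) (o1 h).
    have e3 : excess (@dist R _) (o1 1%g) (o1 g) (o1 h) <= M + 4 * c.
      by move: e1 lt hg hh; clear; lra.
    have e4 := hK 1%g g h e3; rewrite /excess /orbit_dist -!jo in e4.
    have := hn p q np nq; rewrite /excess /= in e2 *.
    by move: e2 e4 i1 i2 hg hh; clear; lra.
  apply: (quasiconvex_of_injective hypX hypX1 gS gS1 dk dk1 qc inj op) => u v du dv duv.
  apply: (h (o1 \o u) (o1 \o v)) => // M; have [n hn] := duv M; exists n => p q np nq.
  by have := hn p q np nq; rewrite -phi1 /= !jo.
(* Both inputs of [quasiconvex_of_injective] are read off the two comparisons of excess: [low] gives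
   the Mitra property on orbits, [up] the injectivity on sequences. *)
have [up low] := qi_embedding_excess hx0 hypX hypX1 qi.
apply: (quasiconvex_of_injective hypX hypX1 gS gS1 dk dk1 qc inj (s0 := s0) (hx0 := hx0)).
  by move=> M; have [N hN] := low M; exists N => a b; rewrite -phi1; exact: hN.
move=> u v _ _ div M; have [K hK] := up M; have [n hn] := div (K + 1).
exists n => p q np nq; rewrite leNgt; apply/negP => /ltW /hK; rewrite phi1.
by have := hn p q np nq; rewrite /=; clear; lra.
Qed.
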